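(* Let $\mathbf r=(r^{\mathtt v},r^e,r^f)$ be an integer vector with $r^f=-1$, $r^e\ge-1$, $r^{\mathtt v}\ge\max\{2r^e,-1\}$, and let $k\ge2r^{\mathtt v}_++1$ be a nonnegative integer, where $r_+^{\mathtt v}=\max\{r^{\mathtt v},0\}$. Let $T$ be a tetrahedron. The shape function space $\mathbb P_k(T;\mathbb R^3)$ is uniquely determined by (i.e. unisolvent with respect to) the degrees of freedom (H0) $\nabla^jv(\mathtt v)$, $\mathtt v\in\Delta_0(T)$, $j=0,1,\dots,r^{\mathtt v}$; (H1) $\int_e\frac{\partial^jv}{\partial n_1^i\partial n_2^{j-i}}\cdot q\,ds$, $e\in\Delta_1(T)$, $q\in\mathbb P_{k-2(r^{\mathtt v}+1)+j}(e)^3$, $0\le i\le j\le r^e$; (H2) $\int_fv\cdot n\,q\,dS$, $q\in\mathbb B_k(f;(r^{\mathtt v},r^e))$, $f\in\Delta_2(T)$; (H3) $\int_Tv\cdot q\,dx$, $q\in\mathbb B_k^{\mathrm{div}}(T;\mathbf r)$. With a mesh $\mathcal T_h$ of $\Omega$, the global $H(\operatorname{div})$-conforming finite element space is defined as $$\mathbb V^{\mathrm{div}}_k(\mathcal T_h;\mathbf r)=\{v\in H(\operatorname{div},\Omega):v|_T\in\mathbb P_k(T;\mathbb R^3)\text{ for all }T\in\mathcal T_h,\ \text{and all the DoFs (H0)–(H3) are single-valued}\}.$$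
   Context: $\Omega\subset\mathbb R^3$ is a domain, $\mathcal T_h$ a conforming tetrahedral mesh of it, and $H(\operatorname{div},\Omega)=\{v\in L^2(\Omega;\mathbb R^3):\operatorname{div}v\in L^2(\Omega)\}$. $\Delta_\ell(T)$ is the set of $\ell$-dimensional subsimplices of $T$. $\mathbb P_j(K)$ is the space of polynomials of degree $\le j$ on $K$, equal to $\{0\}$ if $j<0$, and $\mathbb P_k(T;\mathbb R^3)$ is the space of vector fields on $T$ with components in $\mathbb P_k(T)$. $\nabla^j$ is the tensor of all $j$-th order partial derivatives. For each edge $e$ two linearly independent normal vectors $n_1,n_2$ are fixed and for each face $f$ a normal vector $n$ is fixed; in a mesh they depend only on $e$, resp. $f$, not on the element containing it. With barycentric coordinates $\lambda_0,\dots,\lambda_3$ of $T$, let $\mathbb T_k^3=\{\alpha\in\mathbb N^{4}:|\alpha|=k\}$ and $\lambda^\alpha=\prod_i\lambda_i^{\alpha_i}$; identifying a subsimplex $g$ with its set of vertex indices, put $\operatorname{dist}(\alpha,g)=\sum_{i\notin g}\alpha_i$. Then $\mathbb B_k(T;\mathbf r)=\operatorname{span}\{\lambda^\alpha:\alpha\in\mathbb T_k^3,\ \operatorname{dist}(\alpha,\mathtt v)>r^{\mathtt v},\ \operatorname{dist}(\alpha,e)>r^e,\ \operatorname{dist}(\alpha,f)>r^f$ for all vertices $\mathtt v$, edges $e$, faces $f$ of $T\}$. For a triangular face $f$, $\mathbb B_k(f;(a,b))$ is the span of the degree $k$ monomials $\lambda_f^{\alpha}$ in the barycentric coordinates of $f$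 with $\operatorname{dist}(\alpha,\mathtt v)>a$ for all vertices $\mathtt v$ and $\operatorname{dist}(\alpha,e)>b$ for all edges $e$ of $f$ (dist taken within $f$). $\mathbb B_k^{\mathrm{div}}(T;\mathbf r)=\{v\in\mathbb B_k(T;\mathbf r)^3:v\cdot n=0\text{ on }\partial T\}$. Unisolvent means: taking bases of the test spaces and counting the distinct partial derivatives, the number of DoFs equals $\dim\mathbb P_k(T;\mathbb R^3)$, and a function in $\mathbb P_k(T;\mathbb R^3)$ for which all DoFs vanish is zero. A DoF is single-valued if it takes the same value computed from each tetrahedron containing the associated subsimplex. *)

(* Defs.v *)
From HB Require Import structures.
From mathcomp Require Import all_boot all_order all_algebra.
From mathcomp Require Import all_classical all_reals all_analysis.

Set Implicit Arguments.
Unset Strict Implicit.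
Unset Printing Implicit Defensive.

Import Order.TTheory GRing.Theory Num.Theory.
Import numFieldNormedType.Exports.

Local Open Scope classical_set_scope.
Local Open Scope ring_scope.

Section LinearAlgebra.
Context {R : realType} {V : lmodType R}.

Definition lspan (J : finType) (P : pred J) (b : J -> V) : set V :=
  [set v | exists c : J -> R, v = \sum_(j | P j) c j *: b j].

Definition basis_of_set (m : nat) (b : 'I_m -> V) (S : set V) : Prop :=
  (forall c : 'I_m -> R, \sum_i c i *: b i = 0 -> forall i, c i = 0) /\
  S = lspan predT b.

(* The size of a basis of [S]; 0 by convention if [S] has no finite basis. *)
Definition dimension (S : set V) : nat :=
  xget 0%N [set m | exists b : 'I_m -> V, basis_of_set b S].

End LinearAlgebra.

Section Fields.
Context {R : realType}.

Notation R3 := 'rV[R]_3.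

Definition dot (u w : R3) : R := \sum_c u 0 c * w 0 c.

(* Vector fields whose components all lie in [S]. *)
Definition vec (S : set (R3 -> R)) : set (R3 -> R3) :=
  [set q : R3 -> R3 | forall c, S (fun p => q p 0 c)].

Definition monomial (m : nat) (a : {ffun 'I_3 -> 'I_m.+1}) (p : R3) : R :=
  \prod_c p 0 c ^+ a c.

(* Polynomial functions of degree at most [d] on R^3; {0} when d < 0. *)
Definition poly_le (d : int) : set (R3 -> R) :=
  match d with
  | Posz m => lspan (fun a : {ffun 'I_3 -> 'I_m.+1} => (\sum_c a c <= m)%N)
                   (@monomial m)
  | Negz _ => [set 0]
  end.

(* The space of restrictions to [K] of the functions in [S], a restriction
   being represented by its extension by zero. *)
Definition restr (K : set R3) (S : set (R3 -> R)) : set (R3 -> R) :=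
  [set p \_ K | p in S].

(* P_k(T; R^3). A polynomial on a tetrahedron, which has nonempty interior,
   is identified with the polynomial function on R^3 that extends it. *)
Definition Pvec (k : nat) : set (R3 -> R3) := vec (poly_le k%:Z).

Definition pderiv (W : normedModType R) (s : seq 'I_3) (f : R3 -> W) :
    R3 -> W :=
  foldr (fun c h => 'D_(delta_mx 0 c) h) f s.

Definition dirderiv (W : normedModType R) (u : R3) (i : nat) (f : R3 -> W) :
    R3 -> W :=
  iter i (fun h => 'D_u h) f.

(* R^3 is given Lebesgue measure through the identification of R * R * R
   with row vectors. *)
Definition toR3 (u : R * R * R) : R3 := \row_c [:: u.1.1; u.1.2; u.2]`_c.

Definition leb2 := (@lebesgue_measure R \x @lebesgue_measure R)%E.
Definition leb3 := (leb2 \x @lebesgue_measure R)%E.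

Definition int3 (D : set R3) (f : R3 -> R) : R :=
  \int[leb3]_(u in toR3 @^-1` D) f (toR3 u).

Definition L2 (D : set R3) (f : R3 -> R) : Prop :=
  (f \o toR3) \_ (toR3 @^-1` D) \in Lfun leb3 2%:E.

Definition smooth (f : R3 -> R) : Prop := forall s : seq 'I_3,
  continuous (pderiv s f) /\
  forall c p, derivable (pderiv s f) p (delta_mx 0 c).

Definition test_function (D : set R3) (f : R3 -> R) : Prop :=
  smooth f /\
  exists K : set R3,
    [/\ compact K, K `<=` D & forall p, ~ K p -> f p = 0].

Definition weak_div (D : set R3) (v : R3 -> R3) (g : R3 -> R) : Prop :=
  forall phi, test_function D phi ->
    int3 D (fun p => \sum_c v p 0 c * pderiv [:: c] phi p) =
    - int3 D (fun p => g p * phi p).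

(* H(div, D); an L^2 class is represented by any function in it, with
   irrelevant values outside of [D]. *)
Definition Hdiv (D : set R3) : set (R3 -> R3) :=
  [set v : R3 -> R3 | (forall c, L2 D (fun p => v p 0 c)) /\
           exists2 g, L2 D g & weak_div D v g].

Definition is_domain (D : set R3) : Prop :=
  [/\ open D, connected D & D !=set0].

End Fields.

(* The rows of [x] are points of R^3. A simplex is the set of the indices of
   its vertices, so that its subsimplices are its nonempty subsets. *)
Section Simplices.
Context {R : realType} {n : nat}.
Variable x : 'M[R]_(n, 3).

Notation R3 := 'rV[R]_3.
Implicit Types (g T e f : {set 'I_n}) (r : seq int) (k : nat).

Definition barycentric g (p : R3) : set 'rV[R]_n :=
  [set l : 'rV[R]_n | [/\ forall i, i \notin g -> l 0 i = 0,
               \sum_i l 0 i = 1 & l *m x = p]].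

(* Barycentric coordinates of [p] with respect to [g] (the i-th entry is
   lambda_i for i in [g] and 0 otherwise). They are meaningful when [g] is
   affinely independent and [p] belongs to its affine hull. *)
Definition bary g (p : R3) : 'rV[R]_n := xget 0 (barycentric g p).

Definition simplex g : set R3 :=
  [set p | exists2 l, barycentric g p l & forall i, 0 <= l 0 i].

Definition affinely_independent g : Prop := forall l : 'rV[R]_n,
  (forall i, i \notin g -> l 0 i = 0) ->
  \sum_i l 0 i = 0 -> l *m x = 0 -> l = 0.

Definition tetrahedron T : Prop := #|T| = 4%N /\ affinely_independent T.

(* Delta_l(T) *)
Definition Delta (l : nat) T : pred {set 'I_n} :=
  fun g => (g \subset T) && (#|g| == l.+1).

(* The degree k multi-indices a of [g] with dist(a, s) > r_l for all
   l-dimensional subsimplices s of [g], 0 <= l < size r. *)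
Definition bubble_index r g k (a : {ffun 'I_n -> 'I_k.+1}) : bool :=
  [&& [forall i, (i \notin g) ==> (a i == 0%N :> nat)],
      (\sum_i a i == k)%N &
      [forall s : {set 'I_n},
        (s \subset g) && (0 < #|s| <= size r)%N ==>
        (r`_(#|s|.-1) < (\sum_(i | i \notin s) a i)%N%:Z)]].

Definition bernstein g k (a : {ffun 'I_n -> 'I_k.+1}) (p : R3) : R :=
  \prod_i bary g p 0 i ^+ a i.

(* B_k(g; r), with r = (r_0, ..., r_m) listing one entry per dimension *)
Definition bubble k g r : set (R3 -> R) :=
  lspan (bubble_index r g (k := k)) (bernstein g (k := k)).

(* The normal vectors of edges and faces. Being indexed by the edge or face
   itself, they are the same for all the tetrahedra containing it. *)
Variables (n1 n2 nf : {set 'I_n} -> R3).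

Definition orthogonal_to g (u : R3) : Prop :=
  forall i j, i \in g -> j \in g -> dot (row i x - row j x) u = 0.

Definition normals_of T : Prop :=
  (forall e, Delta 1 T e ->
     [/\ orthogonal_to e (n1 e), orthogonal_to e (n2 e) &
         row_free (col_mx (n1 e) (n2 e))]) /\
  (forall f, Delta 2 T f -> orthogonal_to f (nf f) /\ nf f != 0).

(* B_k^div(T; r) *)
Definition bubble_div k T r : set (R3 -> R3) :=
  [set v : R3 -> R3 | vec (bubble k T r) v /\
           forall f, Delta 2 T f -> forall p, simplex f p ->
             dot (v p) (nf f) = 0].

Definition vertex g (i : nat) : R3 := nth 0 [seq row j x | j <- enum g] i.

(* Arc length integral over an edge and surface integral over a face, by
   affine parametrization over the unit interval and the unit triangle. *)
Definition int1 e (h : R3 -> R) : R :=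
  let u := vertex e 1 - vertex e 0 in
  Num.sqrt (dot u u) *
  \int[@lebesgue_measure R]_(t in `[0, 1]) h (vertex e 0 + t *: u).

Definition int2 f (h : R3 -> R) : R :=
  let u := vertex f 1 - vertex f 0 in
  let w := vertex f 2 - vertex f 0 in
  Num.sqrt (dot u u * dot w w - dot u w ^+ 2) *
  \int[leb2]_(t in [set t : R * R | [/\ 0 <= t.1, 0 <= t.2 & t.1 + t.2 <= 1]])
     h (vertex f 0 + t.1 *: u + t.2 *: w).

Variables (rv re rf : int) (k : nat).

Definition edge_test (j : nat) e : set (R3 -> R3) :=
  vec (restr (simplex e) (poly_le (k%:Z - 2 * (rv + 1) + j%:Z))).

Definition face_test f : set (R3 -> R) :=
  restr (simplex f) (bubble k f [:: rv; re]).

Definition cell_test T : set (R3 -> R3) := bubble_div k T [:: rv; re; rf].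

(* The degrees of freedom associated with the subsimplex [g]; the entries of
   the tensor of derivatives of order j are indexed by sequences of j
   coordinates. *)
Inductive dof (g : {set 'I_n}) : ((R3 -> R3) -> R) -> Prop :=
| DofH0 (i : 'I_n) (s : seq 'I_3) (c : 'I_3) :
    g = [set i]%SET -> (size s)%:Z <= rv ->
    dof g (fun v => pderiv s v (row i x) 0 c)
| DofH1 (i j : nat) (q : R3 -> R3) :
    #|g| = 2%N -> (i <= j)%N -> j%:Z <= re -> edge_test j g q ->
    dof g (fun v => int1 g (fun p =>
      dot (dirderiv (n1 g) i (dirderiv (n2 g) (j - i) v) p) (q p)))
| DofH2 (q : R3 -> R) :
    #|g| = 3%N -> face_test g q ->
    dof g (fun v => int2 g (fun p => dot (v p) (nf g) * q p))
| DofH3 (q : R3 -> R3) :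
    #|g| = 4%N -> cell_test g q ->
    dof g (fun v => int3 (simplex g) (fun p => dot (v p) (q p))).

(* Distinct partial derivatives of order j correspond to nondecreasing
   sequences of coordinates. *)
Definition num_partials (j : nat) : nat :=
  #|[pred s : j.-tuple 'I_3 | sorted leq [seq val c | c <- s]]|.

Definition num_dofs T : nat :=
  (\sum_(g | Delta 0 T g) \sum_(j < `|(rv + 1)%R|) num_partials j * 3 +
   \sum_(e | Delta 1 T e) \sum_(j < `|(re + 1)%R|) \sum_(i < j.+1)
      dimension (edge_test j e) +
   \sum_(f | Delta 2 T f) dimension (V := R3 -> R^o) (face_test f) +
   dimension (cell_test T))%N.

Definition conforming_mesh (D : set R3) (Th : {set {set 'I_n}}) : Prop :=
  [/\ forall T, T \in Th -> tetrahedron T,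
      forall T T', T \in Th -> T' \in Th ->
        simplex T `&` simplex T' = simplex (T :&: T')%SET &
      closure D = [set p | exists2 T, T \in Th & simplex T p]].

(* The global space; [p T] is the restriction of [v] to [T]. *)
Definition Vdiv (D : set R3) (Th : {set {set 'I_n}}) : set (R3 -> R3) :=
  [set v : R3 -> R3 | Hdiv D v /\
     exists p : {set 'I_n} -> (R3 -> R3),
       (forall T, T \in Th -> Pvec k (p T) /\
          {ae leb3, forall u, simplex T (toR3 u) ->
             v (toR3 u) = p T (toR3 u)}) /\
       (forall T T' g, T \in Th -> T' \in Th -> g \subset T -> g \subset T' ->
          forall N, dof g N -> N (p T) = N (p T'))].

End Simplices.

(* Main.v *)
(* Expand v in the Bernstein basis of T. By (H0) the coefficients of the indices
   at distance <= r^v from a vertex vanish. Near an edge, the lowest normal jet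
   of order j <= r^e is then (lambda_0 lambda_1)^(r^v+1-j) times a polynomial of
   degree k-2(r^v+1)+j; testing (H1) with that polynomial kills it, hence all the
   coefficients at distance <= r^e from an edge. What remains lies in
   B_k(T; r)^3: on a face f, v.n belongs to B_k(f; (r^v, r^e)) and is its own
   test function in (H2), so that v belongs to B_k^div(T; r) and is its own test
   function in (H3).
   For the count, every index is near exactly one vertex, or else near exactly
   one edge, or else a bubble index, and
   dim B_k^div(T; r) = 3 dim B_k(T; r) - sum_f dim B_k(f; (r^v, r^e)):
   the conditions v.n = 0 on the faces are independent, because an index lies on
   at most three faces and the normals of three faces are independent. *)

Require Import Defs.
From HB Require Import structures.
From mathcomp Require Import all_boot all_order all_algebra.
From mathcomp Require Import all_classical all_reals all_analysis.
From mathcomp Require Import ring lra zify.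

Import Order.TTheory GRing.Theory Num.Theory.
Import numFieldNormedType.Exports.

Local Open Scope classical_set_scope.
Local Open Scope ring_scope.
Set Implicit Arguments.
Unset Strict Implicit.
Unset Printing Implicit Defensive.

(** Both coefficient steps rest on one computation. On a line p + t u through a point p of a
    subsimplex g, each lambda_i with i off g is t times a component of u, so lambda^a carries the
    factor t^dist(a, g). Once the coefficients at distance below d are known to vanish, the d-th
    derivative along u is, up to d!, a polynomial in the coordinates of p on g and the components of
    u off g, and its coefficients are exactly those at distance d. Restricting u to be orthogonal to
    an edge costs nothing: a multiple of the tangent can be subtracted, which only changes
    components on the edge. The shape functions are functions, not formal polynomials, so every
    independence statement has to come from values. Points with positive barycentric coordinates
    suffice for this, and they are also the points at which a vanishing integral of a nonnegative
    continuous function forces the integrand to vanish. *)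

(** * Dimensions of spans and of subspaces cut out by linear conditions *)

Section Dimension.
Context {R : realType} {V : lmodType R}.

Definition free_on (J : finType) (P : pred J) (b : J -> V) : Prop :=
  forall c : J -> R, \sum_(j | P j) c j *: b j = 0 -> forall j, P j -> c j = 0.

(** The coordinates of [b'] in [b] form an m' by m matrix; a relation between its rows would be a
    relation between the [b' i], so its rank is m'. *)
Lemma basis_size_le (m m' : nat) (b : 'I_m -> V) (b' : 'I_m' -> V) S :
  basis_of_set b S -> basis_of_set b' S -> (m' <= m)%N.
Proof.
move=> [fb Sb] [fb' Sb'].
have /choice[A bA] : forall i, exists c : 'I_m -> R, b' i = \sum_j c j *: b j.
  move=> i; have : S (b' i).
    rewrite Sb'; exists (fun j => (j == i)%:R).
    rewrite (bigD1 i) //= eqxx scale1r big1 ?addr0 // => j /negPf ->.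
    by rewrite scale0r.
  by rewrite Sb => -[c ->]; exists c.
pose M : 'M[R]_(m', m) := \matrix_(i, j) A i j.
suff /eqP <- : row_free M by exact: rank_leq_col.
apply: inj_row_free => r rM0; apply/rowP => i; rewrite mxE.
apply: (fb' (fun i => r 0 i)).
under eq_bigr do rewrite bA scaler_sumr.
rewrite exchange_big /= big1 // => j _.
under eq_bigr do rewrite scalerA.
rewrite -scaler_suml.
have /rowP/(_ j) := rM0; rewrite !mxE; under eq_bigr do rewrite mxE.
by move=> ->; rewrite scale0r.
Qed.

Lemma dimension_basis (m : nat) (b : 'I_m -> V) S :
  basis_of_set b S -> dimension S = m.
Proof.
move=> bS; rewrite /dimension.
apply: xget_unique; first by exists b.
by move=> m' [b' bS']; apply/eqP; rewrite eqn_leq (basis_size_le bS bS') (basis_size_le bS' bS).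
Qed.

(** Rank-nullity for coefficient vectors: solvability for every right-hand side means that the
    matrix of the conditions has full column rank, and the free family [b] carries its kernel to the
    space. Meant for the normal conditions of B_k^div; a sum in the conclusion avoids truncated
    subtraction. *)
Lemma dimension_constrained (J Q : finType) (P : pred J) (P' : pred Q)
    (b : J -> V) (l : J -> Q -> R) :
  free_on P b ->
  (forall d : Q -> R, exists c : J -> R,
     forall q, P' q -> \sum_(j | P j) c j * l j q = d q) ->
  addn (dimension [set v | exists2 c : J -> R, v = \sum_(j | P j) c j *: b j &
      forall q, P' q -> \sum_(j | P j) c j * l j q = 0]) #|P'| = #|P|.
Proof.
move=> fb surj; set S := [set v | _].
pose M : 'M[R]_(#|P|, #|P'|) := \matrix_(i, q) l (enum_val i) (enum_val q).
have sumP (F : J -> V) : \sum_(j | P j) F j = \sum_(i < #|P|) F (enum_val i).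
  exact: (@big_enum_val _ _ _ _ P F).
have sumPR (F : J -> R) : \sum_(j | P j) F j = \sum_(i < #|P|) F (enum_val i).
  exact: (@big_enum_val _ _ _ _ P F).
pose ext (r : 'rV[R]_(#|P|)) j : R :=
  if [pick i | enum_val i == j] is Some i then r 0 i else 0.
have extE r i : ext r (enum_val i) = r 0 i.
  rewrite /ext; case: pickP => [i' /eqP/enum_val_inj -> //|/(_ i)].
  by rewrite eqxx.
(* Solving for the unit vector at [q0] puts each row of the identity into the row space of M. *)
have rM : \rank M = #|P'|.
  apply/eqP; rewrite -/(row_full M) -sub1mx; apply/row_subP => q0.
  have [c cq] := surj (fun q => (q == enum_val q0)%:R).
  apply/submxP; exists (\row_i c (enum_val i)).
  apply/rowP => q; rewrite !mxE.
  have /cq := enum_valP q; rewrite sumPR (inj_eq enum_val_inj) eq_sym => <-.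
  by under [RHS]eq_bigr do rewrite !mxE.
pose B := row_base (kermx M).
have fB : row_free B by exact: row_base_free.
pose b' (i : 'I_(\rank (kermx M))) : V := \sum_j B i j *: b (enum_val j).
have comb (r : 'rV[R]_(\rank (kermx M))) : \sum_i r 0 i *: b' i = \sum_j (r *m B) 0 j *: b (enum_val j).
  under eq_bigr do rewrite scaler_sumr.
  rewrite exchange_big /=; apply: eq_bigr => j _.
  by rewrite mxE scaler_suml; apply: eq_bigr => i _; rewrite scalerA.
have kerP c : (\row_i c (enum_val i) <= kermx M)%MS <->
    forall q, P' q -> \sum_(j | P j) c j * l j q = 0.
  split.
    move/sub_kermxP => cM q Pq; have := Pq; rewrite -[P' q]/(q \in P') => qP.
    have /rowP/(_ (enum_rank_in qP q)) := cM; rewrite !mxE sumPR => e; rewrite -[RHS]e.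
    by apply: eq_bigr => i _; rewrite !mxE enum_rankK_in.
  move=> h; apply/sub_kermxP/rowP => q; rewrite !mxE.
  have /h := enum_valP q; rewrite sumPR => e; rewrite -[RHS]e.
  by apply: eq_bigr => i _; rewrite !mxE.
have bS : basis_of_set b' S.
  split.
    move=> c h i; have := comb (\row_i c i).
    under eq_bigr do rewrite mxE.
    rewrite h => /esym; set r := \row_i c i => e.
    have rB : r *m B = 0.
      apply/rowP => j; rewrite [RHS]mxE -extE.
      apply: fb; last exact: enum_valP.
      by rewrite sumP -[RHS]e; apply: eq_bigr => j' _; rewrite extE.
    have /eqP : r = 0 by apply: (row_free_inj fB); rewrite rB mul0mx.
    by move/eqP/rowP/(_ i); rewrite !mxE.
  apply/seteqP; split => v.
    move=> [c -> /kerP]; rewrite -(eq_row_base (kermx M)) => /submxP[r rE].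
    exists (fun i => r 0 i); rewrite comb -/B -rE sumP.
    by apply: eq_bigr => i _; rewrite mxE.
  move=> [c ->]; exists (ext ((\row_i c i) *m B)).
    rewrite sumP; transitivity (\sum_i (\row_i c i) 0 i *: b' i).
      by apply: eq_bigr => i _; rewrite mxE.
    by rewrite comb; apply: eq_bigr => i _; rewrite extE.
  apply/kerP; have -> : \row_i ext ((\row_i0 c i0) *m B) (enum_val i) = (\row_i0 c i0) *m B.
    by apply/rowP => i; rewrite mxE extE.
  by rewrite -(eq_row_base (kermx M)) submxMl.
by rewrite (dimension_basis bS) mxrank_ker rM subnK // -rM rank_leq_row.
Qed.

Lemma dimension_lspan (J : finType) (P : pred J) (b : J -> V) :
  free_on P b -> dimension (lspan P b) = #|P|.
Proof.
move=> fb; have := dimension_constrained (P' := @pred0 void) (l := fun _ _ => 0) fb.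
rewrite card0 addn0 => <-; last by move=> d; exists (fun=> 0).
by congr dimension; apply/seteqP; split=> v [c]; exists c.
Qed.

End Dimension.

(** * Spans of functions and of vector fields *)

Section LinearSpan.
Context {R : realType} {V : lmodType R} (J : finType) (P : pred J) (b : J -> V).

Lemma lspan0 : lspan P b 0.
Proof. by exists (fun=> 0); rewrite big1 // => j _; rewrite scale0r. Qed.

Lemma lspanD v w : lspan P b v -> lspan P b w -> lspan P b (v + w).
Proof.
move=> [c ->] [d ->]; exists (fun j => c j + d j).
by rewrite -big_split; apply: eq_bigr => j _; rewrite scalerDl.
Qed.

Lemma lspanZ a v : lspan P b v -> lspan P b (a *: v).
Proof.
move=> [c ->]; exists (fun j => a * c j).
by rewrite scaler_sumr; apply: eq_bigr => j _; rewrite scalerA.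
Qed.

Lemma lspan_sum (I : finType) (Q : pred I) (F : I -> V) :
  (forall i, Q i -> lspan P b (F i)) -> lspan P b (\sum_(i | Q i) F i).
Proof. by move=> h; apply: big_ind => //; [exact: lspan0|exact: lspanD]. Qed.

Lemma lspan_gen j : P j -> lspan P b (b j).
Proof.
move=> Pj; exists (fun i => (i == j)%:R).
rewrite (bigD1 j) //= eqxx scale1r big1 ?addr0 // => i /andP[_ /negPf ->].
by rewrite scale0r.
Qed.

End LinearSpan.

Section FieldSpan.
Context {R : realType}.
Notation R3 := 'rV[R]_3.
Variables (J : finType) (P : pred J) (b : J -> R3 -> R^o).

Lemma lspan_pointwise (f : R3 -> R^o) :
  lspan P b f <-> exists c : J -> R, forall p, f p = \sum_(j | P j) c j * b j p.
Proof.
split=> [[c ->]|[c fc]]; exists c; first by move=> p; rewrite fct_sumE.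
by apply/funext => p; rewrite fc fct_sumE.
Qed.

Lemma free_pointwise :
  (forall c : J -> R, (forall p, \sum_(j | P j) c j * b j p = 0) ->
     forall j, P j -> c j = 0) -> free_on P b.
Proof.
move=> h c e; apply: h => p.
by have /(congr1 (fun f => f p)) := e; rewrite fct_sumE.
Qed.

Definition field_basis (jc : J * 'I_3) : R3 -> R3 :=
  fun p => b jc.1 p *: delta_mx 0 jc.2.

Lemma field_basisE (C : J * 'I_3 -> R) (p : R3) c :
  (\sum_(jc | P jc.1) C jc *: field_basis jc) p 0 c = \sum_(j | P j) C (j, c) * b j p.
Proof.
have -> : \sum_(jc | P jc.1) C jc *: field_basis jc =
    \sum_(j | P j) \sum_d C (j, d) *: field_basis (j, d).
  by rewrite pair_big; apply: eq_big => [jc|[j d] _] //; rewrite andbT.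
rewrite fct_sumE summxE; apply: eq_bigr => j _.
rewrite fct_sumE summxE (bigD1 c) //= big1 ?addr0; last first.
  by move=> d dc; rewrite !mxE eqxx (eq_sym c) (negPf dc) !mulr0.
by rewrite /field_basis /= !mxE !eqxx mulr1.
Qed.

Lemma vec_lspan (v : R3 -> R3) :
  vec (lspan P b) v <-> exists C, v = \sum_(jc | P jc.1) C jc *: field_basis jc.
Proof.
split=> [vS|[C ->] c]; last first.
  by apply/lspan_pointwise; exists (fun j => C (j, c)) => p; rewrite field_basisE.
have /choice[C CE] : forall c, exists C : J -> R, forall p, v p 0 c = \sum_(j | P j) C j * b j p.
  by move=> c; have /lspan_pointwise := vS c.
exists (fun jc => C jc.2 jc.1).
by apply/funext => p; apply/rowP => c; rewrite field_basisE CE.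
Qed.

Hypothesis fb : free_on P b.

Lemma free_field_basis : free_on (fun jc => P jc.1) field_basis.
Proof.
move=> C e [j c] Pj; apply: (fb (c := fun j => C (j, c))) => //.
apply/funext => p; rewrite fct_sumE.
have /(congr1 (fun f : R3 -> R3 => f p 0 c)) := e; rewrite field_basisE => e'.
by rewrite [LHS]e' mxE.
Qed.

Lemma card_field_basis : #|[pred jc : J * 'I_3 | P jc.1]| = (#|P| * 3)%N.
Proof.
rewrite -[X in (_ * X)%N]card_ord -cardX.
by apply: eq_card => -[j c]; rewrite !inE andbT.
Qed.

Lemma dimension_vec : dimension (vec (lspan P b)) = (#|P| * 3)%N.
Proof.
rewrite -card_field_basis -(dimension_lspan free_field_basis).
by congr dimension; apply/seteqP; split=> v /vec_lspan.
Qed.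

End FieldSpan.

(** * Linear independence of monomials through their values *)

Lemma digits_inj (n B : nat) (f g : 'I_n -> nat) :
  (forall i, f i < B)%N -> (forall i, g i < B)%N ->
  (\sum_i f i * B ^ i = \sum_i g i * B ^ i)%N -> f =1 g.
Proof.
have lt m (h : 'I_m -> nat) : (forall i, h i < B)%N -> (\sum_i h i * B ^ i < B ^ m)%N.
  elim: m h => [|m IH] h hB; first by rewrite big_ord0.
  rewrite big_ord_recr /= expnS.
  have := IH (fun i => h (widen_ord (leqnSn m) i)) (fun i => hB _).
  have := hB ord_max; set s := (\sum_(_ < _) _)%N; set q := (B ^ m)%N.
  move: (h ord_max) => z zB sq.
  have : (z.+1 * q <= B * q)%N by rewrite leq_mul2r zB orbT.
  by rewrite mulSn; apply: leq_trans; rewrite ltn_add2r.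
elim: n f g => [|n IH] f g fB gB; first by move=> _ [].
rewrite !big_ord_recr /= => e.
have lf := lt _ (fun i => f (widen_ord (leqnSn n) i)) (fun i => fB _).
have lg := lt _ (fun i => g (widen_ord (leqnSn n) i)) (fun i => gB _).
have q0 : (0 < B ^ n)%N by rewrite expn_gt0 (leq_ltn_trans _ (fB ord_max)).
(* The leading digit is the quotient by B^n, since the lower digits add up to less than B^n. *)
have eM : f ord_max = g ord_max.
  have dE z w : (z < B ^ n -> (z + w * B ^ n) %/ B ^ n = w)%N.
    by move=> zl; rewrite addnC divnMDl // divn_small // addn0.
  by have := congr1 (divn^~ (B ^ n)%N) e; rewrite !dE.
have eW : (fun i => f (widen_ord (leqnSn n) i)) =1 (fun i => g (widen_ord (leqnSn n) i)).
  by apply: IH => //; move: e; rewrite eM => /addIn.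
move=> i; case: (unliftP ord_max i) => [j|] -> //.
have -> : lift ord_max j = widen_ord (leqnSn n) j by apply/val_inj; rewrite /= /bump leqNgt ltn_ord.
exact: eW.
Qed.

(** The integers 1, ..., size q are already too many roots. Only positive arguments are assumed
    because the points substituted later must have positive coordinates. *)
Lemma poly_pos_roots (R : realType) (q : {poly R}) :
  (forall t, 0 < t -> q.[t] = 0) -> q = 0.
Proof.
move=> h; apply/eqP/negP => /negP q0.
have := max_poly_roots (rs := [seq (i.+1)%:R | i <- iota 0 (size q)]) q0.
rewrite size_map size_iota ltnn => no; suff: false by []; apply: no.
  by apply/allP => _ /mapP[i _ ->]; rewrite /root h ?ltr0Sn.
rewrite map_inj_uniq ?iota_uniq // => i j /eqP.
by rewrite eqr_nat eqSS => /eqP.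
Qed.

(* Substituting y_i = t^((k+1)^i) separates the monomials. *)
Lemma monomial_free (R : realType) (n k : nat) (P : pred {ffun 'I_n -> 'I_k.+1})
    (c : {ffun 'I_n -> 'I_k.+1} -> R) :
  (forall y : 'I_n -> R, (forall i, 0 < y i) ->
     \sum_(a | P a) c a * \prod_i y i ^+ a i = 0) ->
  forall a, P a -> c a = 0.
Proof.
move=> h a Pa.
pose N (a : {ffun 'I_n -> 'I_k.+1}) := (\sum_i a i * k.+1 ^ i)%N.
have Ninj a1 a2 : N a1 = N a2 -> a1 = a2.
  move=> e; apply/ffunP => i; apply/val_inj.
  by apply: (digits_inj (f := fun i => a1 i) (g := fun i => a2 i) _ _ e) => j; exact: ltn_ord.
pose q : {poly R} := \sum_(a | P a) c a *: 'X^(N a).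
have q0 : q = 0.
  apply: poly_pos_roots => t t0; rewrite /q horner_sum.
  rewrite -[RHS](h (fun i => t ^+ (k.+1 ^ i)%N)); last by move=> i; exact: exprn_gt0.
  apply: eq_bigr => b _; rewrite hornerZ hornerXn /N; congr (_ * _).
  rewrite -prodrXr; apply: eq_bigr => i _.
  by rewrite -exprM mulnC.
have /(congr1 (fun p : {poly R} => p`_(N a))) := q0.
rewrite coef0 coef_sum (bigD1 a) //= coefZ coefXn eqxx mulr1 big1 ?addr0 //.
move=> b /andP[_ ba]; rewrite coefZ coefXn.
by case: eqP => [/Ninj e|]; rewrite ?mulr0 //; rewrite e eqxx in ba.
Qed.

(** [bubble_index] without its distance conditions: the indices of the whole Bernstein basis of
    degree k on g. *)
Definition multi_index {n : nat} (g : {set 'I_n}) (k : nat) : pred {ffun 'I_n -> 'I_k.+1} :=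
  fun a => [forall i, (i \notin g) ==> (a i == 0%N :> nat)] && (\sum_i a i == k)%N.

Lemma multi_indexP (n : nat) (g : {set 'I_n}) (k : nat) (a : {ffun 'I_n -> 'I_k.+1}) :
  reflect ((forall i, i \notin g -> a i = 0%N :> nat) /\ (\sum_i a i)%N = k) (multi_index g a).
Proof.
apply: (iffP andP) => [[/forallP h /eqP ->]|[h /eqP ->]].
  by split=> // i ig; have /implyP/(_ ig)/eqP := h i.
by split=> //; apply/forallP => i; apply/implyP => /h ->.
Qed.

Lemma multi_index_ex (n : nat) (g : {set 'I_n}) (k : nat) (a : 'I_n -> nat) :
  (forall i, i \notin g -> a i = 0%N) -> (\sum_i a i)%N = k ->
  exists2 b : {ffun 'I_n -> 'I_k.+1}, multi_index g b & forall i, b i = a i :> nat.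
Proof.
move=> ag sa.
have ak i : (a i < k.+1)%N by rewrite ltnS -sa (bigD1 i) //= leq_addr.
exists [ffun i => Ordinal (ak i)]; last by move=> i; rewrite ffunE.
apply/multi_indexP; split=> [i /ag|]; first by rewrite ffunE.
by rewrite -[RHS]sa; apply: eq_bigr => i _; rewrite ffunE.
Qed.

(** * Homogeneous polynomials in given generators *)

Section HomogeneousSpan.
Context {R : realType}.
Notation R3 := 'rV[R]_3.

(** Homogeneous polynomials of degree k in the functions [u i]. In this inductive form a linear
    change of generators is a plain induction, with no power of a sum to expand over
    multi-indices. *)
Inductive hspan (I : Type) (u : I -> R3 -> R) : nat -> (R3 -> R) -> Prop :=
| HspanC a : hspan u 0 (fun=> a)
| Hspan0 k : hspan u k (fun=> 0)
| HspanD k f h : hspan u k f -> hspan u k h -> hspan u k (fun p => f p + h p)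
| HspanM k i f : hspan u k f -> hspan u k.+1 (fun p => u i p * f p).

Lemma hspanZ (I : Type) (u : I -> R3 -> R) k a f :
  hspan u k f -> hspan u k (fun p => a * f p).
Proof.
elim=> {k f} [b|k|k f h _ fI _ hI|k i f _ fI].
- exact: HspanC.
- by rewrite (_ : (fun _ => _) = (fun=> 0)); [exact: Hspan0|apply/funext => p; rewrite mulr0].
- rewrite (_ : (fun _ => _) = (fun p => a * f p + a * h p)); first exact: HspanD.
  by apply/funext => p; rewrite mulrDr.
- rewrite (_ : (fun _ => _) = (fun p => u i p * (a * f p))); first exact: HspanM.
  by apply/funext => p; rewrite mulrCA.
Qed.

Lemma hspan_sum (I : Type) (u : I -> R3 -> R) k (J : finType) (P : pred J) (F : J -> R3 -> R) :
  (forall j, P j -> hspan u k (F j)) -> hspan u k (fun p => \sum_(j | P j) F j p).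
Proof.
move=> h.
rewrite (_ : (fun p => _) = (\sum_(j | P j) (F j : R3 -> R^o))); last first.
  by apply/funext => p; rewrite fct_sumE.
apply: (big_ind (hspan u k)) => //; first exact: Hspan0.
by move=> f1 f2; exact: HspanD.
Qed.

(** Used in both directions between the generators x_1, x_2, x_3, 1 and the barycentric coordinates,
    to identify P_k with the span of the Bernstein polynomials. *)
Lemma hspan_change (I : finType) (J : Type) (u : I -> R3 -> R) (w : J -> R3 -> R) :
  (forall j, exists c : I -> R, forall p, w j p = \sum_i c i * u i p) ->
  forall k f, hspan w k f -> hspan u k f.
Proof.
move=> wu k f; elim=> {k f} [b|k|k f h _ fI _ hI|k j f _ fI].
- exact: HspanC.
- exact: Hspan0.
- exact: HspanD.
- have [c wc] := wu j.
  rewrite (_ : (fun _ => _) = (fun p => \sum_i c i * (u i p * f p))).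
    by apply: hspan_sum => i _; apply: hspanZ; exact: HspanM.
  by apply/funext => p; rewrite wc mulr_suml; apply: eq_bigr => i _; rewrite mulrA.
Qed.

Lemma hspanX (I : Type) (u : I -> R3 -> R) i m k f :
  hspan u k f -> hspan u (m + k) (fun p => u i p ^+ m * f p).
Proof.
move=> h; elim: m => [|m IH].
  by rewrite (_ : (fun _ => _) = f) //; apply/funext => p; rewrite expr0 mul1r.
rewrite (_ : (fun _ => _) = (fun p => u i p * (u i p ^+ m * f p))).
  exact: HspanM.
by apply/funext => p; rewrite exprS mulrA.
Qed.

Lemma hspan_prod (I : finType) (u : I -> R3 -> R) (a : I -> nat) :
  hspan u (\sum_i a i)%N (fun p => \prod_i u i p ^+ a i).
Proof.
elim: (index_enum I) => [|i s IH].
  rewrite big_nil (_ : (fun _ => _) = fun=> 1); first exact: HspanC.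
  by apply/funext => p; rewrite big_nil.
rewrite big_cons (_ : (fun _ => _) = fun p => u i p ^+ a i * \prod_(j <- s) u j p ^+ a j).
  exact: hspanX.
by apply/funext => p; rewrite big_cons.
Qed.

(** Multiplication by [u i] raises one entry of each index when i is in g and gives zero otherwise;
    barycentric coordinates vanish off g in the same way. *)
Lemma hspan_multi_index (n : nat) (g : {set 'I_n}) (u : 'I_n -> R3 -> R) k f :
  (forall i, i \notin g -> u i = fun=> 0) ->
  hspan u k f <-> lspan (multi_index g (k := k)) (fun a p => \prod_i u i p ^+ a i : R^o) f.
Proof.
move=> ug; split; last first.
  move=> /lspan_pointwise[c fc].
  rewrite (_ : f = (fun p => \sum_(a | multi_index g a) c a * \prod_i u i p ^+ a i)); last first.
    exact/funext.
  apply: hspan_sum => a /multi_indexP[_ ak]; apply: hspanZ.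
  by rewrite -{1}ak; exact: hspan_prod.
elim=> {k f} [b|k|k f h _ fI _ hI|k i f _ fI].
- apply/lspan_pointwise.
  have [a0 aP a0E] := @multi_index_ex n g 0 (fun=> 0%N) (fun _ _ => erefl) (big1_eq _ _).
  exists (fun a => if a == a0 then b else 0) => p.
  rewrite (bigD1 a0 aP) /= eqxx [X in _ + X]big1; last by move=> a /andP[_ /negPf ->]; rewrite mul0r.
  by rewrite big1 ?mulr1 ?addr0 // => i _; rewrite a0E.
- exact: lspan0.
- exact: lspanD.
- have [ig|/ug ->] := boolP (i \in g); last first.
    rewrite (_ : (fun _ => _) = (0 : R3 -> R^o)); first exact: lspan0.
    by apply/funext => p; rewrite mul0r.
  have /lspan_pointwise[c fc] := fI.
  rewrite (_ : (fun _ => _) =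
      \sum_(a | multi_index g a) c a *: (fun p => u i p * \prod_j u j p ^+ a j : R^o)); last first.
    apply/funext => p; rewrite fc fct_sumE mulr_sumr; apply: eq_bigr => a _.
    by rewrite mulrCA.
  apply: lspan_sum => a /multi_indexP[ag ak]; apply: lspanZ.
  have [b bP bE] : exists2 b : {ffun 'I_n -> 'I_k.+2}, multi_index g b &
      forall j, b j = (a j + (j == i))%N :> nat.
    apply: multi_index_ex => [j jg|].
      by rewrite ag // (_ : j == i = false) //; apply: contraNF jg => /eqP ->.
    rewrite big_split /= ak (bigD1 i) //= eqxx big1 ?addn0 ?addn1 //.
    by move=> j /negPf ->.
  rewrite (_ : (fun _ => _) = (fun p => \prod_j u j p ^+ b j)); first exact: lspan_gen.
  apply/funext => p; rewrite (bigD1 i) //= [RHS](bigD1 i) //= !bE eqxx addn1 exprS mulrA.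
  by congr (_ * _); apply: eq_bigr => j /negPf ji; rewrite bE ji addn0.
Qed.

(* The constant 1 homogenizes the polynomials. *)
Definition affine_gen (i : 'I_4) (p : R3) : R := if unlift ord_max i is Some c then p 0 c else 1.

Lemma monomial_poly_le (m : nat) (a : 'I_3 -> nat) :
  (\sum_c a c <= m)%N -> poly_le m%:Z (fun p : R3 => \prod_c p 0 c ^+ a c).
Proof.
move=> am.
have ac c : (a c < m.+1)%N by rewrite ltnS (leq_trans _ am) // (bigD1 c) //= leq_addr.
rewrite /poly_le (_ : (fun _ => _) = monomial [ffun c => Ordinal (ac c)]).
  apply: lspan_gen; rewrite (eq_bigr a) // => c _; by rewrite ffunE.
by apply/funext => p; apply: eq_bigr => c _; rewrite ffunE.
Qed.

Lemma poly_le_hspan (m : nat) (f : R3 -> R) : poly_le m%:Z f <-> hspan affine_gen m f.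
Proof.
split.
  move=> /lspan_pointwise[c fc].
  rewrite (_ : f = fun p => \sum_(a : {ffun 'I_3 -> 'I_m.+1} | (\sum_c a c <= m)%N) c a * monomial a p); last first.
    exact/funext.
  apply: hspan_sum => a am; apply: hspanZ.
  (* The generator 1 receives the exponent m - |a|, which brings every monomial to degree m. *)
  have := hspan_prod affine_gen (fun i => if unlift ord_max i is Some c then a c : nat else m - \sum_c a c)%N.
  have lm (i : 'I_3) : widen_ord (leqnSn 3) i = lift ord_max i.
    by apply/val_inj; rewrite /= /bump leqNgt ltn_ord.
  rewrite big_ord_recr /= unlift_none; under eq_bigr do rewrite lm liftK.
  rewrite subnKC //; congr hspan; apply/funext => p; rewrite big_ord_recr /=.
  rewrite /affine_gen unlift_none expr1n mulr1; apply: eq_bigr => i _.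
  by rewrite lm liftK.
elim=> {m f} [b|k|k f h _ fI _ hI|k i f _ fI].
- rewrite (_ : (fun=> b) = b *: (fun p : R3 => \prod_c p 0 c ^+ 0 : R^o)).
    by apply: lspanZ; apply: (@monomial_poly_le 0 (fun=> 0%N)); rewrite big1.
  apply/funext => p; rewrite [RHS](_ : _ = b * \prod_c p 0 c ^+ 0) //.
  by rewrite big1 ?mulr1.
- exact: lspan0.
- exact: lspanD.
- have /lspan_pointwise[c fc] := fI.
  rewrite (_ : (fun _ => _) = \sum_(a : {ffun 'I_3 -> 'I_k.+1} | (\sum_c a c <= k)%N)
     c a *: (fun p => affine_gen i p * monomial a p : R^o)); last first.
    apply/funext => p; rewrite fc fct_sumE mulr_sumr; apply: eq_bigr => a _.
    by rewrite mulrCA.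
  apply: lspan_sum => a ak; apply: lspanZ.
  rewrite /affine_gen; case: (unliftP ord_max i) => [d|] _.
    rewrite (_ : (fun p => _) = fun p : R3 => \prod_c p 0 c ^+ (a c + (c == d))%N).
      apply: monomial_poly_le.
      rewrite big_split /= [X in (_ + X)%N](bigD1 d) //= eqxx [X in (_ + (_ + X))%N]big1.
        by rewrite addn0 addn1.
      by move=> j /negPf ->.
    apply/funext => p; rewrite /monomial (bigD1 d) //= [RHS](bigD1 d) //= eqxx addn1 exprS mulrA.
    by congr (_ * _); apply: eq_bigr => j /negPf ji; rewrite ji addn0.
  rewrite (_ : (fun p => _) = fun p : R3 => \prod_c p 0 c ^+ a c).
    by apply: monomial_poly_le; exact: leqW.
  by apply/funext => p; rewrite mul1r.
Qed.

End HomogeneousSpan.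

(** * Polynomial functions and their directional derivatives *)

Section PolynomialFunctions.
Context {R : realType}.
Notation R3 := 'rV[R]_3.
Implicit Types (f : R3 -> R) (u w : R3).

(** Polynomial functions with the degree forgotten: a class stable under derivatives, on which
    derivability, continuity and the rules of calculus follow by induction. *)
Inductive polyfun : (R3 -> R) -> Prop :=
| PolyC a : polyfun (fun=> a)
| PolyX c : polyfun (fun p => p 0 c)
| PolyD f h : polyfun f -> polyfun h -> polyfun (fun p => f p + h p)
| PolyM f h : polyfun f -> polyfun h -> polyfun (fun p => f p * h p).

Lemma polyfun_derive f u : polyfun f ->
  polyfun ('D_u f) /\ forall p, derivable f p u.
Proof.
suff h : polyfun f -> exists2 g, polyfun g & forall p, is_derive p u f (g p).
  move=> /h[g gP fg]; split=> [|p]; last exact: ex_derive.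
  by rewrite (_ : 'D_u f = g) //; apply/funext => p; exact: derive_val.
elim=> {f} [a|c|f h _ [f' fP fD] _ [h' hP hD]|f h fP [f' f'P fD] hP [h' h'P hD]].
- by exists (fun=> 0); [exact: PolyC|move=> p; exact: is_derive_cst].
- exists (fun=> u 0 c); first exact: PolyC.
  move=> p; apply: DeriveDef.
    by apply: diff_derivable; exact: differentiable_coord.
  have idD : derivable (@id R3) p u by exact: derivable_id.
  have := derive_mx idD; rewrite derive_id => /rowP/(_ c).
  by rewrite mxE => ->.
- exists (fun p => f' p + h' p); first exact: PolyD.
  by move=> p; exact: is_deriveD.
- exists (fun p => f p * h' p + h p * f' p); first by apply: PolyD; exact: PolyM.
  by move=> p; exact: is_deriveM.
Qed.

Lemma polyfun_continuous f : polyfun f -> continuous f.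
Proof.
elim=> {f} [a|c|f h _ fC _ hC|f h _ fC _ hC] p.
- exact: cst_continuous.
- exact: coord_continuous.
- by apply: continuousD; [exact: fC|exact: hC].
- by apply: continuousM; [exact: fC|exact: hC].
Qed.

Lemma polyfun_sum (J : finType) (P : pred J) (F : J -> R3 -> R) :
  (forall j, P j -> polyfun (F j)) -> polyfun (fun p => \sum_(j | P j) F j p).
Proof.
move=> h; rewrite (_ : (fun p => _) = \sum_(j | P j) (F j : R3 -> R^o)); last first.
  by apply/funext => p; rewrite fct_sumE.
by apply: (big_ind polyfun) => //; [exact: (PolyC 0)|move=> f1 f2; exact: PolyD].
Qed.

Lemma polyfunX f m : polyfun f -> polyfun (fun p => f p ^+ m).
Proof.
move=> fP; elim: m => [|m IH].
  by under eq_fun do rewrite expr0; exact: PolyC.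
by under eq_fun do rewrite exprS; exact: PolyM.
Qed.

Lemma polyfun_prod (J : finType) (P : pred J) (F : J -> R3 -> R) :
  (forall j, P j -> polyfun (F j)) -> polyfun (fun p => \prod_(j | P j) F j p).
Proof.
move=> h; rewrite (_ : (fun p => _) = \big[(fun f h p => f p * h p)/(fun=> 1)]_(j | P j) F j).
  by apply: (big_ind polyfun) => //; [exact: PolyC|move=> f1 f2; exact: PolyM].
by apply/funext => p; rewrite (big_morph (fun f : R3 -> R => f p) (id1 := 1) (op1 := *%R)).
Qed.

Lemma hspan_polyfun (I : Type) (g : I -> R3 -> R) k f :
  (forall i, polyfun (g i)) -> hspan g k f -> polyfun f.
Proof.
move=> gP; elim=> {k f} [b|k|k f h _ fI _ hI|k j f _ fI].
- exact: PolyC.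
- exact: PolyC.
- exact: PolyD.
- exact: PolyM.
Qed.

Lemma affine_gen_polyfun i : polyfun (affine_gen i : R3 -> R).
Proof.
by rewrite /affine_gen; case: (unlift _ _) => [c|]; [exact: PolyX|exact: PolyC].
Qed.

Lemma poly_le_polyfun (m : nat) f : poly_le m%:Z f -> polyfun f.
Proof. by move=> /poly_le_hspan; apply: hspan_polyfun; exact: affine_gen_polyfun. Qed.

Definition dd u f : R3 -> R := 'D_u f.

Lemma polyfun_deriveC u (a : R) : dd u (fun=> a : R) = (fun=> 0) :> (R3 -> R).
Proof. by apply/funext => p; exact: derive_cst. Qed.

Lemma polyfun_deriveX u c : dd u (fun p : R3 => p 0 c : R) = (fun=> u 0 c).
Proof.
apply/funext => p.
have idD : derivable (@id R3) p u by exact: derivable_id.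
have := derive_mx idD; rewrite derive_id => /rowP/(_ c).
by rewrite mxE.
Qed.

Lemma polyfun_deriveD u f h : polyfun f -> polyfun h ->
  dd u (fun p => f p + h p) = fun p => dd u f p + dd u h p.
Proof.
move=> /(polyfun_derive u)[_ df] /(polyfun_derive u)[_ dh].
by apply/funext => p; exact: deriveD.
Qed.

Lemma polyfun_deriveM u f h : polyfun f -> polyfun h ->
  dd u (fun p => f p * h p) = fun p => f p * dd u h p + h p * dd u f p.
Proof.
move=> /(polyfun_derive u)[_ df] /(polyfun_derive u)[_ dh].
by apply/funext => p; exact: deriveM.
Qed.

Lemma polyfun_deriveZ u (a : R) f : polyfun f ->
  dd u (fun p => a * f p) = fun p => a * dd u f p.
Proof.
move=> fP; rewrite (polyfun_deriveM u (PolyC a) fP) polyfun_deriveC.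
by apply/funext => p /=; rewrite mulr0 addr0.
Qed.

Lemma polyfun_deriveA u f : polyfun f -> polyfun (dd u f).
Proof. by case/(polyfun_derive u). Qed.

(** For a product, the Leibniz rule applied twice is symmetric in the two directions as soon as the
    second derivatives of both factors are. *)
Lemma derive_comm u w f : polyfun f -> dd u (dd w f) = dd w (dd u f).
Proof.
elim=> {f} [a|c|f h fP fI hP hI|f h fP fI hP hI].
- by rewrite !polyfun_deriveC.
- by rewrite !polyfun_deriveX !polyfun_deriveC.
- have dA v g : polyfun g -> polyfun (dd v g) by exact: polyfun_deriveA.
  rewrite (polyfun_deriveD w fP hP) (polyfun_deriveD u fP hP).
  rewrite (polyfun_deriveD u (dA w _ fP) (dA w _ hP)).
  by rewrite (polyfun_deriveD w (dA u _ fP) (dA u _ hP)) fI hI.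
- have dA v g : polyfun g -> polyfun (dd v g) by exact: polyfun_deriveA.
  have E v v' : dd v (dd v' (fun p => f p * h p)) = fun p =>
      (f p * dd v (dd v' h) p + dd v' h p * dd v f p) +
      (h p * dd v (dd v' f) p + dd v' f p * dd v h p).
    rewrite (polyfun_deriveM v' fP hP).
    rewrite (polyfun_deriveD v (PolyM fP (dA v' _ hP)) (PolyM hP (dA v' _ fP))).
    by rewrite (polyfun_deriveM v fP (dA v' _ hP)) (polyfun_deriveM v hP (dA v' _ fP)).
  by rewrite !E fI hI; apply/funext => p; ring.
Qed.

Lemma derive_comb (I : finType) (a : I -> R) (e : I -> R3) f : polyfun f ->
  dd (\sum_i a i *: e i) f = fun p => \sum_i a i * dd (e i) f p.
Proof.
elim=> {f} [b|c|f h fP fI hP hI|f h fP fI hP hI].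
- rewrite polyfun_deriveC; apply/funext => p; rewrite big1 // => i _.
  by rewrite polyfun_deriveC mulr0.
- rewrite polyfun_deriveX; apply/funext => p; rewrite summxE; apply: eq_bigr => i _.
  by rewrite polyfun_deriveX mxE.
- rewrite (polyfun_deriveD _ fP hP) fI hI; apply/funext => p; rewrite -big_split.
  by apply: eq_bigr => i _; rewrite (polyfun_deriveD _ fP hP) mulrDr.
- rewrite (polyfun_deriveM _ fP hP) fI hI; apply/funext => p; rewrite !mulr_sumr -big_split.
  by apply: eq_bigr => i _ /=; rewrite (polyfun_deriveM _ fP hP); ring.
Qed.

Lemma polyfun_line f p u : polyfun f ->
  exists q : {poly R}, forall t, f (p + t *: u) = q.[t].
Proof.
elim=> {f} [a|c|f h _ [q fq] _ [r hr]|f h _ [q fq] _ [r hr]].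
- by exists a%:P => t; rewrite hornerC.
- by exists ((p 0 c)%:P + (u 0 c) *: 'X) => t; rewrite !mxE !hornerE mulrC.
- by exists (q + r) => t; rewrite hornerD fq hr.
- by exists (q * r) => t; rewrite hornerM fq hr.
Qed.

Lemma derive_line f p u (q : {poly R}) : polyfun f ->
  (forall t, f (p + t *: u) = q.[t]) ->
  forall t, dd u f (p + t *: u) = q^`().[t].
Proof.
move=> fP fq t; have <- : 'D_1 (horner q) t = q^`().[t] by exact: derive_val.
rewrite /dd /derive; suff -> : (fun h : R => h^-1 *: ((f \o shift (p + t *: u)) (h *: u) - f (p + t *: u))) =
    (fun h : R => h^-1 *: ((horner q \o shift t) (h *: 1) - q.[t])) by [].
apply/funext => h /=; rewrite fq; congr (_ *: (_ - _)).
by rewrite [h *: 1]mulr1 -fq addrCA -scalerDl.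
Qed.

(** Taylor's formula on a line: derivatives of f at p along u are read off the univariate polynomial
    t -> f(p + t u). *)
Lemma dirderiv_line u m f p (q : {poly R}) : polyfun f ->
  (forall t, f (p + t *: u) = q.[t]) ->
  dirderiv u m f p = m`!%:R * q`_m.
Proof.
move=> fP fq.
have [_ h] : polyfun (dirderiv u m f) /\
    forall t, dirderiv u m f (p + t *: u) = (q^`(m)).[t].
  elim: m => [|m [IH1 IH2]]; first by rewrite derivn0.
  split; first exact: (polyfun_deriveA u IH1).
  by move=> t; rewrite derivnS; exact: (derive_line IH1).
have := h 0; rewrite scale0r addr0 => ->.
by rewrite horner_coef0 coef_derivn addn0 ffactnn mulr_natl.
Qed.

Lemma dirderiv_polyfun u m f : polyfun f -> polyfun (dirderiv u m f).
Proof. by move=> fP; elim: m => // m IH; exact: (polyfun_deriveA u IH). Qed.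

Lemma dirderivS u m f : dirderiv u m.+1 f = dd u (dirderiv u m f).
Proof. by []. Qed.

Lemma dirderivSr u m f : dirderiv u m.+1 f = dirderiv u m (dd u f).
Proof. by rewrite /dirderiv iterSr. Qed.

Lemma dirderiv_derive u m w f : polyfun f ->
  dd w (dirderiv u m f) = dirderiv u m (dd w f).
Proof.
move=> fP; elim: m => // m IH.
by rewrite dirderivS (derive_comm _ _ (dirderiv_polyfun u m fP)) IH.
Qed.

Lemma dirderiv_sum u m (I : finType) (F : I -> R3 -> R) : (forall i, polyfun (F i)) ->
  dirderiv u m (fun p => \sum_i F i p) = fun p => \sum_i dirderiv u m (F i) p.
Proof.
move=> FP; elim: m => // m; rewrite dirderivS => ->.
have GP i := dirderiv_polyfun u m (FP i).
pose G i := dirderiv u m (F i).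
have E s : dd u (fun p => \sum_(i <- s) G i p) = fun p => \sum_(i <- s) dd u (G i) p.
  elim: s => [|i s IH].
    under eq_fun do rewrite big_nil.
    by rewrite polyfun_deriveC; apply/funext => p; rewrite big_nil.
  under eq_fun do rewrite big_cons.
  have sP : polyfun (fun p => \sum_(j <- s) G j p).
    rewrite (_ : (fun _ => _) = fun p => \sum_(j < size s) G (nth i s j) p).
      by apply: polyfun_sum => j _; exact: GP.
    by apply/funext => p; rewrite (big_nth i) big_mkord.
  rewrite (polyfun_deriveD u (GP i) sP) IH.
  by apply/funext => p; rewrite big_cons.
exact: E.
Qed.

Lemma dirderivZ u m (a : R) f : polyfun f ->
  dirderiv u m (fun p => a * f p) = fun p => a * dirderiv u m f p.
Proof.
move=> fP; elim: m => // m; rewrite dirderivS => ->.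
by rewrite (polyfun_deriveZ u a (dirderiv_polyfun u m fP)).
Qed.

Lemma pderiv_polyfun s f : polyfun f -> polyfun (pderiv s f).
Proof. by move=> fP; elim: s => //= c s; exact: polyfun_deriveA. Qed.

Lemma row3_delta u : u = \sum_c u 0 c *: delta_mx 0 c.
Proof. exact: row_sum_delta. Qed.

(** Bridge to (H0), which provides partial derivatives only: the innermost D_u is expanded over the
    coordinate directions, and the induction goes on with each partial derivative of f. *)
Lemma dirderiv_pderiv_eq0 u m f p : polyfun f ->
  (forall s, size s = m -> pderiv s f p = 0) -> dirderiv u m f p = 0.
Proof.
elim: m f => [|m IH] f fP h; first exact: (h [::]).
rewrite dirderivSr {2}(row3_delta u) derive_comb // dirderiv_sum; last first.
  by move=> c; apply: PolyM; [exact: PolyC|exact: polyfun_deriveA].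
rewrite big1 // => c _; rewrite dirderivZ; last exact: polyfun_deriveA.
rewrite IH ?mulr0 //; first exact: polyfun_deriveA.
move=> s sm; have := h (rcons s c).
by rewrite size_rcons sm /pderiv -cats1 foldr_cat; apply.
Qed.

(* The binomial expansion of the derivatives along a combination of [u1] and
   [u2], seen through a linear functional [L]. *)
Lemma dirderiv_mixed_eq0 u1 u2 (a1 a2 : R) m (L : (R3 -> R) -> R) f : polyfun f ->
  (forall g h, polyfun g -> polyfun h -> L (fun p => g p + h p) = L g + L h) ->
  (forall a g, polyfun g -> L (fun p => a * g p) = a * L g) ->
  (forall i, (i <= m)%N -> L (dirderiv u1 i (dirderiv u2 (m - i) f)) = 0) ->
  L (dirderiv (a1 *: u1 + a2 *: u2) m f) = 0.
Proof.
move=> fP LD LZ; elim: m f fP => [|m IH] f fP h; first exact: (h 0%N).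
rewrite dirderivSr; set u := (_ + _).
have -> : dd u f = fun p => a1 * dd u1 f p + a2 * dd u2 f p.
  have := derive_comb (fun b : bool => if b then a1 else a2)
    (fun b : bool => if b then u1 else u2) fP.
  rewrite big_bool /= -/u => ->; apply/funext => p.
  by rewrite big_bool.
have P1 := polyfun_deriveA u1 fP; have P2 := polyfun_deriveA u2 fP.
have DD m' : dirderiv u m' (fun p => a1 * dd u1 f p + a2 * dd u2 f p) =
    fun p => a1 * dirderiv u m' (dd u1 f) p + a2 * dirderiv u m' (dd u2 f) p.
  have := dirderiv_sum u m' (F := fun b : bool => if b then (fun p => a1 * dd u1 f p)
     else (fun p => a2 * dd u2 f p)).
  rewrite (_ : (fun p => \sum_i _) = (fun p => a1 * dd u1 f p + a2 * dd u2 f p)); last first.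
    by apply/funext => p; rewrite big_bool.
  move=> ->; last by case; (apply: PolyM; [exact: PolyC|]).
  by apply/funext => p; rewrite big_bool /= !dirderivZ.
rewrite DD LD; try by apply: PolyM; [exact: PolyC|exact: dirderiv_polyfun].
rewrite !LZ; try exact: dirderiv_polyfun.
rewrite !IH ?mulr0 ?addr0 //.
- move=> i im; have := h i (leqW im); rewrite subSn //.
  by rewrite dirderivSr.
(* The derivative along [u1] that the expansion takes first is taken last in the hypothesis;
   commutation matches the two. *)
- move=> i im; have := h i.+1 im; rewrite subSS /=.
  by rewrite -!dirderiv_derive //; exact: dirderiv_polyfun.
Qed.

Section Fields.
Implicit Types v : R3 -> R3.

Definition polyfield v := forall c, polyfun (fun p => v p 0 c).

Lemma polyfield_deriveE u v : polyfield v ->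
  forall p c, 'D_u v p 0 c = 'D_u (fun p => v p 0 c) p.
Proof.
move=> vP p c; rewrite derive_mx ?mxE //; apply/derivable_mxP => i j.
by rewrite (ord1 i); have [_] := polyfun_derive u (vP j); apply.
Qed.

Lemma polyfield_derive u v : polyfield v -> polyfield ('D_u v).
Proof.
move=> vP c; rewrite (_ : (fun p => _) = 'D_u (fun p => v p 0 c)).
  exact: polyfun_deriveA.
by apply/funext => p; rewrite polyfield_deriveE.
Qed.

Lemma dirderiv_polyfield u m v : polyfield v ->
  polyfield (dirderiv u m v) /\
  forall c, (fun p => dirderiv u m v p 0 c) = dirderiv u m (fun p => v p 0 c).
Proof.
move=> vP; elim: m => [//|m [IH1 IH2]] /=; split; first exact: polyfield_derive.
by move=> c; rewrite -IH2; apply/funext => p; rewrite polyfield_deriveE.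
Qed.

Lemma pderiv_polyfield s v : polyfield v ->
  polyfield (pderiv s v) /\
  forall c, (fun p => pderiv s v p 0 c) = pderiv s (fun p => v p 0 c).
Proof.
move=> vP; elim: s => [//|d s [IH1 IH2]] /=; split; first exact: polyfield_derive.
by move=> c; rewrite -IH2; apply/funext => p; rewrite polyfield_deriveE.
Qed.

End Fields.
End PolynomialFunctions.

(** * Barycentric coordinates and Bernstein polynomials *)

Section Barycentric.
Context {R : realType} {n : nat}.
Variable x : 'M[R]_(n, 3).
Notation R3 := 'rV[R]_3.
Implicit Types (g T : {set 'I_n}) (p u : R3) (l y : 'rV[R]_n).

Lemma affinely_independentS g T : g \subset T ->
  affinely_independent x T -> affinely_independent x g.
Proof.
move=> gT Ti l lg; apply: Ti => i iT; apply: lg.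
by apply: contra iT; exact: (fintype.subsetP gT).
Qed.

Lemma barycentric_unique g p l l' : affinely_independent x g ->
  barycentric x g p l -> barycentric x g p l' -> l = l'.
Proof.
move=> gi [lg l1 lx] [lg' l1' lx']; apply/eqP; rewrite -subr_eq0; apply/eqP/gi.
- by move=> i ig; rewrite !mxE lg // lg' // subrr.
- by under eq_bigr do rewrite !mxE; rewrite sumrB l1 l1' subrr.
- by rewrite mulmxBl lx lx' subrr.
Qed.

Lemma bary_unique g p l : affinely_independent x g ->
  barycentric x g p l -> bary x g p = l.
Proof.
move=> gi h; apply: xget_unique => // l' h'.
exact: barycentric_unique gi h' h.
Qed.

Lemma bary_sub g T p l : g \subset T -> affinely_independent x T ->
  barycentric x g p l -> bary x g p = l /\ bary x T p = l.
Proof.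
move=> gT Ti h; split; apply: bary_unique => //.
  exact: affinely_independentS Ti.
case: h => lg l1 lx; split=> // i iT; apply: lg.
by apply: contra iT; exact: (fintype.subsetP gT).
Qed.

(** Affine independence makes the 4 by 4 matrix Y with rows (x_i, 1) invertible; the coordinates of
    p are then (p, 1) Y^-1, scattered over the n vertices of the mesh by S. *)
Lemma tetrahedron_affine T : tetrahedron x T ->
  exists Q : 'M[R]_(3 + 1, n), forall p, barycentric x T p (row_mx p 1%:M *m Q).
Proof.
move=> [T4 Ti].
pose t (a : 'I_4) : 'I_n := enum_val (cast_ord (esym T4) a).
have tT a : t a \in T by exact: enum_valP.
have tinj : injective t by move=> a b /enum_val_inj/cast_ord_inj.
pose S : 'M[R]_(3 + 1, n) := \matrix_(a, i) (t a == i)%:R.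
pose Y : 'M[R]_(3 + 1) := row_mx (S *m x) (const_mx 1).
have S1 : S *m const_mx 1 = const_mx 1 :> 'cV[R]_(3 + 1).
  apply/colP => a; rewrite !mxE (bigD1 (t a)) //= !mxE eqxx mul1r big1 ?addr0 //.
  by move=> i /negPf; rewrite eq_sym !mxE => ->; rewrite mul0r.
have supp m (c : 'M[R]_(m, 3 + 1)) r i : i \notin T -> (c *m S) r i = 0.
  move=> iT; rewrite mxE big1 // => a _; rewrite mxE (_ : t a == i = false) ?mulr0 //.
  by apply: contraNF iT => /eqP <-.
have sumE (l : 'rV[R]_n) : \sum_i l 0 i = (l *m (const_mx 1 : 'cV[R]_n)) 0 0.
  by rewrite mxE; apply: eq_bigr => i _; rewrite mxE mulr1.
have Yu : Y \in unitmx.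
  rewrite -row_free_unit; apply: inj_row_free => c; rewrite mul_mx_row => cY0.
  have [cx c1] : c *m (S *m x) = 0 /\ c *m const_mx 1 = 0 :> 'cV_1.
    by apply: eq_row_mx; rewrite cY0 row_mx0.
  have cS0 : c *m S = 0.
    apply: Ti; first by move=> i; exact: supp.
      by rewrite sumE -mulmxA S1 c1 mxE.
    by rewrite -mulmxA cx.
  apply/rowP => a; have /rowP/(_ (t a)) := cS0.
  rewrite mxE (bigD1 a) //= mxE eqxx mulr1 big1 ?addr0.
    by move=> ->; rewrite !mxE.
  by move=> b /negPf ba; rewrite mxE (inj_eq tinj) ba mulr0.
exists (invmx Y *m S) => p; split.
- by move=> i; rewrite mulmxA; exact: supp.
- rewrite sumE -!mulmxA S1 (_ : const_mx 1 = Y *m col_mx 0 1%:M); last first.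
    by rewrite mul_row_col mulmx0 mulmx1 add0r.
  by rewrite mulKmx // mul_row_col mulmx0 mulmx1 add0r mxE.
- rewrite -!mulmxA (_ : S *m x = Y *m col_mx 1%:M 0); last first.
    by rewrite mul_row_col mulmx0 mulmx1 addr0.
  by rewrite mulKmx // mul_row_col mulmx0 mulmx1 addr0.
Qed.

Section Tetrahedron.
Variable T : {set 'I_n}.
Hypothesis tT : tetrahedron x T.

Let Ti : affinely_independent x T := tT.2.

Lemma bary_barycentric p : barycentric x T p (bary x T p).
Proof.
have [Q h] := tetrahedron_affine tT.
by rewrite (bary_unique Ti (h p)).
Qed.

(** Linear part of the affine map [bary]: the barycentric coordinates of a direction, which add up
    to 0 instead of 1. *)
Definition baryd u : 'rV[R]_n := bary x T u - bary x T 0.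

Lemma bary_line p u (t : R) : bary x T (p + t *: u) = bary x T p + t *: baryd u.
Proof.
have [Q h] := tetrahedron_affine tT.
rewrite /baryd !(bary_unique Ti (h _)) -mulmxBl scalemxAl -mulmxDl; congr (_ *m _).
by rewrite opp_row_mx add_row_mx scale_row_mx add_row_mx subr0 subrr scaler0 addr0.
Qed.

Lemma baryd_notin u i : i \notin T -> baryd u 0 i = 0.
Proof.
by move=> iT; rewrite !mxE !(let: And3 h _ _ := bary_barycentric _ in h i iT) subrr.
Qed.

Lemma baryd_sum u : \sum_i baryd u 0 i = 0.
Proof.
under eq_bigr do rewrite !mxE.
by rewrite sumrB !(let: And3 _ h _ := bary_barycentric _ in h) subrr.
Qed.

Lemma baryd_mul u : baryd u *m x = u.
Proof. by rewrite mulmxBl !(let: And3 _ _ h := bary_barycentric _ in h) subr0. Qed.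

Lemma baryd_unique y : (forall i, i \notin T -> y 0 i = 0) -> \sum_i y 0 i = 0 ->
  baryd (y *m x) = y.
Proof.
move=> yT y0; apply/eqP; rewrite -subr_eq0; apply/eqP; apply: Ti.
- by move=> i iT; rewrite [LHS]mxE baryd_notin // mxE yT // subrr.
- under eq_bigr do rewrite mxE [(- y) _ _]mxE.
  by rewrite sumrB baryd_sum y0 subrr.
- by rewrite mulmxBl baryd_mul subrr.
Qed.

Lemma bary_affine_gen i : exists c : 'I_4 -> R,
  forall p, bary x T p 0 i = \sum_j c j * affine_gen j p.
Proof.
have [Q h] := tetrahedron_affine tT.
exists (fun j => Q j i) => p; rewrite (bary_unique Ti (h _)) mxE.
rewrite big_split_ord /= big_ord1 [RHS]big_ord_recr /=; congr (_ + _).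
  apply: eq_bigr => j _; rewrite row_mxEl mulrC.
  have -> : widen_ord (leqnSn 3) j = lift ord_max j.
    by apply/val_inj; rewrite /= /bump leqNgt ltn_ord.
  by rewrite /affine_gen liftK; congr (Q _ _ * _); apply/val_inj; rewrite /= /bump leqNgt ltn_ord.
rewrite row_mxEr mxE eqxx mulrC /affine_gen unlift_none; congr (Q _ _ * _).
by apply/val_inj.
Qed.

Lemma affine_gen_bary j : exists c : 'I_n -> R,
  forall p, affine_gen j p = \sum_i c i * bary x T p 0 i.
Proof.
rewrite /affine_gen; case: (unlift _ _) => [c|].
  exists (fun i => x i c) => p; have [_ _ h] := bary_barycentric p.
  by rewrite -{1}h mxE; apply: eq_bigr => i _; rewrite mulrC.
exists (fun=> 1) => p; have [_ h _] := bary_barycentric p.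
by rewrite -{1}h; apply: eq_bigr => i _; rewrite mul1r.
Qed.

(** By p = sum lambda_i x_i and 1 = sum lambda_i, the lambda_i can replace the coordinates and 1 as
    generators; the second identity is what raises lower degrees to m. *)
Lemma poly_le_bernstein (m : nat) (f : R3 -> R) :
  poly_le m%:Z f <-> lspan (multi_index T (k := m)) (bernstein x T (k := m) : _ -> R3 -> R^o) f.
Proof.
rewrite poly_le_hspan -(@hspan_multi_index R n T (fun i p => bary x T p 0 i)); last first.
  by move=> i iT; apply/funext => p; have [h _ _] := bary_barycentric p; exact: h.
split; apply: hspan_change.
- exact: affine_gen_bary.
- exact: bary_affine_gen.
Qed.

Lemma bary_polyfun i : polyfun (fun p => bary x T p 0 i).
Proof.
have [c h] := bary_affine_gen i; rewrite (_ : (fun _ => _) = (fun p => \sum_j c j * affine_gen j p)).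
  by apply: polyfun_sum => j _; apply: PolyM; [exact: PolyC|exact: affine_gen_polyfun].
exact/funext.
Qed.

Lemma bernstein_polyfun k (a : {ffun 'I_n -> 'I_k.+1}) : polyfun (bernstein x T a).
Proof. by apply: polyfun_prod => i _; apply: polyfunX; exact: bary_polyfun. Qed.

End Tetrahedron.

Lemma bernstein_sub g T k (a : {ffun 'I_n -> 'I_k.+1}) p :
  g \subset T -> affinely_independent x T -> simplex x g p ->
  bernstein x T a p = bernstein x g a p.
Proof.
move=> gT Ti [l h _]; have [eg eT] := bary_sub gT Ti h.
by rewrite /bernstein eg eT.
Qed.

Lemma bernstein_eq0 g T k (a : {ffun 'I_n -> 'I_k.+1}) p i :
  g \subset T -> affinely_independent x T -> simplex x g p ->
  i \notin g -> a i != 0%N :> nat -> bernstein x T a p = 0.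
Proof.
move=> gT Ti [l h _] ig ai; have [eg eT] := bary_sub gT Ti h.
rewrite /bernstein eT (bigD1 i) //=; case: h => -> //.
by rewrite expr0n (negPf ai) mul0r.
Qed.

Lemma prod_multi_index_scale g k (a : {ffun 'I_n -> 'I_k.+1}) (s : R) (y l : 'I_n -> R) :
  multi_index g a -> (forall i, i \in g -> y i = s * l i) ->
  \prod_i y i ^+ a i = s ^+ k * \prod_i l i ^+ a i.
Proof.
move=> /multi_indexP[ag ak] yl.
have -> : s ^+ k = s ^+ (\sum_i a i)%N by rewrite ak.
rewrite -prodrXr -big_split; apply: eq_bigr => i _ /=.
have [ig|/ag ->] := boolP (i \in g); last by rewrite !expr0 mulr1.
by rewrite yl // exprMn.
Qed.

(** Homogeneity of degree k allows an arbitrary positive y to be scaled to barycentric coordinates,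
    so vanishing on the open simplex is enough. *)
Lemma bernstein_free g k (P : pred {ffun 'I_n -> 'I_k.+1}) (c : {ffun 'I_n -> 'I_k.+1} -> R) :
  g != finset.set0 -> (forall a, P a -> multi_index g a) ->
  (forall l, (forall i, i \in g -> 0 < l 0 i) -> (forall i, i \notin g -> l 0 i = 0) ->
     \sum_i l 0 i = 1 -> \sum_(a | P a) c a * \prod_i l 0 i ^+ a i = 0) ->
  forall a, P a -> c a = 0.
Proof.
move=> /set0Pn[i0 i0g] Pg h; apply: monomial_free => y y0.
pose s := \sum_(i in g) y i.
have s0 : 0 < s.
  by rewrite /s (bigD1 i0) //= ltr_pwDl // sumr_ge0 // => i _; exact: ltW.
pose l : 'rV[R]_n := \row_i if i \in g then y i / s else 0.
have lE i : i \in g -> y i = s * l 0 i.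
  by move=> ig; rewrite mxE ig mulrCA divff ?mulr1 // gt_eqF.
rewrite (_ : \sum_(a | _) _ = s ^+ k * \sum_(a | P a) c a * \prod_i l 0 i ^+ a i).
  rewrite h ?mulr0 // => [i ig|i /negPf ig|]; rewrite ?mxE ?ig ?divr_gt0 //.
  under eq_bigr do rewrite mxE.
  by rewrite -big_mkcond -mulr_suml divff // gt_eqF.
rewrite mulr_sumr; apply: eq_bigr => a Pa.
by rewrite (prod_multi_index_scale (Pg _ Pa) lE) mulrCA.
Qed.

Lemma barycentric_mul g l : (forall i, i \notin g -> l 0 i = 0) -> \sum_i l 0 i = 1 ->
  barycentric x g (l *m x) l.
Proof. by []. Qed.

Lemma free_bernstein g T k (P : pred {ffun 'I_n -> 'I_k.+1}) :
  g \subset T -> affinely_independent x T -> g != finset.set0 ->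
  (forall a, P a -> multi_index g a) -> forall c : {ffun 'I_n -> 'I_k.+1} -> R,
  (forall p, simplex x g p -> \sum_(a | P a) c a * bernstein x T a p = 0) ->
  forall a, P a -> c a = 0.
Proof.
move=> gT Ti g0 Pg c h; apply: (bernstein_free g0 Pg) => l l0 lg l1.
have bl := barycentric_mul lg l1; have [_ bT] := bary_sub gT Ti bl.
rewrite -[RHS](h (l *m x)); first by rewrite /bernstein bT.
exists l => // i; have [/l0/ltW//|/lg ->] := boolP (i \in g); by rewrite lexx.
Qed.

End Barycentric.

(** * Jets at a subsimplex and Bernstein coefficients *)

Section Jets.
Context {R : realType} {n : nat}.
Variables (x : 'M[R]_(n, 3)) (T : {set 'I_n}) (k : nat).
Hypothesis tT : tetrahedron x T.
Notation R3 := 'rV[R]_3.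
Notation mi := {ffun 'I_n -> 'I_k.+1}.
Variable c : mi -> R.

Definition dist (a : mi) (g : {set 'I_n}) : nat := (\sum_(i | i \notin g) a i)%N.

Definition bernstein_comb (p : R3) : R :=
  \sum_(a : mi | multi_index T a) c a * bernstein x T a p.

Lemma bernstein_comb_polyfun : polyfun bernstein_comb.
Proof.
apply: polyfun_sum => a _; apply: PolyM; [exact: PolyC|exact: bernstein_polyfun].
Qed.

(** Along the line, lambda^a is t^dist(a, g) times a polynomial in t. Indices at distance below d
    have zero coefficients, those above d do not reach t^d, and those at d contribute the value of
    their remaining factor at t = 0. *)
Lemma bernstein_comb_low_coef (g : {set 'I_n}) d p u (q : {poly R}) :
  (forall i, i \notin g -> bary x T p 0 i = 0) ->
  (forall a, multi_index T a -> (dist a g < d)%N -> c a = 0) ->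
  (forall t, bernstein_comb (p + t *: u) = q.[t]) ->
  q`_d = \sum_(a : mi | multi_index T a && (dist a g == d))
     c a * (\prod_(i in g) bary x T p 0 i ^+ a i * \prod_(i | i \notin g) baryd x T u 0 i ^+ a i).
Proof.
move=> pg low hq.
pose A i : {poly R} := (bary x T p 0 i)%:P + baryd x T u 0 i *: 'X.
pose r : {poly R} := \sum_(a : mi | multi_index T a) c a *: \prod_i A i ^+ a i.
have -> : q = r.
  apply/eqP; rewrite -subr_eq0; apply/eqP/poly_pos_roots => t _.
  rewrite hornerD hornerN -hq horner_sum /bernstein_comb; apply/eqP; rewrite subr_eq0; apply/eqP.
  apply: eq_bigr => a _; rewrite hornerZ horner_prod; congr (_ * _).
  apply: eq_bigr => i _; rewrite (bary_line tT) horner_exp !hornerE !mxE; congr (_ ^+ _).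
  by rewrite mulrC.
have E (a : mi) : \prod_i A i ^+ a i =
    (\prod_(i | i \notin g) baryd x T u 0 i ^+ a i) *: ((\prod_(i in g) A i ^+ a i) * 'X^(dist a g)).
  rewrite (bigID [in g]) /= scalerAr -prodrXr -scaler_prod; congr (_ * _).
  by apply: eq_bigr => i ig; rewrite /A pg // add0r exprZn.
rewrite coef_sum (bigID (fun a : mi => dist a g == d)) /= [X in _ + X]big1 ?addr0; last first.
  move=> a /andP[aT ad]; rewrite coefZ E coefZ coefMXn.
  have [lt|] := ltnP (dist a g) d; first by rewrite low ?mul0r.
  by rewrite leq_eqVlt eq_sym (negPf ad) /= => ->; rewrite !mulr0.
apply: eq_bigr => a /andP[aT /eqP ad]; rewrite coefZ E coefZ coefMXn ad ltnn subnn.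
rewrite [X in _ = _ * X]mulrC; congr (_ * (_ * _)).
rewrite -horner_coef0 horner_prod; apply: eq_bigr => i _.
by rewrite horner_exp !hornerE ?mulr0 ?addr0.
Qed.

Lemma bernstein_comb_jet (g : {set 'I_n}) d p u :
  (forall i, i \notin g -> bary x T p 0 i = 0) ->
  (forall a, multi_index T a -> (dist a g < d)%N -> c a = 0) ->
  dirderiv u d bernstein_comb p = d`!%:R * \sum_(a : mi | multi_index T a && (dist a g == d))
     c a * (\prod_(i in g) bary x T p 0 i ^+ a i * \prod_(i | i \notin g) baryd x T u 0 i ^+ a i).
Proof.
move=> pg low; have [q hq] := polyfun_line p u bernstein_comb_polyfun.
by rewrite (dirderiv_line d bernstein_comb_polyfun hq) (bernstein_comb_low_coef pg low hq).
Qed.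

Lemma sum_in_multi_index (g : {set 'I_n}) (a : mi) : multi_index T a ->
  (\sum_(i in g) a i + dist a g = k)%N.
Proof. by move=> /multi_indexP[_ s]; rewrite -[RHS]s [RHS](bigID [in g]). Qed.

(** Induction on the distance d: the jet of order d is a polynomial in the coordinates on g and the
    components off g, zero at all positive values. Only the components of the direction off g are
    prescribed, which leaves room for choosing it normal to an edge. *)
Lemma jet_coef_eq0 (g : {set 'I_n}) N : g \subset T -> g != finset.set0 ->
  (forall d, (d < N)%N -> (forall a, multi_index T a -> (dist a g < d)%N -> c a = 0) ->
     forall l : 'rV[R]_n, (forall i, i \in g -> 0 < l 0 i) ->
       (forall i, i \notin g -> l 0 i = 0) -> \sum_i l 0 i = 1 ->
     forall y : 'I_n -> R, exists2 u,
       forall i, i \in T :\: g -> baryd x T u 0 i = y i &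
       dirderiv u d bernstein_comb (l *m x) = 0) ->
  forall a, multi_index T a -> (dist a g < N)%N -> c a = 0.
Proof.
move=> gT /set0Pn[i0 i0g] H.
suff h d : (d <= N)%N -> forall a, multi_index T a -> (dist a g < d)%N -> c a = 0 by exact: h.
elim: d => // d IH dN; have {}IH := IH (ltnW dN) => a aT.
rewrite ltnS leq_eqVlt => /orP[ad|]; last exact: IH.
suff : multi_index T a && (dist a g == d) -> c a = 0 by apply; rewrite aT ad.
apply: (monomial_free (P := fun a => multi_index T a && (dist a g == d))) => y y0.
(* The variables on g are normalized to the coordinates [l] of a point of g; those off g become the
   components of the direction. *)
pose s := \sum_(i in g) y i.
have s0 : 0 < s by rewrite /s (bigD1 i0) //= ltr_pwDl // sumr_ge0 // => i _; exact: ltW.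
pose l : 'rV[R]_n := \row_i if i \in g then y i / s else 0.
have lg i : i \notin g -> l 0 i = 0 by move=> /negPf ig; rewrite mxE ig.
have l1 : \sum_i l 0 i = 1.
  under eq_bigr do rewrite mxE.
  by rewrite -big_mkcond -mulr_suml divff // gt_eqF.
have l0 i : i \in g -> 0 < l 0 i by move=> ig; rewrite mxE ig divr_gt0.
have [u ug] := H d dN IH l l0 lg l1 y.
have [_ lT] := bary_sub gT tT.2 (barycentric_mul x lg l1).
have pg i : i \notin g -> bary x T (l *m x) 0 i = 0 by rewrite lT; exact: lg.
rewrite (bernstein_comb_jet u pg IH) lT => /eqP; rewrite mulf_eq0 pnatr_eq0 (negPf (lt0n_neq0 (fact_gt0 d))) /=.
(* The power of s undoes the normalization: on g, the entries of an index at distance d add up to k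
   - d. *)
move=> /eqP e0; have := congr1 ( *%R (s ^+ (k - d))) e0; rewrite mulr0 => e; rewrite -[RHS]e.
rewrite mulr_sumr; apply: eq_bigr => b /andP[bT /eqP bd].
rewrite mulrCA; congr (_ * _); rewrite mulrA [LHS](bigID [in g]) /=; congr (_ * _).
  have <- : (\sum_(i in g) b i = k - d)%N by have := sum_in_multi_index g bT; rewrite bd => /(congr1 (subn^~ d)); rewrite addnK.
  rewrite -prodrXr -big_split; apply: eq_bigr => i ig /=.
  by rewrite -exprMn mxE ig mulrCA divff ?mulr1 // gt_eqF.
apply: eq_bigr => i ig; have [iT|iT] := boolP (i \in T); first by rewrite ug // inE ig.
by move: bT => /multi_indexP[-> //]; rewrite !expr0.
Qed.

Lemma vertex_coef_eq0 (i0 : 'I_n) N : i0 \in T ->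
  (forall u d, (d < N)%N -> dirderiv u d bernstein_comb (row i0 x) = 0) ->
  forall a, multi_index T a -> (dist a [set i0] < N)%N -> c a = 0.
Proof.
move=> i0T H; apply: jet_coef_eq0; first by rewrite finset.sub1set.
  by apply/set0Pn; exists i0; rewrite inE.
move=> d dN _ l _ lg l1 y.
(* The entry at [i0] brings the sum to 0, as a direction requires; it lies on the vertex, where
   nothing is prescribed. *)
pose z : 'rV[R]_n := \row_i if i == i0 then - \sum_(j in T :\ i0) y j else if i \in T then y i else 0.
exists (z *m x) => [i|].
  rewrite !inE => /andP[/negPf ii0 iT]; rewrite baryd_unique // ?mxE ?ii0 ?iT //.
    by move=> j jT; rewrite mxE (negPf jT); case: eqP jT => // ->; rewrite i0T.
  rewrite (bigD1 i0) //= mxE eqxx; under eq_bigr => j /negPf ji do rewrite mxE ji.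
  rewrite -big_mkcondr addrC; apply/eqP; rewrite subr_eq0; apply/eqP.
  by apply: eq_bigl => j; rewrite in_setD1.
rewrite (_ : l *m x = row i0 x) ?H // rowE; congr (_ *m _).
apply/rowP => i; rewrite !mxE eqxx /=; have [->|ii0] := eqVneq i i0; last by rewrite lg ?inE.
by rewrite -l1 (bigD1 i0) //= big1 ?addr0 // => j ji; rewrite lg ?inE.
Qed.

Lemma dotC (u w : R3) : dot u w = dot w u.
Proof. by apply: eq_bigr => i _; rewrite mulrC. Qed.

Lemma dotDl (u u' w : R3) : dot (u + u') w = dot u w + dot u' w.
Proof. by rewrite -big_split; apply: eq_bigr => i _; rewrite mxE mulrDl. Qed.

Lemma dotZl (s : R) (u w : R3) : dot (s *: u) w = s * dot u w.
Proof. by rewrite mulr_sumr; apply: eq_bigr => i _; rewrite mxE mulrA. Qed.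

Lemma dotDr (u w w' : R3) : dot u (w + w') = dot u w + dot u w'.
Proof. by rewrite dotC dotDl !(dotC u). Qed.

Lemma dotZr (s : R) (u w : R3) : dot u (s *: w) = s * dot u w.
Proof. by rewrite dotC dotZl dotC. Qed.

Lemma dot_eq0 (u : R3) : (dot u u == 0) = (u == 0).
Proof.
apply/eqP/eqP => [|->]; last by rewrite /dot big1 // => i _; rewrite mxE mul0r.
move=> /eqP; rewrite psumr_eq0; last by move=> i _; rewrite -expr2 sqr_ge0.
move=> /allP h; apply/rowP => i; have /implyP/(_ isT) := h i (mem_index_enum _).
by rewrite mulf_eq0 orbb mxE => /eqP.
Qed.

Lemma dot_gt0 (u : R3) : u != 0 -> 0 < dot u u.
Proof.
by move=> u0; rewrite lt_neqAle eq_sym dot_eq0 u0 sumr_ge0 // => i _; rewrite -expr2 sqr_ge0.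
Qed.

Lemma rows_neq (i j : 'I_n) : i \in T -> j \in T -> i != j -> row j x - row i x != 0.
Proof.
move=> iT jT ij; apply/eqP => e.
have /(_ _ _ _)/rowP/(_ j) := tT.2 (delta_mx 0 j - delta_mx 0 i : 'rV[R]_n).
rewrite !mxE !eqxx /= eq_sym (negPf ij) subr0 => h.
suff : (1 : R) = 0 by apply/eqP; rewrite oner_eq0.
apply: h => [m mT||]; last by rewrite mulmxBl -!rowE.
  have mF h : h \in T -> m == h = false by move=> hT; apply: contraNF mT => /eqP ->.
  by rewrite !mxE !eqxx /= (mF j jT) (mF i iT) subrr.
under eq_bigr do rewrite !mxE !eqxx /=.
rewrite sumrB (bigD1 j) //= eqxx big1; last by move=> m /negPf ->.
by rewrite [X in _ - X](bigD1 i) //= eqxx [X in _ - (_ + X)]big1 ?addr0 ?subrr // => m /negPf ->.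
Qed.

(** A direction [z0] with the prescribed components off the edge is made orthogonal to the edge by
    subtracting [tau] times the tangent, whose barycentric components sit at [i0] and [i1] only. *)
Lemma edge_coef_eq0 (i0 i1 : 'I_n) N : i0 \in T -> i1 \in T -> i0 != i1 ->
  (forall d, (d < N)%N ->
     (forall a, multi_index T a -> (dist a [set i0; i1] < d)%N -> c a = 0) ->
   forall u, orthogonal_to x [set i0; i1] u ->
   forall t, 0 < t < 1 ->
     dirderiv u d bernstein_comb (row i0 x + t *: (row i1 x - row i0 x)) = 0) ->
  forall a, multi_index T a -> (dist a [set i0; i1] < N)%N -> c a = 0.
Proof.
move=> i0T i1T i01 H.
have eT : [set i0; i1]%SET \subset T by rewrite finset.subUset !finset.sub1set i0T.
apply: jet_coef_eq0 => //; first by apply/set0Pn; exists i0; rewrite !inE eqxx.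
move=> d dN low l l0 lg l1 y.
set w := row i1 x - row i0 x.
have w0 : 0 < dot w w.
  by apply: dot_gt0; exact: rows_neq i0T i1T i01.
pose S := \sum_(j in T :\: [set i0; i1]) y j.
pose z0 : 'rV[R]_n := \row_i if i == i0 then - S else if i == i1 then 0 else if i \in T then y i else 0.
pose tau := dot (z0 *m x) w / dot w w.
pose z : 'rV[R]_n := z0 - tau *: (delta_mx 0 i1 - delta_mx 0 i0).
have zx : z *m x = z0 *m x - tau *: w.
  by rewrite mulmxBl -scalemxAl mulmxBl -!rowE.
have i10 : i1 == i0 = false by rewrite eq_sym (negPf i01).
have zi i : i != i0 -> i != i1 -> z 0 i = if i \in T then y i else 0.
  by move=> /negPf h0 /negPf h1; rewrite !mxE h0 h1 !eqxx /= subrr mulr0 subr0.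
exists (z *m x) => [i|].
  rewrite !inE negb_or => /andP[/andP[h0 h1] iT]; rewrite (baryd_unique tT); first by rewrite zi ?iT.
    move=> j jT; rewrite zi ?(negPf jT) //; by apply: contraNneq jT => ->.
  rewrite (bigD1 i0) //= (bigD1 i1) /= ?i10 //.
  rewrite (eq_bigr (fun j => if j \in T then y j else 0)); last by move=> j /andP[? ?]; exact: zi.
  rewrite -big_mkcondr (eq_bigl [in T :\: [set i0; i1]]); last first.
    by move=> j; rewrite !inE negb_or.
  rewrite !mxE !eqxx i10 (negPf i01) /= -/S; ring.
have -> : l *m x = row i0 x + l 0 i1 *: w.
  have l01 : l 0 i0 = 1 - l 0 i1.
    rewrite -l1 (bigD1 i0) //= (bigD1 i1) /= ?i10 // big1 ?addr0 ?addrK //.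
    by move=> j /andP[? ?]; rewrite lg // !inE negb_or; apply/andP.
  have lE : l = delta_mx 0 i0 + l 0 i1 *: (delta_mx 0 i1 - delta_mx 0 i0).
    apply/rowP => j; rewrite !mxE !eqxx /=.
    have [->|j0] := eqVneq j i0; first by rewrite (negPf i01) l01 /=; ring.
    have [->|j1] := eqVneq j i1; first by rewrite /=; ring.
    by rewrite lg ?inE ?negb_or ?j0 ?j1 //=; ring.
  by rewrite {1}lE mulmxDl -scalemxAl mulmxBl -!rowE.
apply: H => //.
  have : dot (z *m x) w = 0.
    by rewrite zx dotDl -scaleNr dotZl mulNr divfK ?subrr // gt_eqF.
  move=> zw i j; rewrite !inE => /orP[/eqP->|/eqP->] /orP[/eqP->|/eqP->].
  - by rewrite subrr -(scale0r 0) dotZl mul0r.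
  - by rewrite -opprB -scaleN1r dotZl dotC zw mulr0.
  - by rewrite dotC.
  - by rewrite subrr -(scale0r 0) dotZl mul0r.
have p0 := l0 i0; have p1 := l0 i1.
rewrite p1 ?inE ?eqxx ?orbT //= -l1 (bigD1 i0) //= (bigD1 i1) /= ?i10 // big1.
  by rewrite addr0 ltrDr p0 // !inE eqxx.
by move=> j /andP[? ?]; rewrite lg // !inE negb_or; apply/andP.
Qed.

(** The orthogonal complement of [w] has dimension 2, so two independent vectors in it span it. *)
Lemma orthogonal_comb (w u1 u2 u : R3) : w != 0 ->
  dot w u1 = 0 -> dot w u2 = 0 -> row_free (col_mx u1 u2) -> dot w u = 0 ->
  exists s t, u = s *: u1 + t *: u2.
Proof.
move=> w0 w1 w2 free wu.
have dm (u' : R3) : dot w u' = 0 -> (u' <= kermx w^T)%MS.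
  move=> h; apply/sub_kermxP/rowP => i; rewrite !mxE ord1 -[RHS]h.
  by apply: eq_bigr => j _; rewrite mxE mulrC.
have sub : (col_mx u1 u2 <= kermx w^T)%MS by rewrite -addsmxE addsmx_sub !dm.
have : (kermx w^T <= col_mx u1 u2)%MS.
  rewrite -(geq_leqif (mxrank_leqif_sup sub)) mxrank_ker mxrank_tr.
  by move/eqP: free => ->; rewrite rank_rV w0.
move=> /(submx_trans (dm u wu))/submxP[D ->].
exists (lsubmx D 0 0), (rsubmx D 0 0).
rewrite -{1}(hsubmxK D) mul_row_col.
by rewrite -!mul_scalar_mx -!mx11_scalar.
Qed.

End Jets.

(** * Zero integrals of nonnegative continuous functions *)

Section MeasureBase.
Context {R : realType}.

(* A countable neighbourhood base of measurable sets of positive measure; the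
   neighbourhood system [nb] is a parameter since products carry no joint
   topological and measurable structure. *)
Definition measure_base d (X : measurableType d) (nb : X -> set_system X)
    (mu : {measure set X -> \bar R}) : Prop :=
  exists (I : countType) (B : I -> set X),
    [/\ forall i, measurable (B i), forall i, B i !=set0 -> (0 < mu (B i))%E &
        forall p U, nb p U -> exists2 i, B i p & B i `<=` U].

Definition nb_continuous d (X : measurableType d) (nb : X -> set_system X) (f : X -> R) : Prop :=
  forall p V, nbhs (f p) V -> nb p (f @^-1` V).

Lemma measure_base_lebesgue :
  measure_base (fun p : measurableTypeR R => nbhs (p : R)) (@lebesgue_measure R).
Proof.
exists (rat * rat)%type, (fun q : rat * rat => `]ratr q.1, ratr q.2[%classic); split.
- by move=> i; exact: measurable_itv.
- move=> [q r] [p /=]; rewrite in_itv /= => /andP[qp pr].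
  have qr : ratr q < ratr r :> R by exact: lt_trans pr.
  by rewrite lebesgue_measure_itv /= lte_fin qr -EFinB lte_fin subr_gt0.
- move=> p U /nbhs_ballP[e /= e0 eU].
  have [q] : exists q : rat, ratr q \in `](p - e), p[ by apply: rat_in_itvoo; lra.
  rewrite in_itv /= => /andP[q1 q2].
  have [r] : exists q : rat, ratr q \in `]p, (p + e)[ by apply: rat_in_itvoo; lra.
  rewrite in_itv /= => /andP[r1 r2].
  exists (q, r); rewrite /= ?in_itv /= ?q2 //.
  move=> z; rewrite /= in_itv /= => /andP[z1 z2]; apply: eU.
  by rewrite /ball /= ltr_norml; apply/andP; split; lra.
Qed.

Lemma measure_base_prod d1 d2 (X : measurableType d1) (Y : measurableType d2)
    (nb1 : X -> set_system X) (nb2 : Y -> set_system Y)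
    (mu1 : {measure set X -> \bar R}) (mu2 : {sigma_finite_measure set Y -> \bar R}) :
  measure_base nb1 mu1 -> measure_base nb2 mu2 ->
  measure_base (fun p : X * Y => filter_prod (nb1 p.1) (nb2 p.2)) (mu1 \x mu2)%E.
Proof.
move=> [I [B [Bm Bp Bb]]] [J [C [Cm Cp Cb]]].
exists (I * J)%type, (fun ij : I * J => B ij.1 `*` C ij.2); split.
- by move=> ij; exact: measurableX.
- move=> [i j] [[p q] [/= Bip Cjq]]; rewrite product_measure1E //.
  by apply: mule_gt0; [apply: Bp; exists p|apply: Cp; exists q].
- move=> [p q] U [[P Q] [/= /Bb[i Bip BiP] /Cb[j Cjq CjQ]] PQU].
  exists (i, j) => // -[a b] [/= Ba Cb']; apply: PQU.
  by split; [exact: BiP|exact: CjQ].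
Qed.

Section Base.
Context d (X : measurableType d) (nb : X -> set_system X) (mu : {measure set X -> \bar R}).
Hypothesis hb : measure_base nb mu.

(** U is the union of the base sets that it contains, and these are countably many. *)
Lemma nb_open_measurable (U : set X) : (forall p, U p -> nb p U) -> measurable U.
Proof.
case: hb => I [B [Bm _ Bb]] Uo.
rewrite (_ : U = \bigcup_i (if `[< B i `<=` U >] then B i else set0)).
  by apply: countable_bigcupT_measurable => // i; case: ifP.
apply/seteqP; split=> [p Up|p [i _]].
  have [i Bip BiU] := Bb _ _ (Uo p Up).
  by exists i => //; case: asboolP.
by case: asboolP => // BiU /BiU.
Qed.

Lemma nb_continuous_measurable (f : X -> R) D :
  nb_continuous nb f -> measurable D -> measurable_fun D f.
Proof.
move=> fc mD; apply: (measurable_funS measurableT) => //.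
apply: (measurability _ (measurable_realfun.RGenOpens.measurableE R)) => _ [_ [a [b ->] <-]].
rewrite setTI; apply: nb_open_measurable => p fp; apply: fc.
by apply: open_nbhs_nbhs; split=> //; exact: interval_open.
Qed.

(** If f p > 0, then f exceeds f p / 2 on a base set around p inside D; this set has positive
    measure, and so does the integral. *)
Lemma nb_integral_eq0 (D : set X) (f : X -> R) (p : X) :
  (forall q, Filter (nb q)) -> nb_continuous nb f -> measurable D ->
  mu.-integrable D (EFin \o f) -> (forall q, D q -> 0 <= f q) ->
  \int[mu]_(q in D) f q = 0 -> nb p D -> D p -> f p = 0.
Proof.
move=> nbF fc mD fi f0 If pD Dp; apply/eqP; rewrite eq_le f0 // andbT leNgt.
apply/negP => fp.
have : nb p (D `&` f @^-1` [set z | f p / 2 < z]).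
  apply: filterI => //; apply: fc; apply: lt_nbhsr; lra.
case: hb => I [B [Bm Bp Bb]] /Bb[i Bip BU].
have mf := measurable_int _ fi.
(* The real integral is the finite part of the extended one, which would also be 0 at infinity;
   integrability excludes that. *)
have /eqP : (\int[mu]_(q in D) (f q)%:E)%E = 0%E.
  have := integrable_fin_num mD fi => /fineK <-.
  by rewrite -[fine _]/(\int[mu]_(q in D) f q) If.
apply/negP; rewrite gt_eqF //.
apply: (@lt_le_trans _ _ (\int[mu]_(q in B i) (f p / 2)%:E)%E).
  rewrite integral_cst //; apply: mule_gt0; last by apply: Bp; exists p.
  by rewrite lte_fin; lra.
apply: (@le_trans _ _ (\int[mu]_(q in B i) (f q)%:E)%E).
  apply: ge0_le_integral => //.
  - by move=> q _; rewrite lee_fin; lra.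
  - by apply: measurable_funS mf => // q /BU[].
  - by move=> q /BU[_ /= fq]; rewrite lee_fin ltW.
apply: ge0_subset_integral => //; last by move=> q /BU[].
Qed.

Lemma nb_bounded_integrable (D : set X) (f : X -> R) (M : R) :
  nb_continuous nb f -> measurable D -> (mu D < +oo)%E ->
  (forall q, D q -> `|f q| <= M) -> mu.-integrable D (EFin \o f).
Proof.
move=> fc mD Doo fM; apply: measurable_bounded_integrable => //.
  exact: nb_continuous_measurable.
exists M; split; first exact: num_real.
by move=> z Mz q Dq; apply: le_trans (fM q Dq) (ltW Mz).
Qed.

End Base.
End MeasureBase.

(** * Integration over the unit interval, the unit triangle and a tetrahedron *)

Section SpaceR3.
Context {R : realType}.
Notation R3 := 'rV[R]_3.
Notation leb1 := (@lebesgue_measure R).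

Definition nb1 : measurableTypeR R -> set_system (measurableTypeR R) := fun p => nbhs (p : R).
Definition nb2 (p : measurableTypeR R * measurableTypeR R) := filter_prod (nb1 p.1) (nb1 p.2).
Definition nb3 (p : measurableTypeR R * measurableTypeR R * measurableTypeR R) :=
  filter_prod (nb2 p.1) (nb1 p.2).

Lemma leb1_base : measure_base nb1 leb1.
Proof. exact: measure_base_lebesgue. Qed.

Lemma leb2_base : measure_base nb2 (@leb2 R).
Proof. exact: measure_base_prod leb1_base leb1_base. Qed.

Lemma leb3_base : measure_base nb3 (@leb3 R).
Proof. exact: measure_base_prod leb2_base leb1_base. Qed.

Lemma toR3_continuous : continuous (@toR3 R).
Proof.
rewrite (_ : @toR3 R = fun u => u.1.1 *: delta_mx 0 0 + u.1.2 *: delta_mx 0 1 + u.2 *: delta_mx 0 2%:R).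
  move=> u; apply: cvgD; first apply: cvgD.
  - by apply: cvgZ; [exact: (continuous_comp cvg_fst cvg_fst)|exact: cvg_cst].
  - by apply: cvgZ; [exact: (continuous_comp cvg_fst cvg_snd)|exact: cvg_cst].
  - by apply: cvgZ; [exact: cvg_snd|exact: cvg_cst].
apply/funext => u; apply/rowP => c; rewrite !mxE /=.
by case: c => -[|[|[|//]]] h; rewrite /= ?mulr1 ?mulr0 ?addr0 ?add0r.
Qed.

End SpaceR3.

Section IntegrationDomains.
Context {R : realType}.
Notation R3 := 'rV[R]_3.
Notation leb1 := (@lebesgue_measure R).

Lemma continuous_bounded_compact (X : topologicalType) (K : set X) (f : X -> R) :
  compact K -> continuous f -> exists M, forall p, K p -> `|f p| <= M.
Proof.
move=> cK cf; have : bounded_set (f @` K).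
  apply: compact_bounded; apply: continuous_compact => //.
  exact: continuous_subspaceT.
move=> [M [_ h]]; exists (M + 1) => p Kp; apply: (h (M + 1)); first by rewrite ltrDl.
by exists p.
Qed.

Lemma nb2_continuous (f : R * R -> R) : continuous f -> nb_continuous (@nb2 R) f.
Proof. by move=> fc [p q] V; exact: fc. Qed.

Lemma nb3_continuous (f : R * R * R -> R) : continuous f -> nb_continuous (@nb3 R) f.
Proof. by move=> fc [[p q] r] V; exact: fc. Qed.

Lemma nb2_filter p : Filter (@nb2 R p). Proof. exact: filter_prod_filter. Qed.
Lemma nb3_filter p : Filter (@nb3 R p). Proof. exact: filter_prod_filter. Qed.

Lemma nb_ge0_measurable d (X : measurableType d) (nb : X -> set_system X)
    (mu : {measure set X -> \bar R}) (f : X -> R) :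
  measure_base nb mu -> nb_continuous nb f -> measurable [set p | 0 <= f p].
Proof.
move=> hb fc; rewrite (_ : [set _ | _] = ~` [set p | f p < 0]).
  apply: measurableC; apply: (nb_open_measurable hb) => p /= fp.
  exact: fc (lt_nbhsl fp).
apply/seteqP; split=> p /=; first by rewrite leNgt => /negP.
by move/negP; rewrite -leNgt.
Qed.

(** With [triangle], the parameter domains of [int1] and [int2], typed over the measurable copy of
    R. *)
Definition interval01 : set (measurableTypeR R) := `[0, 1]%classic.

Definition triangle : set (measurableTypeR R * measurableTypeR R) :=
  [set t | [/\ 0 <= t.1, 0 <= t.2 & t.1 + t.2 <= 1]].

Lemma interval01_measurable : measurable interval01.
Proof. exact: measurable_itv. Qed.

Lemma itv_measure (a b : R) : (leb1 `[a, b]%classic < +oo)%E.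
Proof. by rewrite lebesgue_measure_itv /=; case: ifP => _; rewrite -?EFinB ltry. Qed.

Lemma interval01_integrable (f : R -> R) : continuous f ->
  leb1.-integrable interval01 (EFin \o f).
Proof.
move=> fc; have [M fM] := continuous_bounded_compact (@segment_compact R 0 1) fc.
apply: (nb_bounded_integrable leb1_base (M := M)) => //.
- exact: interval01_measurable.
- exact: itv_measure.
Qed.

Lemma box2_measure (a b : R) : (leb2 (`[a, b]%classic `*` `[a, b]%classic) < +oo)%E.
Proof.
rewrite /leb2 product_measure1E; try exact: measurable_itv.
apply: lte_mul_pinfty; [exact: measure_ge0| |exact: itv_measure].
by rewrite ge0_fin_numE; [exact: itv_measure|exact: measure_ge0].
Qed.

Lemma box3_measure (a b : R) :
  (leb3 (`[a, b]%classic `*` `[a, b]%classic `*` `[a, b]%classic) < +oo)%E.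
Proof.
rewrite /leb3 product_measure1E; try exact: measurable_itv; last first.
  by apply: measurableX; exact: measurable_itv.
apply: lte_mul_pinfty; [exact: measure_ge0| |exact: itv_measure].
by rewrite ge0_fin_numE; [exact: box2_measure|exact: measure_ge0].
Qed.

Lemma box3_compact (a b : R) :
  compact (`[a, b]%classic `*` `[a, b]%classic `*` `[a, b]%classic : set (R * R * R)).
Proof. by do ![apply: compact_setX|exact: segment_compact]. Qed.

Lemma box3_measurable (a b : R) :
  measurable (`[a, b]%classic `*` `[a, b]%classic `*` `[a, b]%classic :
    set (measurableTypeR R * measurableTypeR R * measurableTypeR R)).
Proof. by do ![apply: measurableX|exact: measurable_itv]. Qed.

Lemma triangle_measurable : measurable triangle.
Proof.
have c1 : continuous (fun t : R * R => t.1) by move=> t; exact: cvg_fst.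
have c2 : continuous (fun t : R * R => t.2) by move=> t; exact: cvg_snd.
rewrite (_ : triangle = [set t | 0 <= t.1] `&` [set t | 0 <= t.2] `&` [set t | 0 <= 1 - (t.1 + t.2)]).
  apply: measurableI; first apply: measurableI.
  - exact: (nb_ge0_measurable leb2_base (nb2_continuous c1)).
  - exact: (nb_ge0_measurable leb2_base (nb2_continuous c2)).
  - apply: (nb_ge0_measurable leb2_base (nb2_continuous _)) => t.
    by apply: cvgB; [exact: cvg_cst|apply: cvgD; [exact: c1|exact: c2]].
apply/seteqP; split=> t /=; first by case=> h1 h2 h3; rewrite subr_ge0.
by case=> -[h1 h2]; rewrite subr_ge0 => h3.
Qed.

Lemma triangle_integrable (f : R * R -> R) : continuous f ->
  (@leb2 R).-integrable triangle (EFin \o f).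
Proof.
move=> fc.
have sub : triangle `<=` `[0, 1]%classic `*` `[0, 1]%classic.
  move=> t [t1 t2 t12]; split=> /=; rewrite in_itv /=; apply/andP; split => //; lra.
have [M fM] := continuous_bounded_compact
  (compact_setX (@segment_compact R 0 1) (@segment_compact R 0 1)) fc.
apply: (nb_bounded_integrable leb2_base (M := M)).
- by move=> [p q] V; exact: fc.
- exact: triangle_measurable.
- apply: le_lt_trans (box2_measure 0 1); apply: le_measure => //; rewrite inE.
    exact: triangle_measurable.
  by apply: measurableX; exact: measurable_itv.
- by move=> q /sub /fM.
Qed.

Lemma toR3_box (M : R) u : (forall c, `|toR3 u 0 c| <= M) ->
  (`[- M, M]%classic `*` `[- M, M]%classic `*` `[- M, M]%classic) u.
Proof.
move=> h; have := (h 0, h 1, h 2%:R); rewrite /toR3 !mxE /= => -[[h0 h1] h2].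
by split; [split|]; rewrite /= in_itv /= -ler_norml.
Qed.

Lemma toR3_integrable (D : set R3) (f : R3 -> R) (M : R) :
  continuous f -> measurable (@toR3 R @^-1` D) ->
  (forall p c, D p -> `|p 0 c| <= M) ->
  (@leb3 R).-integrable (@toR3 R @^-1` D) (EFin \o (f \o @toR3 R)).
Proof.
move=> fc mD DM.
have fc' : continuous (f \o @toR3 R).
  by move=> u; apply: continuous_comp; [exact: toR3_continuous|exact: fc].
have [N fN] := continuous_bounded_compact (@box3_compact (- M) M) fc'.
have sub u : toR3 u \in D -> (`[- M, M]%classic `*` `[- M, M]%classic `*` `[- M, M]%classic) u.
  by rewrite inE => Du; apply: toR3_box => c; exact: DM.
apply: (nb_bounded_integrable leb3_base (M := N)) => //.
- apply: le_lt_trans (box3_measure (- M) M); apply: le_measure; rewrite ?inE //.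
    exact: box3_measurable.
  by move=> u Du; apply: sub; rewrite inE.
- by move=> u Du; apply: fN; apply: sub; rewrite inE.
Qed.

Section SimplexDomain.
Context {n : nat}.
Variables (x : 'M[R]_(n, 3)) (T : {set 'I_n}).
Hypothesis tT : tetrahedron x T.

Lemma simplexE p : simplex x T p <-> forall i, 0 <= bary x T p 0 i.
Proof.
split=> [[l h l0]|h]; first by rewrite (bary_unique tT.2 h).
by exists (bary x T p) => //; exact: bary_barycentric.
Qed.

Lemma simplex_bounded p c : simplex x T p -> `|p 0 c| <= \sum_i \sum_d `|x i d|.
Proof.
move=> [l [lT l1 <-] l0]; rewrite mxE; apply: le_trans (ler_norm_sum _ _ _) _.
apply: ler_sum => i _; rewrite normrM (ger0_norm (l0 i)).
have li : l 0 i <= 1 by rewrite -l1 (bigD1 i) //= lerDl sumr_ge0.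
apply: (@le_trans _ _ `|x i c|); first by rewrite ler_piMl.
by rewrite (bigD1 c) //= lerDl sumr_ge0.
Qed.

Lemma bary_toR3_continuous i : continuous (fun u => bary x T (toR3 u) 0 i).
Proof.
move=> u; apply: (continuous_comp (f := @toR3 R) (g := fun p => bary x T p 0 i)).
  exact: toR3_continuous.
exact: polyfun_continuous (bary_polyfun tT i) _.
Qed.

Lemma simplex_measurable : measurable (@toR3 R @^-1` simplex x T).
Proof.
rewrite (_ : _ @^-1` _ = ~` \bigcup_(i in [set: 'I_n]) [set u | bary x T (toR3 u) 0 i < 0]).
  apply: measurableC; apply: countable_bigcupT_measurable => // i.
  apply: (nb_open_measurable leb3_base) => u /= ui.
  by have := nb3_continuous (@bary_toR3_continuous i) (lt_nbhsl ui).
apply/seteqP; split=> u /=.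
  by move=> /simplexE h [i _ /=]; rewrite ltNge h.
by move=> h; apply/simplexE => i; rewrite leNgt; apply/negP => ui; apply: h; exists i.
Qed.

Lemma simplex_integrable (f : R3 -> R) : continuous f ->
  (@leb3 R).-integrable (@toR3 R @^-1` simplex x T) (EFin \o (f \o @toR3 R)).
Proof.
move=> fc; apply: toR3_integrable => //; first exact: simplex_measurable.
by move=> p c; exact: simplex_bounded.
Qed.

Lemma toR3_surj (p : R3) : exists u, toR3 u = p.
Proof.
exists (p 0 0, p 0 1, p 0 2%:R); apply/rowP => c; rewrite !mxE /=.
by case: c => -[|[|[|//]]] h /=; congr (p _ _); apply/val_inj.
Qed.

Lemma simplex_integral_eq0 (f : R3 -> R) p : continuous f ->
  (forall q, simplex x T q -> 0 <= f q) -> int3 (simplex x T) f = 0 ->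
  (forall i, i \in T -> 0 < bary x T p 0 i) -> f p = 0.
Proof.
move=> fc f0 If p0; have [u up] := toR3_surj p.
rewrite -up; apply: (nb_integral_eq0 (f := f \o @toR3 R) leb3_base (D := @toR3 R @^-1` simplex x T)).
- by apply: nb3_continuous => v; apply: continuous_comp; [exact: toR3_continuous|exact: fc].
- exact: simplex_measurable.
- exact: simplex_integrable.
- by move=> v /= /f0.
- exact: If.
- have F := @nb3_filter u.
  (* For i in T positivity at p persists nearby; for i off T the coordinate is identically 0.
     Together they make p an interior point of the simplex. *)
  have h (i : 'I_n) : nb3 u [set v | 0 <= bary x T (toR3 v) 0 i].
    have [iT|iT] := boolP (i \in T).
      have := p0 i iT; rewrite -up => ui.
      apply: (filterS (P := [set v | 0 < bary x T (toR3 v) 0 i])).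
        by move=> v /= /ltW.
      by have := nb3_continuous (@bary_toR3_continuous i) (lt_nbhsr ui).
    rewrite (_ : [set v | _] = setT); first exact: filterT.
    apply/seteqP; split=> // v _ /=.
    by have [-> //] := bary_barycentric tT (toR3 v).
  have h' : nb3 u [set v | forall i, 0 <= bary x T (toR3 v) 0 i].
    exact: (@filter_forall _ _ (fun (i : 'I_n) v => 0 <= bary x T (toR3 v) 0 i) _ F h).
  apply: filterS h' => v hv /=.
  by apply/simplexE => i; exact: hv.
- rewrite /= up; apply/simplexE => i; have [/p0/ltW//|iT] := boolP (i \in T).
  by have [-> //] := bary_barycentric tT p.
Qed.

End SimplexDomain.

Lemma interval01_integral_eq0 (f : R -> R) t : continuous f ->
  (forall t, 0 <= t <= 1 -> 0 <= f t) ->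
  \int[leb1]_(t in interval01) f t = 0 -> 0 < t < 1 -> f t = 0.
Proof.
move=> fc f0 If /andP[t0 t1].
apply: (nb_integral_eq0 leb1_base (D := interval01)) => //.
- exact: interval01_measurable.
- exact: interval01_integrable.
- apply: filterS2 (lt_nbhsr t0) (lt_nbhsl t1) => z z0 z1.
  by rewrite /interval01 /= in_itv /= !ltW.
- by rewrite /interval01 /= in_itv /= !ltW.
Qed.

Lemma triangle_integral_eq0 (f : R * R -> R) t : continuous f ->
  (forall t, triangle t -> 0 <= f t) ->
  \int[leb2]_(t in triangle) f t = 0 -> 0 < t.1 -> 0 < t.2 -> t.1 + t.2 < 1 -> f t = 0.
Proof.
move=> fc f0 If t1 t2 t12.
apply: (nb_integral_eq0 leb2_base (D := triangle)) => //.
- exact: triangle_measurable.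
- exact: triangle_integrable.
- have F := @nb2_filter t.
  have c1 : continuous (fun t : R * R => t.1) by move=> q; exact: cvg_fst.
  have c2 : continuous (fun t : R * R => t.2) by move=> q; exact: cvg_snd.
  have c12 : continuous (fun t : R * R => t.1 + t.2).
    by move=> q; apply: cvgD; [exact: c1|exact: c2].
  have h1 := nb2_continuous c1 (lt_nbhsr t1).
  have h2 := nb2_continuous c2 (lt_nbhsr t2).
  have h3 := nb2_continuous c12 (lt_nbhsl t12).
  apply: filterS (filterI (filterI h1 h2) h3) => z [[z1 z2] z3].
  by split; exact: ltW.
- by split; exact: ltW.
Qed.

End IntegrationDomains.

(** * Integrability and linearity of the edge, face and cell integrals *)

Section ContinuousOn.
Context {R : realType}.
Notation R3 := 'rV[R]_3.
Implicit Types (K : set R3) (f h : R3 -> R).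

(** Agreement on K with a globally continuous function. Test functions are extended by zero, hence
    discontinuous on the whole space, while the integrals only see K. *)
Definition cont_on K h := exists2 h', continuous h' & forall p, K p -> h p = h' p.

Lemma cont_onD K f h : cont_on K f -> cont_on K h -> cont_on K (fun p => f p + h p).
Proof.
move=> [f' fc fE] [h' hc hE]; exists (fun p => f' p + h' p).
  by move=> p; exact: (cvgD (fc p) (hc p)).
by move=> p Kp; rewrite fE ?hE.
Qed.

Lemma cont_onM K f h : cont_on K f -> cont_on K h -> cont_on K (fun p => f p * h p).
Proof.
move=> [f' fc fE] [h' hc hE]; exists (fun p => f' p * h' p).
  by move=> p; exact: (cvgM (fc p) (hc p)).
by move=> p Kp; rewrite fE ?hE.
Qed.

Lemma cont_on_polyfun K f : polyfun f -> cont_on K f.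
Proof. by move=> fP; exists f => //; exact: polyfun_continuous. Qed.

Lemma cont_on_eq K f h : (forall p, K p -> f p = h p) -> cont_on K h -> cont_on K f.
Proof. by move=> fh [h' hc hE]; exists h' => // p Kp; rewrite fh ?hE. Qed.

Lemma cont_on_restr K f : polyfun f -> cont_on K (f \_ K).
Proof.
move=> fP; apply: cont_on_eq (cont_on_polyfun _ fP) => p Kp.
by rewrite patchE mem_set.
Qed.

Lemma cont_on_sum K (J : finType) (F : J -> R3 -> R) :
  (forall j, cont_on K (F j)) -> cont_on K (fun p => \sum_j F j p).
Proof.
move=> h; rewrite (_ : (fun p => _) = \sum_j (F j : R3 -> R^o)); last first.
  by apply/funext => p; rewrite fct_sumE.
apply: (big_ind (cont_on K)) => //; first exact: (cont_on_polyfun _ (PolyC 0)).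
by move=> f1 f2; exact: cont_onD.
Qed.

Lemma cont_on_dot K (v q : R3 -> R3) : polyfield v ->
  (forall c, cont_on K (fun p => q p 0 c)) -> cont_on K (fun p => dot (v p) (q p)).
Proof.
move=> vP qc; apply: cont_on_sum => c.
by apply: cont_onM; [exact: cont_on_polyfun|exact: qc].
Qed.

End ContinuousOn.

Section Dofs.
Context {R : realType} {n : nat}.
Variables (x : 'M[R]_(n, 3)) (T : {set 'I_n}).
Hypothesis tT : tetrahedron x T.
Notation R3 := 'rV[R]_3.
Notation leb1 := (@lebesgue_measure R).
Implicit Types (e f : {set 'I_n}).

(** The endpoints are named in the order of [enum], that is, in the order of the parametrization in
    [int1]. *)
Lemma edge_vertices e : e \subset T -> #|e| = 2%N -> exists i0 i1,
  [/\ e = [set i0; i1]%SET, i0 != i1, i0 \in T /\ i1 \in T,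
      vertex x e 0 = row i0 x & vertex x e 1 = row i1 x].
Proof.
move=> eT e2; have := enum_uniq [in e]; have := cardE e; rewrite e2 /vertex.
have : enum e =i e by move=> i; rewrite mem_enum.
case: (enum e) => [//|i0 [//|i1 [|//]]] ei _; rewrite /= inE andbT => i01.
have eE : e = [set i0; i1]%SET by apply/setP => i; rewrite !inE -ei !inE.
exists i0, i1; split=> //.
by split; apply: (fintype.subsetP eT); rewrite eE !inE eqxx ?orbT.
Qed.

Lemma face_vertices f : f \subset T -> #|f| = 3%N -> exists i0 i1 i2,
  [/\ f = [set i0; i1; i2]%SET, [/\ i0 != i1, i0 != i2 & i1 != i2],
      [/\ i0 \in T, i1 \in T & i2 \in T],
      vertex x f 0 = row i0 x & vertex x f 1 = row i1 x /\ vertex x f 2 = row i2 x].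
Proof.
move=> fT f3; have := enum_uniq [in f]; have := cardE f; rewrite f3 /vertex.
have : enum f =i f by move=> i; rewrite mem_enum.
case: (enum f) => [//|i0 [//|i1 [//|i2 [|//]]]] fi _; rewrite /= !inE andbT negb_or => /andP[/andP[i01 i02] i12].
have fE : f = [set i0; i1; i2]%SET by apply/setP => i; rewrite !inE -fi !inE orbA.
exists i0, i1, i2; split=> //.
by split; apply: (fintype.subsetP fT); rewrite fE !inE eqxx ?orbT.
Qed.

(** Barycentric coordinates of the point of parameter t in [int1]. *)
Definition edge_pt (i0 i1 : 'I_n) (t : R) : 'rV[R]_n :=
  delta_mx 0 i0 + t *: (delta_mx 0 i1 - delta_mx 0 i0).

Lemma edge_pt_mul i0 i1 t :
  edge_pt i0 i1 t *m x = row i0 x + t *: (row i1 x - row i0 x).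
Proof. by rewrite mulmxDl -scalemxAl mulmxBl -!rowE. Qed.

Lemma edge_ptE i0 i1 t i : i0 != i1 ->
  edge_pt i0 i1 t 0 i = if i == i0 then 1 - t else if i == i1 then t else 0.
Proof.
move=> i01; rewrite !mxE !eqxx /=.
have [->|_] := eqVneq i i0; first by rewrite (negPf i01) /=; ring.
by case: eqVneq => _ /=; ring.
Qed.

Lemma sum_delta m (j : 'I_m) : \sum_i (delta_mx 0 j : 'rV[R]_m) 0 i = 1.
Proof.
rewrite (bigD1 j) //= mxE !eqxx big1 ?addr0 // => i /negPf ij.
by rewrite mxE ij andbF.
Qed.

Lemma edge_pt_barycentric i0 i1 t : barycentric x [set i0; i1]%SET (edge_pt i0 i1 t *m x) (edge_pt i0 i1 t).
Proof.
split=> //.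
  by move=> i; rewrite !inE negb_or => /andP[/negPf h0 /negPf h1]; rewrite !mxE h0 h1 !andbF subrr mulr0 addr0.
have E i : edge_pt i0 i1 t 0 i = (delta_mx 0 i0 : 'rV_n) 0 i +
    t * ((delta_mx 0 i1 : 'rV_n) 0 i - (delta_mx 0 i0 : 'rV_n) 0 i) by rewrite !mxE.
under eq_bigr do rewrite E.
by rewrite big_split -mulr_sumr sumrB /= !sum_delta subrr mulr0 addr0.
Qed.

Lemma edge_pt_simplex i0 i1 t : i0 != i1 -> 0 <= t <= 1 ->
  simplex x [set i0; i1]%SET (edge_pt i0 i1 t *m x).
Proof.
move=> i01 /andP[t0 t1]; exists (edge_pt i0 i1 t); first exact: edge_pt_barycentric.
by move=> i; rewrite edge_ptE //; case: ifP => _; [rewrite subr_ge0|case: ifP].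
Qed.

Definition face_pt (i0 i1 i2 : 'I_n) (t : R * R) : 'rV[R]_n :=
  delta_mx 0 i0 + t.1 *: (delta_mx 0 i1 - delta_mx 0 i0) + t.2 *: (delta_mx 0 i2 - delta_mx 0 i0).

Lemma face_pt_mul i0 i1 i2 t : face_pt i0 i1 i2 t *m x =
  row i0 x + t.1 *: (row i1 x - row i0 x) + t.2 *: (row i2 x - row i0 x).
Proof. by rewrite !mulmxDl -!scalemxAl !mulmxBl -!rowE. Qed.

Lemma face_ptE i0 i1 i2 t i : i0 != i1 -> i0 != i2 -> i1 != i2 ->
  face_pt i0 i1 i2 t 0 i = if i == i0 then 1 - t.1 - t.2 else if i == i1 then t.1
    else if i == i2 then t.2 else 0.
Proof.
move=> i01 i02 i12; rewrite !mxE !eqxx /=.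
have [->|_] := eqVneq i i0; first by rewrite (negPf i01) (negPf i02) /=; ring.
have [->|_] := eqVneq i i1; first by rewrite (negPf i12) /=; ring.
by case: eqVneq => _ /=; ring.
Qed.

Lemma face_pt_barycentric i0 i1 i2 t :
  barycentric x [set i0; i1; i2]%SET (face_pt i0 i1 i2 t *m x) (face_pt i0 i1 i2 t).
Proof.
split=> //.
  move=> i; rewrite !inE !negb_or => /andP[/andP[/negPf h0 /negPf h1] /negPf h2].
  by rewrite !mxE h0 h1 h2 !andbF subrr !mulr0 !addr0.
have E i : face_pt i0 i1 i2 t 0 i = (delta_mx 0 i0 : 'rV_n) 0 i +
    t.1 * ((delta_mx 0 i1 : 'rV_n) 0 i - (delta_mx 0 i0 : 'rV_n) 0 i) +
    t.2 * ((delta_mx 0 i2 : 'rV_n) 0 i - (delta_mx 0 i0 : 'rV_n) 0 i) by rewrite !mxE.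
under eq_bigr do rewrite E.
by rewrite !big_split -!mulr_sumr !sumrB /= !sum_delta !subrr !mulr0 !addr0.
Qed.

Lemma face_pt_simplex i0 i1 i2 t : i0 != i1 -> i0 != i2 -> i1 != i2 -> triangle t ->
  simplex x [set i0; i1; i2]%SET (face_pt i0 i1 i2 t *m x).
Proof.
move=> i01 i02 i12 [t1 t2 t12]; exists (face_pt i0 i1 i2 t); first exact: face_pt_barycentric.
by move=> i; rewrite face_ptE //; do ?case: ifP => _ //; lra.
Qed.

Section EdgeIntegral.
Variable e : {set 'I_n}.
Hypotheses (eT : e \subset T) (e2 : #|e| = 2%N).

Lemma int1_cont (h : R3 -> R) : cont_on (simplex x e) h ->
  exists2 H : R -> R, continuous H & forall t, 0 <= t <= 1 ->
    h (vertex x e 0 + t *: (vertex x e 1 - vertex x e 0)) = H t.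
Proof.
have [i0 [i1 [eE i01 _ -> ->]]] := edge_vertices eT e2.
move=> [h' hc hE]; exists (fun t => h' (row i0 x + t *: (row i1 x - row i0 x))).
  move=> t; apply: (continuous_comp (f := fun t : R => row i0 x + t *: (row i1 x - row i0 x)) (g := h')).
    by apply: cvgD; [exact: cvg_cst|apply: cvgZ; [exact: cvg_id|exact: cvg_cst]].
  exact: hc.
by move=> t t01; rewrite hE // eE -edge_pt_mul; exact: edge_pt_simplex.
Qed.

Lemma int1_integrable (h : R3 -> R) : cont_on (simplex x e) h ->
  leb1.-integrable interval01 (EFin \o (fun t => h (vertex x e 0 + t *: (vertex x e 1 - vertex x e 0)))).
Proof.
move=> /int1_cont[H Hc HE]; apply: eq_integrable (interval01_integrable Hc); first exact: interval01_measurable.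
by move=> t; rewrite inE /interval01 /= in_itv /= => t01; rewrite HE.
Qed.

Lemma int1D (g h : R3 -> R) : cont_on (simplex x e) g -> cont_on (simplex x e) h ->
  int1 x e (fun p => g p + h p) = int1 x e g + int1 x e h.
Proof.
move=> gc hc; rewrite /int1 -mulrDr; congr (_ * _).
by apply: RintegralD; [exact: measurable_itv|exact: int1_integrable|exact: int1_integrable].
Qed.

Lemma int1Z (a : R) (g : R3 -> R) : cont_on (simplex x e) g ->
  int1 x e (fun p => a * g p) = a * int1 x e g.
Proof.
move=> gc; rewrite /int1 mulrCA; congr (_ * _).
by apply: RintegralZl; [exact: measurable_itv|exact: int1_integrable].
Qed.

(** The length factor is positive because the endpoints differ, so the integral over the parameter
    vanishes too. *)
Lemma int1_eq0 (h : R3 -> R) : cont_on (simplex x e) h ->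
  (forall p, simplex x e p -> 0 <= h p) -> int1 x e h = 0 ->
  forall t, 0 < t < 1 -> h (vertex x e 0 + t *: (vertex x e 1 - vertex x e 0)) = 0.
Proof.
move=> hc h0 Ih t t01; have [H Hc HE] := int1_cont hc.
have [i0 [i1 [eE i01 [i0T i1T] v0 v1]]] := edge_vertices eT e2.
have t01' : 0 <= t <= 1 by case/andP: t01 => ? ?; rewrite !ltW.
rewrite HE //; apply: interval01_integral_eq0 t01 => //.
  move=> s s01; rewrite -HE //; apply: h0; rewrite v0 v1 eE -edge_pt_mul.
  exact: edge_pt_simplex.
move: Ih; rewrite /int1 => /eqP; rewrite mulf_eq0 sqrtr_eq0 leNgt v0 v1.
rewrite dot_gt0 ?(rows_neq tT) //= => /eqP I0; rewrite -[RHS]I0.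
apply: eq_Rintegral => s; rewrite inE /interval01 /= in_itv /= => s01.
by rewrite -HE // v0 v1.
Qed.

End EdgeIntegral.

Lemma dot_comb (a b : R) (u w : R3) : dot (a *: u + b *: w) (a *: u + b *: w) =
  a ^+ 2 * dot u u + 2 * a * b * dot u w + b ^+ 2 * dot w w.
Proof. by rewrite !dotDl !dotDr !dotZl !dotZr (dotC w u); ring. Qed.

(** Strict Cauchy-Schwarz: w.w times the Gram determinant is the squared norm of (w.w) u - (u.w) w,
    and affine independence forbids this combination to vanish. *)
Lemma triangle_area_gt0 i0 i1 i2 : i0 \in T -> i1 \in T -> i2 \in T ->
  i0 != i1 -> i0 != i2 -> i1 != i2 ->
  0 < dot (row i1 x - row i0 x) (row i1 x - row i0 x) *
      dot (row i2 x - row i0 x) (row i2 x - row i0 x) -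
      dot (row i1 x - row i0 x) (row i2 x - row i0 x) ^+ 2.
Proof.
move=> i0T i1T i2T i01 i02 i12; set u := row i1 x - _; set w := row i2 x - _; rewrite ltNge; apply/negP => D0.
have w0 : 0 < dot w w by apply: dot_gt0; exact: (rows_neq tT i0T i2T i02).
pose l : 'rV[R]_n := dot w w *: (delta_mx 0 i1 - delta_mx 0 i0) - dot u w *: (delta_mx 0 i2 - delta_mx 0 i0).
have lx : l *m x = dot w w *: u - dot u w *: w.
  by rewrite mulmxBl -!scalemxAl !mulmxBl -!rowE.
have z0 : dot (l *m x) (l *m x) <= 0.
  have -> : dot (l *m x) (l *m x) = dot w w * (dot u u * dot w w - dot u w ^+ 2).
    rewrite lx -scaleNr dot_comb; ring.
  by rewrite mulr_ge0_le0 // ltW.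
have {}z0 : l *m x = 0.
  apply/eqP; rewrite -dot_eq0 eq_le z0 /=; apply: sumr_ge0 => i _.
  by rewrite -expr2 sqr_ge0.
have : l = 0.
  apply: tT.2 => //.
    move=> i iT; have h j : j \in T -> i == j = false by move=> jT; apply: contraNF iT => /eqP ->.
    by rewrite !mxE !h // !andbF !subrr !mulr0 subrr.
  have E i : l 0 i = dot w w * ((delta_mx 0 i1 : 'rV_n) 0 i - (delta_mx 0 i0 : 'rV_n) 0 i) -
    dot u w * ((delta_mx 0 i2 : 'rV_n) 0 i - (delta_mx 0 i0 : 'rV_n) 0 i) by rewrite !mxE.
  under eq_bigr do rewrite E.
  by rewrite sumrB -!mulr_sumr !sumrB /= !sum_delta !subrr !mulr0 subrr.
move=> /rowP/(_ i1); rewrite !mxE !eqxx /= (negPf i12) eq_sym (negPf i01) /=.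
by rewrite !subr0 mulr1 mulr0 subr0 => /eqP; rewrite gt_eqF.
Qed.

Section FaceIntegral.
Variable f : {set 'I_n}.
Hypotheses (fT : f \subset T) (f3 : #|f| = 3%N).
Let par (t : R * R) := vertex x f 0 + t.1 *: (vertex x f 1 - vertex x f 0)
  + t.2 *: (vertex x f 2 - vertex x f 0).

Lemma int2_cont (h : R3 -> R) : cont_on (simplex x f) h ->
  exists2 H : R * R -> R, continuous H & forall t, triangle t -> h (par t) = H t.
Proof.
rewrite /par; have [i0 [i1 [i2 [fE [i01 i02 i12] _ -> [-> ->]]]]] := face_vertices fT f3.
move=> [h' hc hE]; exists (fun t => h' (row i0 x + t.1 *: (row i1 x - row i0 x) + t.2 *: (row i2 x - row i0 x))).
  move=> t; apply: (continuous_comp (f := fun t : R * R => row i0 x + t.1 *: (row i1 x - row i0 x) + t.2 *: (row i2 x - row i0 x)) (g := h')).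
    apply: cvgD; last by apply: cvgZ; [exact: cvg_snd|exact: cvg_cst].
    by apply: cvgD; [exact: cvg_cst|apply: cvgZ; [exact: cvg_fst|exact: cvg_cst]].
  exact: hc.
by move=> t t01; rewrite hE // fE -face_pt_mul; exact: face_pt_simplex.
Qed.

Lemma int2_integrable (h : R3 -> R) : cont_on (simplex x f) h ->
  (@leb2 R).-integrable triangle (EFin \o (fun t => h (par t))).
Proof.
move=> /int2_cont[H Hc HE].
apply: eq_integrable (triangle_integrable Hc); first exact: triangle_measurable.
by move=> t; rewrite inE => t01; rewrite /= HE.
Qed.

Lemma int2D (g h : R3 -> R) : cont_on (simplex x f) g -> cont_on (simplex x f) h ->
  int2 x f (fun p => g p + h p) = int2 x f g + int2 x f h.
Proof.
move=> gc hc; rewrite /int2 -mulrDr; congr (_ * _).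
by apply: RintegralD; [exact: triangle_measurable|exact: int2_integrable|exact: int2_integrable].
Qed.

Lemma int2Z (a : R) (g : R3 -> R) : cont_on (simplex x f) g ->
  int2 x f (fun p => a * g p) = a * int2 x f g.
Proof.
move=> gc; rewrite /int2 mulrCA; congr (_ * _).
by apply: RintegralZl; [exact: triangle_measurable|exact: int2_integrable].
Qed.

Lemma int2_eq0 (h : R3 -> R) : cont_on (simplex x f) h ->
  (forall p, simplex x f p -> 0 <= h p) -> int2 x f h = 0 ->
  forall t, 0 < t.1 -> 0 < t.2 -> t.1 + t.2 < 1 -> h (par t) = 0.
Proof.
move=> hc h0 Ih t t1 t2 t12; have [H Hc HE] := int2_cont hc.
have tt : triangle t by split; exact: ltW.
have [i0 [i1 [i2 [fE [i01 i02 i12] [i0T i1T i2T] v0 [v1 v2]]]]] := face_vertices fT f3.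
rewrite HE //; apply: triangle_integral_eq0 => //.
  move=> s ts; rewrite -HE //; apply: h0; rewrite /par v0 v1 v2 fE -face_pt_mul.
  exact: face_pt_simplex.
move: Ih; rewrite /int2 => /eqP; rewrite mulf_eq0 sqrtr_eq0 leNgt v0 v1 v2.
rewrite triangle_area_gt0 //= => /eqP I0; rewrite -[RHS]I0.
by apply: eq_Rintegral => s; rewrite inE => st; rewrite -HE // /par v0 v1 v2.
Qed.

End FaceIntegral.

Lemma int3_integrable (h : R3 -> R) : cont_on (simplex x T) h ->
  (@leb3 R).-integrable (@toR3 R @^-1` simplex x T) (EFin \o (h \o @toR3 R)).
Proof.
move=> [h' hc hE]; apply: eq_integrable (simplex_integrable tT hc).
  exact: simplex_measurable.
by move=> u; rewrite inE => uT; rewrite /= hE.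
Qed.

Lemma int3D (g h : R3 -> R) : cont_on (simplex x T) g -> cont_on (simplex x T) h ->
  int3 (simplex x T) (fun p => g p + h p) = int3 (simplex x T) g + int3 (simplex x T) h.
Proof.
move=> gc hc; apply: RintegralD; [exact: simplex_measurable|exact: int3_integrable|exact: int3_integrable].
Qed.

Lemma int3Z (a : R) (g : R3 -> R) : cont_on (simplex x T) g ->
  int3 (simplex x T) (fun p => a * g p) = a * int3 (simplex x T) g.
Proof.
move=> gc; apply: RintegralZl; [exact: simplex_measurable|exact: int3_integrable].
Qed.

End Dofs.

(** * Linearity of the degrees of freedom *)

Section DofLinearity.
Context {R : realType}.
Notation R3 := 'rV[R]_3.

Lemma dd_comb (u : R3) (a : R) (f h : R3 -> R) : polyfun f -> polyfun h ->
  dd u (fun p => a * f p + h p) = fun p => a * dd u f p + dd u h p.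
Proof.
move=> fP hP; rewrite (polyfun_deriveD u (PolyM (PolyC a) fP) hP).
by rewrite (polyfun_deriveZ u a fP).
Qed.

Lemma dirderiv_comb (u : R3) m (a : R) (f h : R3 -> R) : polyfun f -> polyfun h ->
  dirderiv u m (fun p => a * f p + h p) = fun p => a * dirderiv u m f p + dirderiv u m h p.
Proof.
move=> fP hP; elim: m => // m; rewrite dirderivS => ->.
by rewrite (dd_comb u a (dirderiv_polyfun u m fP) (dirderiv_polyfun u m hP)).
Qed.

Lemma pderiv_comb s (a : R) (f h : R3 -> R) : polyfun f -> polyfun h ->
  pderiv s (fun p => a * f p + h p) = fun p => a * pderiv s f p + pderiv s h p.
Proof.
move=> fP hP; elim: s => // c s IH; rewrite [LHS]/= -/(pderiv s _) IH.
exact: (dd_comb (delta_mx 0 c) a (pderiv_polyfun s fP) (pderiv_polyfun s hP)).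
Qed.

Lemma polyfield_comb (a : R) (v w : R3 -> R3) : polyfield v -> polyfield w ->
  polyfield (a *: v + w).
Proof.
move=> vP wP c; rewrite (_ : (fun p => _) = fun p => a * v p 0 c + w p 0 c).
  by apply: PolyD => //; apply: PolyM => //; exact: PolyC.
by apply/funext => p; rewrite !mxE.
Qed.

Lemma field_comp_comb (a : R) (v w : R3 -> R3) c :
  (fun p => (a *: v + w) p 0 c) = fun p => a * v p 0 c + w p 0 c.
Proof. by apply/funext => p; rewrite !mxE. Qed.

Lemma dirderiv_field_comb (u : R3) m (a : R) (v w : R3 -> R3) :
  polyfield v -> polyfield w ->
  dirderiv u m (a *: v + w) = a *: dirderiv u m v + dirderiv u m w.
Proof.
move=> vP wP; apply/funext => p; apply/rowP => c.
have [_ /(_ c)/(congr1 (fun f => f p)) ->] := dirderiv_polyfield u m (polyfield_comb a vP wP).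
rewrite field_comp_comb dirderiv_comb // !mxE.
have [_ /(_ c) <-] := dirderiv_polyfield u m vP.
by have [_ /(_ c) <-] := dirderiv_polyfield u m wP.
Qed.

Lemma pderiv_field_comb s (a : R) (v w : R3 -> R3) p c :
  polyfield v -> polyfield w ->
  pderiv s (a *: v + w) p 0 c = a * pderiv s v p 0 c + pderiv s w p 0 c.
Proof.
move=> vP wP.
have [_ /(_ c)/(congr1 (fun f => f p)) ->] := pderiv_polyfield s (polyfield_comb a vP wP).
rewrite field_comp_comb pderiv_comb //.
have [_ /(_ c) <-] := pderiv_polyfield s vP.
by have [_ /(_ c) <-] := pderiv_polyfield s wP.
Qed.

Lemma Pvec_polyfield k (v : R3 -> R3) : Pvec k v -> polyfield v.
Proof. by move=> vP c; exact: poly_le_polyfun (vP c). Qed.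

Context {n : nat}.
Variables (x : 'M[R]_(n, 3)) (T : {set 'I_n}).
Hypothesis tT : tetrahedron x T.
Variables (n1 n2 nf : {set 'I_n} -> R3) (rv re rf : int) (k : nat).

Lemma bubble_cont_on (g : {set 'I_n}) r h : g \subset T -> bubble x k g r h -> cont_on (simplex x g) h.
Proof.
move=> gT /lspan_pointwise[c hc].
apply: (cont_on_eq (h := fun p => \sum_(a | bubble_index r g (k := k) a) c a * bernstein x T a p)).
  move=> p pg; rewrite hc; apply: eq_bigr => a _.
  by rewrite (bernstein_sub a gT tT.2 pg).
apply: cont_on_polyfun; apply: polyfun_sum => a _; apply: PolyM; first exact: PolyC.
exact: bernstein_polyfun.
Qed.

Lemma bubble_polyfun r h : bubble x k T r h -> polyfun h.
Proof.
move=> /lspan_pointwise[c hc].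
rewrite (_ : h = fun p => \sum_(a | bubble_index r T (k := k) a) c a * bernstein x T a p); last exact/funext.
apply: polyfun_sum => a _; apply: PolyM; first exact: PolyC.
exact: bernstein_polyfun.
Qed.

Lemma restr_cont_on (K : set R3) (S : set (R3 -> R)) (h : R3 -> R) : (forall f, S f -> cont_on K f) -> restr K S h -> cont_on K h.
Proof.
move=> Sc [f /Sc fc <-]; apply: cont_on_eq fc => p Kp.
by rewrite patchE mem_set.
Qed.

Lemma poly_le_cont_on (K : set R3) (d : int) (f : R3 -> R) : poly_le d f -> cont_on K f.
Proof.
case: d => d; first by move=> /poly_le_polyfun; exact: cont_on_polyfun.
by move=> ->; exact: cont_on_polyfun (PolyC 0).
Qed.

(** Makes single-valuedness stable under linear combinations. It is stated for polynomial fields,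
    for which the derivatives exist and the integrands are integrable. *)
Lemma dof_linear (g : {set 'I_n}) N (a : R) (v w : R3 -> R3) : g \subset T ->
  dof x n1 n2 nf rv re rf k g N -> polyfield v -> polyfield w ->
  N (a *: v + w) = a * N v + N w.
Proof.
move=> gT [i s c _ _|i j q g2 _ _ qP|q g3 qP|q g4 [qP _]] vP wP.
- exact: pderiv_field_comb.
- have P1 u : polyfield u -> polyfield (dirderiv (n2 g) (j - i) u).
    by move=> uP; have [] := dirderiv_polyfield (n2 g) (j - i) uP.
  have P2 u : polyfield u -> polyfield (dirderiv (n1 g) i (dirderiv (n2 g) (j - i) u)).
    by move=> uP; have [] := dirderiv_polyfield (n1 g) i (P1 _ uP).
  have qc c : cont_on (simplex x g) (fun p => q p 0 c).
    by apply: restr_cont_on (qP c) => f; exact: poly_le_cont_on.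
  have C u : polyfield u -> cont_on (simplex x g)
      (fun p => dot (dirderiv (n1 g) i (dirderiv (n2 g) (j - i) u) p) (q p)).
    by move=> uP; apply: cont_on_dot => //; exact: P2.
  rewrite -(int1Z gT g2 _ (C v vP)) -(int1D gT g2 _ (C w wP)); last first.
    by apply: cont_onM (C v vP); exact: cont_on_polyfun (PolyC a).
  congr int1; apply/funext => p.
  rewrite (dirderiv_field_comb _ _ _ vP wP) (dirderiv_field_comb _ _ _ (P1 _ vP) (P1 _ wP)).
  by rewrite dotDl dotZl.
- have gc : cont_on (simplex x g) q.
    by apply: restr_cont_on qP => f; exact: bubble_cont_on.
  have C u : polyfield u -> cont_on (simplex x g) (fun p => dot (u p) (nf g) * q p).
    move=> uP; apply: cont_onM gc; apply: cont_on_dot => // c.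
    exact: cont_on_polyfun (PolyC _).
  rewrite -(int2Z gT g3 _ (C v vP)) -(int2D gT g3 _ (C w wP)); last first.
    by apply: cont_onM (C v vP); exact: cont_on_polyfun (PolyC a).
  by congr int2; apply/funext => p; rewrite dotDl dotZl mulrDl mulrA.
- have gE : g = T by apply/eqP; rewrite eqEcard gT g4 tT.1.
  rewrite gE in qP *.
  have C u : polyfield u -> cont_on (simplex x T) (fun p => dot (u p) (q p)).
    move=> uP; apply: cont_on_dot => // c; apply: cont_on_polyfun.
    exact: bubble_polyfun (qP c).
  rewrite -(int3Z tT _ (C v vP)) -(int3D tT _ (C w wP)); last first.
    by apply: cont_onM (C v vP); exact: cont_on_polyfun (PolyC a).
  by congr int3; apply/funext => p; rewrite dotDl dotZl.
Qed.

End DofLinearity.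

(** * Vanishing of the edge jets *)

Section EdgeStep.
Context {R : realType} {n : nat}.
Variables (x : 'M[R]_(n, 3)) (T : {set 'I_n}) (k : nat).
Hypothesis tT : tetrahedron x T.
Notation R3 := 'rV[R]_3.
Notation mi := {ffun 'I_n -> 'I_k.+1}.
Variable c : mi -> R.

Lemma poly_le_hspan_bary (m : nat) (f : R3 -> R) :
  poly_le m%:Z f <-> hspan (fun i p => bary x T p 0 i) m f.
Proof.
rewrite (poly_le_bernstein tT) -(@hspan_multi_index R n T (fun i p => bary x T p 0 i)) //.
by move=> i iT; apply/funext => p; have [h _ _] := bary_barycentric tT p; exact: h.
Qed.

(* On the edge, the first jet of order d that does not vanish identically is
   (lambda_0 lambda_1)^(r+1-d) times a polynomial of degree k - 2(r+1) + d,
   which is admissible as a test function. *)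
Lemma edge_jet_eq0 (i0 i1 : 'I_n) (r d : nat) (u : R3) :
  i0 \in T -> i1 \in T -> i0 != i1 -> (d <= r)%N ->
  vertex x [set i0; i1]%SET 0 = row i0 x -> vertex x [set i0; i1]%SET 1 = row i1 x ->
  (forall i a, i \in [set i0; i1]%SET -> multi_index T a -> (dist a [set i]%SET <= r)%N -> c a = 0) ->
  (forall a, multi_index T a -> (dist a [set i0; i1]%SET < d)%N -> c a = 0) ->
  (forall W : R3 -> R, poly_le (k%:Z - 2 * (r.+1)%:Z + d%:Z) W ->
     int1 x [set i0; i1]%SET (fun p => dirderiv u d (bernstein_comb x T c) p *
       (W \_ (simplex x [set i0; i1]%SET)) p) = 0) ->
  forall t, 0 < t < 1 ->
  dirderiv u d (bernstein_comb x T c) (row i0 x + t *: (row i1 x - row i0 x)) = 0.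
Proof.
move=> i0T i1T i01 dr; set e := [set i0; i1]%SET => v0 v1 vert low H t t01.
have eT : e \subset T by rewrite finset.subUset !finset.sub1set i0T.
have e2 : #|e| = 2%N by rewrite cards2 i01.
have i10 : i1 == i0 = false by rewrite eq_sym (negPf i01).
set F := bernstein_comb x T c.
have sume (G : 'I_n -> nat) : (\sum_(i in e) G i = G i0 + G i1)%N.
  by rewrite /e finset.big_setU1 ?finset.big_set1 // !inE.
have prode (G : 'I_n -> R) : \prod_(i in e) G i = G i0 * G i1.
  by rewrite /e finset.big_setU1 ?finset.big_set1 // !inE.
have dist1 (a : mi) i j : [set i; j]%SET = e -> i != j -> dist a [set i]%SET = (a j + dist a e)%N.
  move=> ije ij; rewrite /dist (bigD1 j) /=; last by rewrite inE eq_sym.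
  by congr addn; apply: eq_bigl => l; rewrite -ije !inE negb_or.
(* The distance of a to the vertex [i1] is a i0 + d. If it is at most r the coefficient vanishes, so
   otherwise a i0 >= r + 1 - d; likewise at the other end. *)
have big (a : mi) : multi_index T a -> dist a e = d -> c a != 0 ->
    (r.+1 - d <= a i0)%N /\ (r.+1 - d <= a i1)%N.
  move=> aT ad ca; split; rewrite leqNgt; apply/negP => lt; move/eqP: ca; apply.
    apply: (vert i1) => //; first by rewrite !inE eqxx orbT.
    by rewrite (dist1 a i1 i0) 1?finset.setUC ?i10 //; move: ad lt dr; lia.
  apply: (vert i0) => //; first by rewrite !inE eqxx.
  by rewrite (dist1 a i0 i1) //; move: ad lt dr; lia.
have off p : simplex x e p -> forall i, i \notin e -> bary x T p 0 i = 0.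
  move=> [l h _] i ie; have [_ ->] := bary_sub eT tT.2 h.
  by case: h => ->.
have pos p : simplex x e p -> forall i, 0 <= bary x T p 0 i.
  by move=> [l h l0] i; have [_ ->] := bary_sub eT tT.2 h.
(* The jet with the power of lambda_0 lambda_1 taken out of the exponents. Truncation in the
   subtraction is harmless: indices with a smaller entry have coefficient 0. *)
pose W p := d`!%:R * \sum_(a : mi | multi_index T a && (dist a e == d))
  c a * (\prod_(i in e) bary x T p 0 i ^+ (a i - (r.+1 - d)) * \prod_(i | i \notin e) baryd x T u 0 i ^+ a i).
pose P p := \prod_(i in e) bary x T p 0 i.
have FW p : simplex x e p -> dirderiv u d F p = P p ^+ (r.+1 - d) * W p.
  move=> pe; rewrite (bernstein_comb_jet tT u (off p pe) low) mulrCA; congr (_ * _).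
  rewrite mulr_sumr; apply: eq_bigr => a /andP[aT /eqP ad].
  have [->|ca] := eqVneq (c a) 0; first by rewrite !mul0r mulr0.
  rewrite [RHS]mulrCA; congr (_ * _); rewrite mulrA; congr (_ * _).
  rewrite /P -prodrXl -big_split; apply: eq_bigr => i ie /=.
  rewrite -exprD subnKC //; have [h0 h1] := big a aT ad ca.
  by move: ie; rewrite !inE => /orP[]/eqP ->.
have degs (a : mi) : multi_index T a -> dist a e = d -> c a != 0 ->
    ((a i0 - (r.+1 - d)) + (a i1 - (r.+1 - d)) + 2 * r.+1 = k + d)%N.
  move=> aT ad ca; have [h0 h1] := big a aT ad ca.
  have := sum_in_multi_index e aT; rewrite sume ad; move: h0 h1 dr; lia.
have WP : poly_le (k%:Z - 2 * (r.+1)%:Z + d%:Z) W.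
  (* In negative degree no index at distance d keeps a nonzero coefficient, so W = 0, which is the
     only test function there. *)
  have [kd|kd] := leqP (2 * r.+1) (k + d); last first.
    have W0 : W = fun=> 0.
      apply/funext => p; rewrite /W big1 ?mulr0 // => a /andP[aT /eqP ad].
      have [->|ca] := eqVneq (c a) 0; first by rewrite mul0r.
      by have := degs a aT ad ca; move: kd; lia.
    rewrite W0; case: (_ + _) => m //; exact: lspan0.
  have -> : k%:Z - 2 * (r.+1)%:Z + d%:Z = (k + d - 2 * r.+1)%N%:Z by move: kd; lia.
  apply/poly_le_hspan_bary; apply: hspanZ; apply: hspan_sum => a /andP[aT /eqP ad].
  have [->|ca] := eqVneq (c a) 0.
    by rewrite (_ : (fun p => 0 * _) = fun=> 0); [exact: Hspan0|apply/funext => p; rewrite mul0r].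
  apply: hspanZ.
  rewrite (_ : (fun p => _ * \prod_(i | i \notin e) _) = fun p => (\prod_(i | i \notin e) baryd x T u 0 i ^+ a i) *
      \prod_i bary x T p 0 i ^+ (if i \in e then a i - (r.+1 - d) else 0)%N).
    apply: hspanZ.
    have -> : (k + d - 2 * r.+1 = \sum_i (if i \in e then a i - (r.+1 - d) else 0))%N.
      by rewrite -big_mkcond sume -(degs a aT ad ca) addnK.
    exact: hspan_prod.
  apply/funext => p; rewrite mulrC; congr (_ * _).
  rewrite big_mkcond; apply: eq_bigr => i _; by case: ifP.
have FP : polyfun (dirderiv u d F).
  by apply: dirderiv_polyfun; exact: bernstein_comb_polyfun.
(* Testing with W, whose sign is unknown, gives P^(r+1-d) W^2, which is nonnegative on the edge. *)
have h0 p : simplex x e p -> dirderiv u d F p * (W \_ (simplex x e)) p = P p ^+ (r.+1 - d) * W p ^+ 2.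
  by move=> pe; rewrite FW // patchE mem_set // -mulrA -expr2.
have Pge p : simplex x e p -> 0 <= P p by move=> pe; apply: prodr_ge0 => i _; exact: pos.
have hc : cont_on (simplex x e) (fun p => dirderiv u d F p * (W \_ (simplex x e)) p).
  apply: cont_onM; first exact: cont_on_polyfun.
  by apply: (restr_cont_on (S := poly_le (k%:Z - 2 * (r.+1)%:Z + d%:Z))); [move=> f; exact: poly_le_cont_on|exists W].
have hge p : simplex x e p -> 0 <= dirderiv u d F p * (W \_ (simplex x e)) p.
  by move=> pe; rewrite h0 //; apply: mulr_ge0; [apply: exprn_ge0; exact: Pge|exact: sqr_ge0].
have := int1_eq0 tT eT e2 hc hge (H W WP) t01; rewrite v0 v1 -edge_pt_mul.
set p := edge_pt i0 i1 t *m x.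
have pe : simplex x e p by apply: edge_pt_simplex => //; case/andP: t01 => ? ?; rewrite !ltW.
have [_ bp] := bary_sub eT tT.2 (edge_pt_barycentric x i0 i1 t).
(* Inside the edge lambda_0 and lambda_1 are positive, so W vanishes there and the jet with it. *)
rewrite h0 // => /eqP; rewrite mulf_eq0 (expf_eq0 (W p)) /= => /orP[|/eqP W0]; last by rewrite FW // W0 mulr0.
rewrite expf_eq0 => /andP[_]; rewrite gt_eqF // /P prode bp !edge_ptE // eqxx i10 eqxx.
by case/andP: t01 => t0 t1; rewrite mulr_gt0 // subr_gt0.
Qed.

End EdgeStep.

(** * Indices of cell bubbles and of face bubbles *)

Section BubbleIndices.
Context {n : nat}.
Variables (T : {set 'I_n}) (rv re rf : int) (k : nat).
Hypotheses (hrf : rf = -1) (hre : -1 <= re) (hrv : Num.max (2 * re) (-1) <= rv)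
  (hk : 2 * Num.max rv 0 + 1 <= k%:Z).
Notation mi := {ffun 'I_n -> 'I_k.+1}.

(** The hypotheses with the maxima resolved: re <= rv combines 2 re <= rv with rv >= -1 for re = -1,
    and k > 0 holds for rv = -1 as well. *)
Lemma degree_bounds : [/\ -1 <= rv, 2 * re <= rv, re <= rv, rv < k%:Z & 2 * rv + 1 <= k%:Z /\ (0 < k)%N].
Proof.
move: hre hrv hk; rewrite ge_max => h1 /andP[h2 h3].
have [r0|r0] := leP rv 0; move=> h4; do ?split; lia.
Qed.

(** Here rf = -1 enters: distances to faces, being natural numbers, all exceed it. *)
Lemma bubble_cellP (a : mi) :
  reflect [/\ multi_index T a, forall i, i \in T -> rv < (dist a [set i]%SET)%:Z &
      forall e : {set 'I_n}, e \subset T -> #|e| = 2%N -> re < (dist a e)%:Z]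
    (bubble_index [:: rv; re; rf] T a).
Proof.
apply: (iffP and3P) => [[aT ak /forallP h]|[/andP[aT ak] hv he]].
  split; first by rewrite /multi_index aT.
    move=> i iT; have /implyP := h [set i]%SET.
    by rewrite cards1 finset.sub1set iT; apply.
  move=> e eT e2; have /implyP := h e.
  by rewrite e2 eT; apply.
split=> //; apply/forallP => s; apply/implyP => /andP[sT].
case e : #|s| => [//|[|[|[|//]]]] _ /=; rewrite -/(dist a s).
- by have /eqP/cards1P[i si] := e; rewrite si in sT *; apply: hv; rewrite -finset.sub1set.
- exact: he.
- by rewrite hrf; clear; lia.
Qed.

Lemma bubble_faceP (f : {set 'I_n}) (a : mi) :
  reflect [/\ multi_index f a, forall i, i \in f -> rv < (dist a [set i]%SET)%:Z &
      forall e : {set 'I_n}, e \subset f -> #|e| = 2%N -> re < (dist a e)%:Z]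
    (bubble_index [:: rv; re] f a).
Proof.
apply: (iffP and3P) => [[aT ak /forallP h]|[/andP[aT ak] hv he]].
  split; first by rewrite /multi_index aT.
    move=> i iT; have /implyP := h [set i]%SET.
    by rewrite cards1 finset.sub1set iT; apply.
  move=> e eT e2; have /implyP := h e.
  by rewrite e2 eT; apply.
split=> //; apply/forallP => s; apply/implyP => /andP[sT].
case e : #|s| => [//|[|[|//]]] _ /=; rewrite -/(dist a s).
- by have /eqP/cards1P[i si] := e; rewrite si in sT *; apply: hv; rewrite -finset.sub1set.
- exact: he.
Qed.

Lemma dist_restrict (f s : {set 'I_n}) (a : mi) : multi_index f a ->
  dist a s = dist a (s :&: f).
Proof.
move=> /multi_indexP[af _]; rewrite /dist [LHS]big_mkcond [RHS]big_mkcond.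
apply: eq_bigr => i _; rewrite inE; case: (i \in s) => //=.
by case: ifPn => // /af.
Qed.

Lemma multi_indexS (f : {set 'I_n}) (a : mi) : f \subset T -> multi_index f a -> multi_index T a.
Proof.
move=> fT /multi_indexP[af ak]; apply/multi_indexP; split=> // i iT; apply: af.
by apply: contra iT; exact: (fintype.subsetP fT).
Qed.

(** For an index supported on f, the distance to s is the distance to the part of s in f. A vertex
    off f is thus at distance k > rv, and an edge that meets f in one vertex inherits a distance
    above rv >= re. *)
Lemma bubble_face_cell (f : {set 'I_n}) (a : mi) : f \subset T -> #|T| = 4%N -> #|f| = 3%N ->
  bubble_index [:: rv; re] f a =
  bubble_index [:: rv; re; rf] T a && [forall i, (i \notin f) ==> (a i == 0%N :> nat)].
Proof.
move=> fT T4 f3; have [rv1 re2 rev rvk [_ k0]] := degree_bounds.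
apply/bubble_faceP/andP => [[af hv he]|[/bubble_cellP[aT hv he] /forallP af]]; last first.
  have {}af : multi_index f a.
    apply/multi_indexP; split; last by case/multi_indexP: aT.
    by move=> i /(implyP (af i))/eqP.
  split=> // [i /(fintype.subsetP fT)/hv//|e ef]; apply: he; exact: fintype.subset_trans ef fT.
have a0 : dist a finset.set0 = k.
  by have := sum_in_multi_index finset.set0 af; rewrite big_set0 add0n.
split; last by case/andP: af.
apply/bubble_cellP; split=> [|i iT|e eT e2].
- exact: multi_indexS af.
- have [/hv//|ni] := boolP (i \in f); rewrite (dist_restrict _ af) (_ : _ :&: f = finset.set0) ?a0 //.
  by apply/setP => j; rewrite !inE; case: eqP => // ->; rewrite (negPf ni).
- rewrite (dist_restrict _ af); have : (#|e :&: f| <= 2)%N by rewrite -e2 subset_leq_card // subsetIl.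
  case c : #|e :&: f| => [|[|[|//]]] _.
  + by have /eqP := c; rewrite cards_eq0 => /eqP ->; rewrite a0; exact: le_lt_trans rvk.
  + have /eqP/cards1P[i ei] := c; rewrite ei; apply: le_lt_trans rev (hv i _).
    have : i \in e :&: f by rewrite ei inE.
    by rewrite inE => /andP[].
  + by apply: he c; exact: subsetIr.
Qed.

End BubbleIndices.

(** * Injectivity of the degrees of freedom *)

Section Unisolvence.
Context {R : realType} {n : nat}.
Variables (x : 'M[R]_(n, 3)) (T : {set 'I_n}).
Notation R3 := 'rV[R]_3.
Variables (n1 n2 nf : {set 'I_n} -> R3) (rv re rf : int) (k : nat).
Hypotheses (hrf : rf = -1) (hre : -1 <= re) (hrv : Num.max (2 * re) (-1) <= rv)
  (hk : 2 * Num.max rv 0 + 1 <= k%:Z).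
Hypotheses (tT : tetrahedron x T) (nT : normals_of x n1 n2 nf T).
Notation mi := {ffun 'I_n -> 'I_k.+1}.

Variable v : R3 -> R3.
Hypothesis dof0 : forall (g : {set 'I_n}) N, g \subset T ->
  dof x n1 n2 nf rv re rf k g N -> N v = 0.
Variable C : 'I_3 -> mi -> R.
Hypothesis vC : forall c, (fun p => v p 0 c) = bernstein_comb x T (C c).

Let vP : polyfield v.
Proof. by move=> c; rewrite vC; exact: bernstein_comb_polyfun. Qed.

Lemma vertex_dofs c i0 a : i0 \in T -> multi_index T a ->
  (dist a [set i0]%SET)%:Z <= rv -> C c a = 0.
Proof.
(* A distance is nonnegative, so rv = -1 is excluded and m + 1 = rv + 1 layers have to be killed. *)
move=> i0T aT adist; have [m rvm] : exists m : nat, rv = m%:Z.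
  by exists `|rv|%N; rewrite gez0_abs //; exact: le_trans adist.
apply: (vertex_coef_eq0 tT (N := m.+1) i0T) aT _; last by move: adist; rewrite rvm lez_nat ltnS.
move=> u d dN; apply: dirderiv_pderiv_eq0; first exact: bernstein_comb_polyfun.
move=> s sd; rewrite -vC.
have [_ /(_ c)/(congr1 (fun f => f (row i0 x))) <-] := pderiv_polyfield s vP.
apply: (dof0 (g := [set i0]%SET) (N := fun v => pderiv s v (row i0 x) 0 c)).
  by rewrite finset.sub1set.
by apply: DofH0 => //; rewrite sd rvm lez_nat -ltnS.
Qed.

Lemma edge_dofs c (e : {set 'I_n}) a : e \subset T -> #|e| = 2%N -> multi_index T a ->
  (dist a e)%:Z <= re -> C c a = 0.
Proof.
move=> eT e2 aT adist; have [m rem] : exists m : nat, re = m%:Z.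
  by exists `|re|%N; rewrite gez0_abs //; exact: le_trans adist.
have [rv1 re2 rev rvk _] := degree_bounds hrf hre hrv hk.
have [r rvr] : exists r : nat, rv = r%:Z.
  by exists `|rv|%N; rewrite gez0_abs //; apply: le_trans rev; rewrite rem.
have [i0 [i1 [eE i01 [i0T i1T] v0 v1]]] := edge_vertices x eT e2.
have [/(_ e)[]] := nT; first by rewrite /Delta eT e2.
move=> o1 o2 rf12 _.
rewrite eE in adist.
apply: (edge_coef_eq0 tT (N := m.+1) i0T i1T i01) aT _; last by move: adist; rewrite rem lez_nat ltnS.
move=> d dN low u ou t t01; rewrite eE in v0 v1.
apply: (edge_jet_eq0 (r := r) tT i0T i1T i01 _ v0 v1 _ low _ t01).
- by move: rev; rewrite rem rvr lez_nat; apply: leq_trans.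
- move=> i b ie bT bd; apply: (@vertex_dofs c i b _ bT); last by rewrite rvr lez_nat.
  by move: ie; rewrite !inE => /orP[]/eqP ->.
move=> W WP; rewrite -eE in v0 v1 ou *.
(* Every direction orthogonal to the edge is a combination of its two fixed normals, whose mixed
   derivatives (H1) controls. *)
have [s [s' uE]] : exists s t, u = s *: n1 e + t *: n2 e.
  have ie : i0 \in e by rewrite eE !inE eqxx.
  have ie' : i1 \in e by rewrite eE !inE eqxx orbT.
  apply: (orthogonal_comb (w := row i1 x - row i0 x)) => //.
  - exact: (rows_neq tT i0T i1T i01).
  - exact: o1.
  - exact: o2.
  - exact: ou.
have WPf : polyfun W.
  by move: WP; case: (_ + _) => m'; [exact: poly_le_polyfun|move=> ->; exact: PolyC].
have Wc : cont_on (simplex x e) (W \_ (simplex x e)) by exact: cont_on_restr.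
have LC g : polyfun g -> cont_on (simplex x e) (fun p => g p * (W \_ (simplex x e)) p).
  by move=> gP; apply: cont_onM Wc; exact: cont_on_polyfun.
rewrite uE; apply: (@dirderiv_mixed_eq0 _ _ _ _ _ _ (fun g => int1 x e (fun p => g p * (W \_ (simplex x e)) p))).
- exact: bernstein_comb_polyfun.
- move=> g h gP hP; rewrite -(int1D eT e2 (LC g gP) (LC h hP)).
  by congr int1; apply/funext => p; rewrite mulrDl.
- move=> b g gP; rewrite -(int1Z eT e2 b (LC g gP)).
  by congr int1; apply/funext => p; rewrite mulrA.
move=> i id.
(* The scalar test function is placed in component c, with 0 in the others. *)
pose Q p : R3 := (W \_ (simplex x e)) p *: delta_mx 0 c.
have QP : edge_test x rv k d e Q.
  move=> c'; have [->|cc] := eqVneq c' c.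
    exists W; first by rewrite (_ : rv + 1 = r.+1%:Z) // rvr; lia.
    by apply/funext => p; rewrite !mxE !eqxx mulr1.
  exists (fun=> 0).
    case: (_ + _) => // m'; exact: lspan0.
  apply/funext => p; rewrite !mxE (negPf cc) andbF mulr0 patchE; by case: ifP.
have dre : d%:Z <= re by rewrite rem lez_nat -ltnS.
have H := dof0 eT (@DofH1 _ _ x n1 n2 nf rv re rf k e i d Q e2 id dre QP).
rewrite -vC -[RHS]H.
congr int1; apply/funext => p.
have P1 := dirderiv_polyfield (n2 e) (d - i) vP.
have P2 := dirderiv_polyfield (n1 e) i P1.1.
rewrite /dot (bigD1 c) //= big1 ?addr0; last first.
  by move=> c' /negPf cc; rewrite !mxE cc andbF !mulr0.
rewrite !mxE !eqxx mulr1; congr (_ * _).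
by rewrite -P1.2 -P2.2.
Qed.

Lemma bubble_coef c p : v p 0 c =
  \sum_(a : mi | bubble_index [:: rv; re; rf] T a) C c a * bernstein x T a p.
Proof.
have -> : v p 0 c = bernstein_comb x T (C c) p by rewrite -vC.
rewrite /bernstein_comb (bigID (bubble_index [:: rv; re; rf] T (k := k))) /= [X in _ + X]big1 ?addr0.
  apply: eq_bigl => a; apply/andP/idP => [[]//|h]; split=> //.
  by have /(@bubble_cellP _ T rv re rf k hrf a)[] := h.
move=> a /andP[aT nb]; suff -> : C c a = 0 by rewrite mul0r.
apply: contraNeq nb => Ca; apply/(@bubble_cellP _ T rv re rf k hrf a); split=> // [i iT|e eT e2]; rewrite ltNge.
  by apply: contra Ca => h; rewrite (vertex_dofs c iT aT h).
by apply: contra Ca => h; rewrite (edge_dofs c eT e2 aT h).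
Qed.

Lemma normal_component_face (f : {set 'I_n}) p : f \subset T -> #|f| = 3%N -> simplex x f p ->
  dot (v p) (nf f) = \sum_(a : mi | bubble_index [:: rv; re] f a)
    (\sum_c C c a * nf f 0 c) * bernstein x f a p.
Proof.
move=> fT f3 pf; rewrite /dot; under eq_bigr do rewrite bubble_coef mulr_suml.
rewrite exchange_big /= (bigID (fun a : mi => [forall i, (i \notin f) ==> (a i == 0%N :> nat)])) /=.
rewrite [X in _ + X]big1 ?addr0.
  rewrite (eq_bigl (bubble_index [:: rv; re] f (k := k))); last first.
    by move=> a; rewrite (bubble_face_cell hrf hre hrv hk _ fT tT.1 f3).
  apply: eq_bigr => a _; rewrite mulr_suml; apply: eq_bigr => c _.
  by rewrite (bernstein_sub a fT tT.2 pf) mulrAC.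
move=> a /andP[_]; rewrite negb_forall => /existsP[i]; rewrite negb_imply => /andP[nif ai].
rewrite big1 // => c _.
by rewrite (bernstein_eq0 fT tT.2 pf nif ai) mulr0 mul0r.
Qed.

Lemma face_dofs (f : {set 'I_n}) p : f \subset T -> #|f| = 3%N -> simplex x f p ->
  dot (v p) (nf f) = 0.
Proof.
move=> fT f3 pf.
pose w p := \sum_(a : mi | bubble_index [:: rv; re] f a)
  (\sum_c C c a * nf f 0 c) * bernstein x f a p.
have wP : bubble x k f [:: rv; re] w by apply/lspan_pointwise; exists (fun a => \sum_c C c a * nf f 0 c).
have qP : face_test x rv re k f (w \_ (simplex x f)) by exists w.
have hE q : simplex x f q -> dot (v q) (nf f) * (w \_ (simplex x f)) q = w q ^+ 2.
  by move=> qf; rewrite normal_component_face // patchE mem_set.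
have hc : cont_on (simplex x f) (fun q => dot (v q) (nf f) * (w \_ (simplex x f)) q).
  apply: cont_onM; first by apply: cont_on_dot => // c; exact: cont_on_polyfun (PolyC _).
  by apply: restr_cont_on qP => h; exact: (bubble_cont_on tT).
have h0 q : simplex x f q -> 0 <= dot (v q) (nf f) * (w \_ (simplex x f)) q.
  by move=> qf; rewrite hE // sqr_ge0.
have I0 := dof0 fT (@DofH2 _ _ x n1 n2 nf rv re rf k f _ f3 qP).
have {}I0 := int2_eq0 tT fT f3 hc h0 I0.
have [i0 [i1 [i2 [fE [i01 i02 i12] [i0T i1T i2T] v0 [v1 v2]]]]] := face_vertices x fT f3.
rewrite normal_component_face // big1 // => a aP.
suff -> : \sum_c C c a * nf f 0 c = 0 by rewrite mul0r.
(* The integral only yields vanishing at interior points of f. This suffices for the coefficients,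
   and vanishing coefficients cover the boundary of f as well. *)
apply: (bernstein_free (g := f) (P := bubble_index [:: rv; re] f (k := k))
  (c := fun a => \sum_c C c a * nf f 0 c)) aP.
- by apply/set0Pn; exists i0; rewrite fE !inE eqxx.
- by move=> b /bubble_faceP[].
move=> l l0 lf l1.
pose t := (l 0 i1, l 0 i2).
have fi0 : i0 \in f by rewrite fE !inE eqxx.
have fi1 : i1 \in f by rewrite fE !inE eqxx orbT.
have fi2 : i2 \in f by rewrite fE !inE eqxx !orbT.
have l012 : l 0 i0 + l 0 i1 + l 0 i2 = 1.
  rewrite -l1 (bigD1 i0) //= (bigD1 i1) 1?eq_sym //= (bigD1 i2) /=; last first.
    by rewrite !(eq_sym i2) i02 i12.
  rewrite big1 ?addr0 ?addrA // => i /andP[/andP[h0' h1'] h2'].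
  by rewrite lf // fE !inE !negb_or h0' h1' h2'.
have lE : l = face_pt i0 i1 i2 t.
  apply/rowP => i; rewrite face_ptE //=.
  case: eqVneq => [->|ni0]; first by rewrite -l012; ring.
  case: eqVneq => [->//|ni1]; case: eqVneq => [->//|ni2].
  by rewrite lf // fE !inE !negb_or ni0 ni1.
have := I0 t (l0 _ fi1) (l0 _ fi2) _; rewrite v0 v1 v2 -face_pt_mul -lE => /(_ _) H.
have lx : barycentric x f (l *m x) l by [].
have lS : simplex x f (l *m x).
  exists l => // i; have [/l0/ltW//|/lf ->] := boolP (i \in f); by rewrite lexx.
move: H; rewrite hE // => H.
have /eqP : w (l *m x) ^+ 2 = 0.
  by apply: H; rewrite /t /= -l012; have := l0 _ fi0; lra.
rewrite sqrf_eq0 => /eqP w0; rewrite -[RHS]w0; apply: eq_bigr => b _.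
by rewrite /bernstein; have [-> _] := bary_sub fT tT.2 lx.
Qed.

Lemma cell_dofs : v = 0.
Proof.
have qP : cell_test x nf rv re rf k T v.
  split; first by move=> c; apply/lspan_pointwise; exists (C c) => p; exact: bubble_coef.
  by move=> f /andP[fT /eqP f3] p pf; exact: face_dofs.
have I0 : int3 (simplex x T) (fun p => dot (v p) (v p)) = 0.
  exact: (dof0 (fintype.subxx T) (@DofH3 _ _ x n1 n2 nf rv re rf k T _ tT.1 qP)).
have dP : polyfun (fun p => dot (v p) (v p)).
  by apply: polyfun_sum => c _; exact: PolyM.
have T0 : T != finset.set0 by rewrite -card_gt0 tT.1.
(* From v = 0 at the interior points of T to v = 0 on all of R^3, by way of the coefficients. *)
have z c a : multi_index T a -> C c a = 0.
  apply: (bernstein_free (g := T) (P := multi_index T (k := k))) => // l l0 lT l1.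
  have lx : barycentric x T (l *m x) l by [].
  have bl := bary_unique tT.2 lx.
  have /eqP : dot (v (l *m x)) (v (l *m x)) = 0.
    apply: (simplex_integral_eq0 tT (polyfun_continuous dP)) => //.
      by move=> q _; apply: sumr_ge0 => i _; rewrite -expr2 sqr_ge0.
    by move=> i iT; rewrite bl l0.
  rewrite dot_eq0 => /eqP/rowP/(_ c); rewrite mxE => v0; rewrite -[RHS]v0.
  have -> : v (l *m x) 0 c = bernstein_comb x T (C c) (l *m x) by rewrite -vC.
  by apply: eq_bigr => b _; rewrite /bernstein bl.
apply/funext => p; apply/rowP => c; rewrite bubble_coef big1 ?mxE // => a /(@bubble_cellP _ T rv re rf k hrf a)[aT _ _].
by rewrite z ?mul0r.
Qed.

End Unisolvence.

(** * Linear structure of H(div) *)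

Section DivergenceSpace.
Context {R : realType}.
Notation R3 := 'rV[R]_3.
Notation X3 := (measurableTypeR R * measurableTypeR R * measurableTypeR R)%type.
Implicit Types (D : set R3) (f h psi : R3 -> R).

Lemma L2_comb D (a : R) f h : L2 D f -> L2 D h -> L2 D (fun p => a * f p + h p).
Proof.
have one2 : (1 <= 2%:E :> \bar R)%E by rewrite lee_fin; lra.
rewrite /L2 => fL hL.
rewrite (_ : _ \_ _ = a *: ((f \o @toR3 R) \_ (@toR3 R @^-1` D)) + (h \o @toR3 R) \_ (@toR3 R @^-1` D)).
  exact: (@Lfun_submod_closed _ _ _ (@leb3 R) 2%:E one2).2 a _ _ fL hL.
apply/funext => u.
rewrite [RHS](_ : _ = a * ((f \o @toR3 R) \_ (@toR3 R @^-1` D)) u + ((h \o @toR3 R) \_ (@toR3 R @^-1` D)) u) //.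
by rewrite !patchE; case: ifP => //= _; rewrite mulr0 addr0.
Qed.

Lemma open_toR3_measurable D : open D -> measurable (@toR3 R @^-1` D : set X3).
Proof.
move=> oD; apply: (nb_open_measurable leb3_base) => u Du.
have := @toR3_continuous R u D (open_nbhs_nbhs (conj oD Du)).
by case: u Du => -[].
Qed.

Definition bounded_support psi : Prop :=
  exists M : R, forall p, psi p != 0 -> forall c, `|p 0 c| <= M.

(** Domination by f^2 + psi^2, where psi^2 is integrable because psi is continuous and vanishes off
    a box of finite measure. *)
Lemma L2_mul_integrable D f psi : open D -> L2 D f -> continuous psi ->
  bounded_support psi ->
  (@leb3 R).-integrable (@toR3 R @^-1` D) (EFin \o ((fun p => f p * psi p) \o @toR3 R)).
Proof.
move=> oD fL pc [M pM].
have mD := open_toR3_measurable oD.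
pose F := (f \o @toR3 R) \_ (@toR3 R @^-1` D).
pose A : set X3 := `[- M, M]%classic `*` `[- M, M]%classic `*` `[- M, M]%classic.
have mA : measurable A by exact: box3_measurable.
pose P := psi \o @toR3 R.
have Pc : continuous (P : R * R * R -> R).
  by move=> u; apply: continuous_comp; [exact: toR3_continuous|exact: pc].
have mP : measurable_fun setT P.
  exact: (nb_continuous_measurable leb3_base (nb3_continuous Pc)).
have mF : measurable_fun setT F.
  by move: fL; rewrite /L2 inE => /andP[]; rewrite inE.
have iF : (@leb3 R).-integrable setT (EFin \o (fun u => F u ^+ 2)).
  exact: Lfun2_integrable_sqr.
have iP : (@leb3 R).-integrable setT ((EFin \o (fun u => P u ^+ 2)) \_ A).
  suff : (@leb3 R).-integrable A (EFin \o (fun u => P u ^+ 2)) by move=> /(integrable_mkcond _ mA).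
  have P2c : continuous (fun u : R * R * R => P u ^+ 2).
    by move=> u; under eq_fun do rewrite expr2; exact: (cvgM (Pc u) (Pc u)).
  have [N PN] := continuous_bounded_compact (@box3_compact R (- M) M) P2c.
  apply: (nb_bounded_integrable leb3_base (M := N)) => //; last exact: box3_measure.
have iFP : (@leb3 R).-integrable setT (EFin \o (fun u => F u * P u)).
  apply: (le_integrable measurableT _ _ (integrableD measurableT iF iP)) => //.
    by apply/measurable_realfun.measurable_EFinP; exact: measurable_realfun.measurable_funM.
  move=> u _; rewrite /= patchE; case: ifPn => uA.
    rewrite -EFinD lee_fin (ger0_norm (addr_ge0 (sqr_ge0 _) (sqr_ge0 _))) normrM.
    have := sqr_ge0 (`|F u| - `|P u|); rewrite sqrrB !real_normK ?num_real // mulr2n.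
    have := sqr_ge0 (`|F u| + `|P u|); rewrite sqrrD !real_normK ?num_real // mulr2n.
    lra.
  have -> : P u = 0.
    apply/eqP; apply: contraNT uA => Pu; rewrite inE; apply: toR3_box; exact: pM.
  by rewrite mulr0 normr0 lee_fin.
apply: (@eq_integrable _ _ _ _ _ mD (EFin \o (fun u => F u * P u))).
  by move=> u uD; rewrite /= /F patchE uD.
exact: integrableS iFP.
Qed.

Lemma test_function_bounded_support D phi : test_function D phi -> bounded_support phi.
Proof.
move=> [_ [K [cK _ K0]]].
have [M [_ KM]] := compact_bounded cK.
exists (M + 1) => p pp c.
have Kp : K p by apply: contrapT => /K0 e; move: pp; rewrite e eqxx.
have := KM (M + 1); rewrite ltrDl ltr01 => /(_ isT p Kp); apply: le_trans.
rewrite [leRHS]/Num.Def.normr /= mx_normrE.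
exact: (le_bigmax _ _ (0, c)).
Qed.

Lemma test_function_continuous D phi : test_function D phi -> continuous phi.
Proof. by move=> [/(_ [::])[]]. Qed.

Lemma test_derivative_continuous D phi c : test_function D phi -> continuous (pderiv [:: c] phi).
Proof. by move=> [/(_ [:: c])[]]. Qed.

(** K is closed, so phi vanishes near every point off K, and its derivative vanishes at that
    point. *)
Lemma test_derivative_bounded_support D phi c : test_function D phi ->
  bounded_support (pderiv [:: c] phi).
Proof.
move=> [_ [K [cK _ K0]]].
have [M [_ KM]] := compact_bounded cK.
have clK : closed K by apply: compact_closed cK; exact: norm_hausdorff.
exists (M + 1) => p pp d.
have Kp : K p.
  apply: contrapT => nKp; move: pp; rewrite /= (_ : 'D__ phi p = 0) ?eqxx //.
  rewrite -[RHS](derive_cst (V := R3) (0 : R) p (delta_mx 0 c)).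
  apply: near_eq_derive; have : nbhs p (~` K).
    by apply: open_nbhs_nbhs; split=> //; exact: closed_openC.
  by apply: filterS => q /K0.
have := KM (M + 1); rewrite ltrDl ltr01 => /(_ isT p Kp); apply: le_trans.
rewrite [leRHS]/Num.Def.normr /= mx_normrE.
exact: (le_bigmax _ _ (0, d)).
Qed.

(** The integrals may be split because each product of an L^2 function with a test function or its
    derivative is integrable. *)
Lemma weak_div_comb D (a : R) (v w : R3 -> R3) (g h : R3 -> R) : open D ->
  (forall c, L2 D (fun p => v p 0 c)) -> (forall c, L2 D (fun p => w p 0 c)) ->
  L2 D g -> L2 D h -> weak_div D v g -> weak_div D w h ->
  weak_div D (a *: v + w) (fun p => a * g p + h p).
Proof.
move=> oD vL wL gL hL vg wh phi phiT.
have mD := open_toR3_measurable oD.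
have I3 (u : R3 -> R3) : (forall c, L2 D (fun p => u p 0 c)) ->
    (@leb3 R).-integrable (@toR3 R @^-1` D)
      (EFin \o ((fun p => \sum_c u p 0 c * pderiv [:: c] phi p) \o @toR3 R)).
  move=> uL.
  pose G (c : 'I_3) (q : R * R * R) : \bar R := (u (toR3 q) 0 c * pderiv [:: c] phi (toR3 q))%:E.
  rewrite (_ : _ \o _ = fun q => (\sum_c G c q)%E).
    apply: integrable_sum => // c _.
    exact: (L2_mul_integrable oD (uL c) (@test_derivative_continuous D phi c phiT)
      (@test_derivative_bounded_support D phi c phiT)).
  by apply/funext => q; rewrite /= sumEFin.
have I1 f : L2 D f -> (@leb3 R).-integrable (@toR3 R @^-1` D)
    (EFin \o ((fun p => f p * phi p) \o @toR3 R)).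
  move=> fL; apply: L2_mul_integrable => //; first exact: test_function_continuous phiT.
  exact: test_function_bounded_support phiT.
have lin (F G : R3 -> R) : (@leb3 R).-integrable (@toR3 R @^-1` D) (EFin \o (F \o @toR3 R)) ->
    (@leb3 R).-integrable (@toR3 R @^-1` D) (EFin \o (G \o @toR3 R)) ->
    int3 D (fun p => a * F p + G p) = a * int3 D F + int3 D G.
  move=> iF iG.
  have -> : int3 D (fun p => a * F p + G p) = int3 D (fun p => a * F p) + int3 D G.
    have H := integrableZl mD a iF.
    by apply: RintegralD => //; move: H; apply: eq_integrable.
  by congr (_ + _); apply: RintegralZl.
transitivity (int3 D (fun p => a * (\sum_c v p 0 c * pderiv [:: c] phi p) +
    (\sum_c w p 0 c * pderiv [:: c] phi p))).
  congr int3; apply/funext => p; rewrite mulr_sumr -big_split; apply: eq_bigr => c _.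
  by rewrite !mxE mulrDl mulrA.
rewrite lin; [|exact: I3|exact: I3]; rewrite vg // wh //.
transitivity (- (int3 D (fun p => a * (g p * phi p) + h p * phi p))).
  by rewrite lin; [rewrite mulrN opprD|exact: I1|exact: I1].
by congr (- int3 _ _); apply/funext => p; rewrite mulrDl mulrA.
Qed.

Lemma Hdiv_comb D (a : R) (v w : R3 -> R3) : open D -> Hdiv D v -> Hdiv D w -> Hdiv D (a *: v + w).
Proof.
move=> oD [vL [g gL vg]] [wL [h hL wh]]; split.
  by move=> c; rewrite field_comp_comb; exact: L2_comb.
by exists (fun p => a * g p + h p); [exact: L2_comb|exact: weak_div_comb].
Qed.

Lemma int3_0 D : int3 D (fun=> 0) = 0 :> R.
Proof. by rewrite /int3 /Rintegral integral0. Qed.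

Lemma Hdiv0 D : Hdiv D (0 : R3 -> R3).
Proof.
have one2 : (1 <= 2%:E :> \bar R)%E by rewrite lee_fin; lra.
have L0 : L2 D (fun=> 0).
  rewrite /L2 (_ : _ \_ _ = 0); first exact: (@Lfun_submod_closed _ _ _ (@leb3 R) 2%:E one2).1.
  by apply/funext => u; rewrite patchE; case: ifP.
split=> [c|]; first by under eq_fun do rewrite mxE.
exists (fun=> 0) => // phi _.
rewrite (_ : (fun p => \sum_c _) = fun=> 0); last first.
  by apply/funext => p; rewrite big1 // => c _; rewrite mxE mul0r.
by under [in RHS]eq_fun do rewrite mul0r; rewrite int3_0 oppr0.
Qed.

End DivergenceSpace.

(** * Dimensions of the test spaces *)

Section TestSpaceDimensions.
Context {R : realType} {n : nat}.
Variables (x : 'M[R]_(n, 3)) (T : {set 'I_n}).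
Notation R3 := 'rV[R]_3.
Hypothesis tT : tetrahedron x T.

Lemma restr_lspan (K : set R3) (J : finType) (P : pred J) (b : J -> R3 -> R^o) :
  restr K (lspan P b) = lspan P (fun j => (b j \_ K : R3 -> R^o)).
Proof.
have E c p : (\sum_(j | P j) c j *: (b j \_ K : R3 -> R^o)) p =
    ((\sum_(j | P j) c j *: b j) \_ K : R3 -> R) p.
  rewrite patchE; case: ifP => pK; rewrite !fct_sumE.
    by apply: eq_bigr => j _; rewrite /= -[LHS]/(c j * (b j \_ K) p) patchE pK.
  by rewrite big1 // => j _; rewrite -[LHS]/(c j * (b j \_ K) p) patchE pK mulr0.
apply/seteqP; split=> h.
  by move=> [_ [c ->] <-]; exists c; apply/funext => p; rewrite E.
move=> [c ->]; exists (\sum_(j | P j) c j *: b j); first by exists c.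
by apply/funext => p; rewrite E.
Qed.

Lemma free_restr_bernstein (g : {set 'I_n}) m (P : pred {ffun 'I_n -> 'I_m.+1}) :
  g \subset T -> g != finset.set0 -> (forall a, P a -> multi_index g a) ->
  free_on P (fun a => (bernstein x T a \_ (simplex x g) : R3 -> R^o)).
Proof.
move=> gT g0 Pg; apply: free_pointwise => c h.
apply: (free_bernstein gT tT.2 g0 Pg) => p pg; rewrite -[RHS](h p).
by apply: eq_bigr => a _; rewrite patchE mem_set.
Qed.

Lemma dimension_poly_le (m : nat) : dimension (vec (@poly_le R m%:Z)) =
  (#|multi_index T (k := m)| * 3)%N.
Proof.
rewrite (_ : poly_le m%:Z = lspan (multi_index T (k := m)) (bernstein x T (k := m) : _ -> R3 -> R^o)).
  apply: dimension_vec; apply: free_pointwise => c h.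
  have T0 : T != finset.set0 by rewrite -card_gt0 tT.1.
  by apply: (free_bernstein (fintype.subxx T) tT.2 T0).
by apply/seteqP; split=> f /(poly_le_bernstein tT).
Qed.

(** On g the Bernstein polynomials of T whose index is not supported on g vanish, while the others
    stay independent. *)
Lemma dimension_restr_poly_le (g : {set 'I_n}) (m : nat) : g \subset T -> g != finset.set0 ->
  dimension (vec (restr (simplex x g) (poly_le m%:Z))) = (#|multi_index g (k := m)| * 3)%N.
Proof.
move=> gT g0.
rewrite (_ : restr _ _ = lspan (multi_index g (k := m)) (fun a => (bernstein x T a \_ (simplex x g) : R3 -> R^o))).
  by apply: dimension_vec; exact: free_restr_bernstein.
rewrite -restr_lspan; apply/seteqP; split=> _ [f + <-].
  move=> /(poly_le_bernstein tT)/lspan_pointwise[c fc].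
  exists (fun p => \sum_(a | multi_index g a) c a * bernstein x T a p).
    by apply/lspan_pointwise; exists c.
  apply/funext => p; rewrite !patchE; case: ifPn => //; rewrite inE => pg.
  rewrite fc [RHS](bigID (multi_index g (k := m))) /= [X in _ + X]big1 ?addr0.
    apply: eq_bigl => a; apply/idP/andP => [ag|[]//]; split=> //.
    exact: multi_indexS ag.
  move=> a /andP[aT]; rewrite /multi_index negb_and => /orP[|ak].
    rewrite negb_forall => /existsP[i]; rewrite negb_imply => /andP[ig ai].
    by rewrite (bernstein_eq0 gT tT.2 pg ig ai) mulr0.
  by case/andP: aT => _; rewrite (negPf ak).
move=> /lspan_pointwise[c fc]; exists f => //.
apply/(poly_le_bernstein tT)/lspan_pointwise.
exists (fun a => if multi_index g a then c a else 0) => p.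
rewrite fc [RHS](bigID (multi_index g (k := m))) /= [X in _ = _ + X]big1 ?addr0; last first.
  by move=> a /andP[_ /negPf ->]; rewrite mul0r.
rewrite [RHS](eq_bigl (multi_index g (k := m))).
  by apply: eq_bigr => a ->.
move=> a; apply/andP/idP => [[]//|ag]; split=> //; exact: multi_indexS ag.
Qed.

Lemma dimension_restr_poly_le_neg (g : {set 'I_n}) (m : nat) :
  dimension (vec (restr (simplex x g) (@poly_le R (Negz m)))) = 0%N.
Proof.
rewrite (_ : restr _ _ = lspan (@pred0 'I_1) (fun=> (0 : R3 -> R^o))).
  by rewrite dimension_vec ?card0.
apply/seteqP; split=> h.
  by move=> [_ -> <-]; exists (fun=> 0); rewrite big_pred0 //; apply/funext => p; rewrite patchE; case: ifP.
move=> [c]; rewrite big_pred0 // => ->; exists 0 => //.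
by apply/funext => p; rewrite patchE; case: ifP.
Qed.

Section Normals.
Variables (n1 n2 nf : {set 'I_n} -> R3) (rv re rf : int) (k : nat).
Hypotheses (hrf : rf = -1) (hre : -1 <= re) (hrv : Num.max (2 * re) (-1) <= rv)
  (hk : 2 * Num.max rv 0 + 1 <= k%:Z).
Hypothesis nT : normals_of x n1 n2 nf T.
Notation mi := {ffun 'I_n -> 'I_k.+1}.

Lemma dimension_face_test (f : {set 'I_n}) : Delta 2 T f ->
  dimension (V := R3 -> R^o) (face_test x rv re k f) = #|bubble_index [:: rv; re] f (k := k)|.
Proof.
move=> /andP[fT /eqP f3].
have f0 : f != finset.set0 by rewrite -card_gt0 f3.
rewrite /face_test /bubble (@restr_lspan (simplex x f) _ _ (bernstein x f (k := k))).
rewrite (_ : (fun j => _) = fun a => (bernstein x T a \_ (simplex x f) : R3 -> R^o)).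
  by apply: dimension_lspan; apply: free_restr_bernstein => // a /bubble_faceP[].
apply/funext => a; apply/funext => p; rewrite !patchE; case: ifPn => //; rewrite inE => pf.
by rewrite (bernstein_sub a fT tT.2 pf).
Qed.

(** The edges from [i0] span R^3, so a vector orthogonal to all of them is orthogonal to itself. *)
Lemma edges_span (u : R3) (i0 : 'I_n) : i0 \in T ->
  (forall i, i \in T -> dot (row i x - row i0 x) u = 0) -> u = 0.
Proof.
move=> i0T h; apply/eqP; rewrite -dot_eq0; apply/eqP.
have E : u = \sum_i baryd x T u 0 i *: (row i x - row i0 x).
  under eq_bigr do rewrite scalerBr.
  by rewrite sumrB -scaler_suml baryd_sum // scale0r subr0 -mulmx_sum_row baryd_mul.
have S (J : finType) (F : J -> R3) : dot (\sum_j F j) u = \sum_j dot (F j) u.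
  rewrite (big_morph (fun z => dot z u) (id1 := 0) (op1 := +%R)) //.
    by move=> z w; exact: dotDl.
  by rewrite -(scale0r 0) dotZl mul0r.
rewrite {1}E S big1 // => i _; rewrite dotZl.
by have [/h ->|iT] := boolP (i \in T); rewrite ?mulr0 // baryd_notin // mul0r.
Qed.

(** Otherwise the normal of the face opposite to i would be orthogonal to all the edges from
    [i0]. *)
Lemma normal_transversal (i i0 : 'I_n) : i \in T -> i0 \in T -> i != i0 ->
  dot (row i x - row i0 x) (nf (T :\ i)) != 0.
Proof.
move=> iT i0T ii0; have fD : Delta 2 T (T :\ i).
  by rewrite /Delta subD1set; have := cardsD1 i T; rewrite tT.1 iT add1n => /eqP; rewrite eqSS eq_sym.
have [_ /(_ _ fD)[onf n0]] := nT; apply: contra_neq n0 => h0.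
apply: (edges_span i0T) => j jT; have [->//|ji] := eqVneq j i.
by apply: onf; rewrite !inE ?ji ?jT // eq_sym ii0 i0T.
Qed.

Lemma faceP (f : {set 'I_n}) : Delta 2 T f -> exists2 i, i \in T & f = T :\ i.
Proof.
move=> /andP[fT /eqP f3]; have : #|T :\: f| == 1%N by rewrite cardsD (finset.setIidPr fT) tT.1 f3.
move=> /cards1P[i ei]; have : i \in T :\: f by rewrite ei inE.
rewrite inE => /andP[nif iT]; exists i => //.
by rewrite -ei finset.setDDr finset.setDv finset.set0U (finset.setIidPr fT).
Qed.

(** The condition v.n = 0 on f splits into one linear condition for each face bubble index,
    involving only the vector coefficient of that index. The faces that carry a given index b all
    contain a vertex [i0 b] with b (i0 b) > 0; the edges from this vertex are, up to scaling, dual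
    to the normals of these faces, which solves the conditions explicitly for any data. *)
Lemma dimension_cell_test :
  (dimension (cell_test x nf rv re rf k T) + \sum_(f | Delta 2 T f) #|bubble_index [:: rv; re] f (k := k)| =
   #|bubble_index [:: rv; re; rf] T (k := k)| * 3)%N.
Proof.
pose S : pred mi := bubble_index [:: rv; re; rf] T (k := k).
have ST a : S a -> multi_index T a by move=> /(@bubble_cellP _ T rv re rf k hrf a)[].
have T0 : T != finset.set0 by rewrite -card_gt0 tT.1.
have fS : free_on S (bernstein x T (k := k) : mi -> R3 -> R^o).
  by apply: free_pointwise => c h; apply: (free_bernstein (fintype.subxx T) tT.2 T0 ST).
pose Q : pred ({set 'I_n} * mi) := fun fb => Delta 2 T fb.1 && bubble_index [:: rv; re] fb.1 fb.2.
have QS f a : Q (f, a) -> S a /\ forall i, i \notin f -> a i = 0%N :> nat.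
  move=> /andP[/= /andP[fT /eqP f3]].
  rewrite (bubble_face_cell hrf hre hrv hk a fT tT.1 f3) => /andP[Sa /forallP h]; split=> // i nif.
  by have /implyP/(_ nif)/eqP := h i.
pose l (ac : mi * 'I_3) (fb : {set 'I_n} * mi) : R := (ac.1 == fb.2)%:R * nf fb.1 0 ac.2.
have lE (c : mi * 'I_3 -> R) f b : S b ->
    \sum_(ac | S ac.1) c ac * l ac (f, b) = \sum_d c (b, d) * nf f 0 d.
  move=> Sb; have -> : \sum_(ac | S ac.1) c ac * l ac (f, b) =
      \sum_(a | S a) \sum_d c (a, d) * l (a, d) (f, b).
    by rewrite pair_big; apply: eq_big => [ac|[j d] _] //; rewrite andbT.
  rewrite (bigD1 b) //= [X in _ + X]big1 ?addr0.
    by apply: eq_bigr => d _; rewrite /l /= eqxx mul1r.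
  by move=> a /andP[_ /negPf ab]; rewrite big1 // => d _; rewrite /l /= ab mul0r mulr0.
have surj (d : {set 'I_n} * mi -> R) : exists c : mi * 'I_3 -> R,
    forall fb, Q fb -> \sum_(ac | S ac.1) c ac * l ac fb = d fb.
  have k0 : (0 < k)%N by have [_ _ _ _ []] := degree_bounds hrf hre hrv hk.
  (* A vertex at which the index is positive exists because the entries add up to k > 0. *)
  have /choice[i0 i0P] : forall b : mi, exists i, S b -> (i \in T) && (0 < b i)%N.
    move=> b; have [Sb|nS] := boolP (S b); last first.
      by have /set0Pn[i _] := T0; exists i.
    have /multi_indexP[bT bk] := ST b Sb.
    have : [exists i, (i \in T) && (0 < b i)%N].
      apply: contraLR k0; rewrite negb_exists -leqNgt leqn0 => /forallP h.
      have <- : (\sum_i b i)%N = k by [].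
      rewrite sum_nat_eq0; apply/forallP => i; apply/implyP => _; have := h i.
      by have [iT|/bT ->//] := boolP (i \in T); rewrite andTb -leqNgt leqn0.
    by move=> /existsP[i hi]; exists i.
  pose w b i := row i x - row (i0 b) x : R3.
  pose z b : R3 := \sum_(i in T :\ i0 b) (d (T :\ i, b) / dot (w b i) (nf (T :\ i))) *: w b i.
  exists (fun bc => z bc.1 0 bc.2) => -[f b] Qfb; have [Sb bf] := QS f b Qfb.
  rewrite lE //= -/(dot (z b) (nf f)).
  have /andP[/= fD _] := Qfb; have [i iT fE] := faceP fD.
  have /andP[i0T bi0] := i0P b Sb.
  have ii0 : i != i0 b.
    by apply: contraTneq bi0 => <-; rewrite bf // fE !inE eqxx.
  have DS (P : pred 'I_n) (F : 'I_n -> R3) (u : R3) : dot (\sum_(j | P j) F j) u = \sum_(j | P j) dot (F j) u.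
    rewrite (big_morph (fun z => dot z u) (id1 := 0) (op1 := +%R)) //.
      by move=> z' w'; exact: dotDl.
    by rewrite -(scale0r 0) dotZl mul0r.
  (* Of the edges from [i0 b], only the one to the vertex i opposite to f is not contained in f. *)
  rewrite /z DS (bigD1 i) /=; last by rewrite !inE ii0.
  rewrite dotZl fE divfK; last exact: normal_transversal.
  rewrite big1 ?addr0 // => j /andP[]; rewrite !inE => /andP[ji0 jT] ji.
  have [_ /(_ f fD)[onf _]] := nT.
  by rewrite dotZl /w -fE onf ?mulr0 // fE !inE ?ji ?jT // eq_sym ii0 i0T.
have := dimension_constrained (free_field_basis fS) surj.
rewrite (card_field_basis S) => <-; congr addn; last first.
  rewrite -sum1_card; under eq_bigr do rewrite -sum1_card.
  by rewrite pair_big_dep.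
congr dimension; apply/seteqP; split=> v; last first.
  move=> [c -> hc]; split.
    by apply/(vec_lspan S (bernstein x T (k := k) : mi -> R3 -> R^o)); exists c.
  move=> f fD p pf; have /andP[fT /eqP f3] := fD.
  rewrite /dot; under eq_bigr do rewrite (field_basisE S) mulr_suml.
  rewrite exchange_big /= big1 // => a Sa.
  have [/existsP[i /andP[nif ai]]|] := boolP [exists i, (i \notin f) && (a i != 0%N :> nat)].
    by rewrite big1 // => d _; rewrite (bernstein_eq0 fT tT.2 pf nif ai) mulr0 mul0r.
  rewrite negb_exists => /forallP h.
  have Qfa : Q (f, a).
    rewrite /Q fD (bubble_face_cell hrf hre hrv hk a fT tT.1 f3) -/(S a) Sa /=.
    by apply/forallP => i; have := h i; rewrite negb_and !negbK implyNb.
  have := hc (f, a) Qfa; rewrite lE // => e0.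
  under eq_bigr do rewrite mulrAC.
  by rewrite -mulr_suml e0 mul0r.
move=> [/(vec_lspan S (bernstein x T (k := k) : mi -> R3 -> R^o))[c vc] vn]; exists c => // -[f b] Qfb.
have [Sb bf] := QS f b Qfb; rewrite lE //.
have /andP[/= fD bb] := Qfb; have /andP[fT /eqP f3] := fD.
have f0 : f != finset.set0 by rewrite -card_gt0 f3.
(* Restricted to f, the normal component is a combination of face bubbles; their independence on f
   turns its vanishing into the separate conditions. *)
apply: (@free_bernstein _ _ x f T k (bubble_index [:: rv; re] f (k := k)) fT tT.2 f0 _
  (fun a => \sum_d c (a, d) * nf f 0 d) _ b bb).
  by move=> a /bubble_faceP[].
move=> p pf; rewrite -[RHS](vn f fD p pf) vc /dot.
under [RHS]eq_bigr do rewrite (field_basisE S) mulr_suml.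
rewrite exchange_big /= [RHS](bigID (fun a : mi => [forall i, (i \notin f) ==> (a i == 0%N :> nat)])) /=.
rewrite [X in _ = _ + X]big1 ?addr0; last first.
  move=> a /andP[_]; rewrite negb_forall => /existsP[i]; rewrite negb_imply => /andP[nif ai].
  by rewrite big1 // => d _; rewrite (bernstein_eq0 fT tT.2 pf nif ai) mulr0 mul0r.
apply: eq_big => a; first by rewrite (bubble_face_cell hrf hre hrv hk a fT tT.1 f3).
by move=> _; rewrite mulr_suml; apply: eq_bigr => d _; rewrite mulrAC.
Qed.

End Normals.
End TestSpaceDimensions.

(** * Partition and counting of the multi-indices *)

Section Counting.
Context {n : nat}.
Implicit Types (g e T : {set 'I_n}).

(** Stars and bars, transported from tuples along the enumeration of g. *)
Lemma card_multi_index g k m : #|g| = m.+1 -> #|multi_index g (k := k)| = 'C(m + k, m).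
Proof.
move=> gm; rewrite -card_ord_partitions -gm.
pose F (t : #|g|.-tuple 'I_k.+1) : {ffun 'I_n -> 'I_k.+1} :=
  [ffun i => if [pick j : 'I_#|g| | enum_val j == i] is Some j then tnth t j else ord0].
have FE t j : F t (enum_val j) = tnth t j.
  rewrite ffunE; case: pickP => [j' /eqP/enum_val_inj -> //|/(_ j)].
  by rewrite eqxx.
have F0 t i : i \notin g -> F t i = 0%N :> nat.
  rewrite ffunE => ig; case: pickP => // j /eqP ji.
  by have := enum_valP j; rewrite ji (negPf ig).
have Fsum t : (\sum_i F t i = \sum_(i <- t) i)%N.
  rewrite (bigID [in g]) /= [X in (_ + X)%N]big1 ?addn0; last by move=> i /F0.
  rewrite big_enum_val big_tuple; apply: eq_bigr => j _; by rewrite FE.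
have Finj : injective F.
  move=> t t' e; apply: eq_from_tnth => j.
  by rewrite -!FE e.
rewrite -(card_imset _ Finj) -[LHS]cardsE; apply: eq_card => a.
rewrite !inE; apply/idP/imsetP => [/multi_indexP[ag ak]|[t]].
  exists [tuple a (enum_val j) | j < #|g|].
    rewrite inE -Fsum; apply/eqP; rewrite -[RHS]ak; apply: eq_bigr => i _.
    have [ig|ig] := boolP (i \in g); last by rewrite F0 // ag.
    by rewrite -(enum_rankK_in ig ig) FE tnth_mktuple.
  apply/ffunP => i; apply/val_inj.
  have [ig|ig] := boolP (i \in g); last by rewrite /= F0 // ag.
  by rewrite -(enum_rankK_in ig ig) FE tnth_mktuple.
rewrite inE => /eqP tk ->; apply/multi_indexP; split=> [i|]; first exact: F0.
by rewrite Fsum.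
Qed.

(** Nondecreasing sequences are multisets of coordinates. The count is that of the degree j indices
    on the face opposite to a vertex, which matches (H0) with the layers around the vertex. *)
Lemma num_partialsE j : num_partials j = 'C(2 + j, 2).
Proof.
rewrite /num_partials -(bin_sub (leq_addr j 2)) addKn addnC -card_sorted_tuples.
by rewrite cardsE.
Qed.

(** Tool for separating neighbourhoods: for disjoint g and g' the first term on the right is |a|, so
    both distances cannot be small at once. *)
Lemma dist_capcup g g' k (a : {ffun 'I_n -> 'I_k.+1}) :
  (dist a g + dist a g' = dist a (g :&: g') + dist a (g :|: g'))%N.
Proof.
rewrite /dist !(big_mkcond (fun i => i \notin _)) -!big_split /=; apply: eq_bigr => i _.
by rewrite !inE; case: (i \in g); case: (i \in g'); rewrite /= ?addn0.
Qed.

(** Such an index is a pair: its part off g, of degree j, and its part on g lowered by s in every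
    entry, of degree m. *)
Lemma card_split g T k j s m : g \subset T -> (j + #|g| * s + m = k)%N ->
  #|[pred a : {ffun 'I_n -> 'I_k.+1} | [&& multi_index T a, dist a g == j &
     [forall i, (i \in g) ==> (s <= a i)%N]]]| =
  (#|multi_index (T :\: g) (k := j)| * #|multi_index g (k := m)|)%N.
Proof.
move=> gT jk.
pose F (bc : {ffun 'I_n -> 'I_j.+1} * {ffun 'I_n -> 'I_m.+1}) : {ffun 'I_n -> 'I_k.+1} :=
  [ffun i => inord (bc.1 i + bc.2 i + (i \in g) * s)].
pose D : {pred {ffun 'I_n -> 'I_j.+1} * {ffun 'I_n -> 'I_m.+1}} :=
  [predX (multi_index (T :\: g) (k := j)) & (multi_index g (k := m))].
have FE b c i : (b, c) \in D -> F (b, c) i = (b i + c i + (i \in g) * s)%N :> nat.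
  rewrite inE => /andP[/multi_indexP[/= b0 bj] /multi_indexP[/= c0 cm]].
  rewrite ffunE /= inordK // ltnS -jk.
  have bi : (b i <= j)%N by rewrite -ltnS ltn_ord.
  have ci : (c i <= m)%N by rewrite -ltnS ltn_ord.
  case ig : (i \in g) => /=; last by rewrite mul0n addn0; move: bi ci; clear; lia.
  have : (s <= #|g| * s)%N by rewrite leq_pmull // card_gt0; apply/set0Pn; exists i.
  move: (#|g| * s)%N => q sq; rewrite mul1n addnAC.
  by apply: leq_add => //; apply: leq_add.
have Fin b c i : (b, c) \in D -> i \in g -> F (b, c) i = (c i + s)%N :> nat.
  move=> bcD ig; rewrite (FE _ _ _ bcD) ig mul1n.
  move: bcD; rewrite inE => /andP[/multi_indexP[/= b0 _] _].
  by rewrite b0 // !inE ig.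
have Fout b c i : (b, c) \in D -> i \notin g -> F (b, c) i = b i :> nat.
  move=> bcD ig; rewrite (FE _ _ _ bcD) (negPf ig) mul0n addn0.
  move: bcD; rewrite inE => /andP[_ /multi_indexP[/= c0 _]].
  by rewrite c0 // addn0.
have Finj : {in D &, injective F}.
  move=> [b c] [b' c'] h h' e.
  have := h; rewrite inE => /andP[/multi_indexP[/= b0 _] /multi_indexP[/= c0 _]].
  have := h'; rewrite inE => /andP[/multi_indexP[/= b0' _] /multi_indexP[/= c0' _]].
  have E i : F (b, c) i = F (b', c') i :> nat by rewrite e.
  congr (_, _); apply/ffunP => i; apply/val_inj; rewrite /=; have := E i.
    have [ig|ig] := boolP (i \in g); last by rewrite !Fout.
    by rewrite b0 ?b0' // !inE ig.
  have [ig|ig] := boolP (i \in g); last by rewrite c0 ?c0'.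
  by rewrite !Fin // => /addIn.
rewrite -cardX -(card_in_imset Finj); apply: eq_card => a.
rewrite inE; apply/and3P/imsetP => [[/multi_indexP[aT ak] /eqP aj /forallP as_]|[[b c] bcD ->]].
  have [b bP bE] : exists2 b : {ffun 'I_n -> 'I_j.+1}, multi_index (T :\: g) b &
      forall i, b i = (if i \in g then 0 else a i)%N :> nat.
    apply: multi_index_ex => [i|].
      by rewrite !inE negb_and negbK; case: (i \in g) => //= /aT.
    by rewrite -[RHS]aj /dist [RHS]big_mkcond; apply: eq_bigr => i _; rewrite if_neg.
  have [c cP cE] : exists2 c : {ffun 'I_n -> 'I_m.+1}, multi_index g c &
      forall i, c i = (if i \in g then a i - s else 0)%N :> nat.
    apply: multi_index_ex => [i /negPf -> //|].
    have aTP : multi_index T a by apply/multi_indexP.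
    have E := sum_in_multi_index g aTP; rewrite aj in E; rewrite -big_mkcond.
    have E2 : (\sum_(i in g) a i = \sum_(i in g) (a i - s) + #|g| * s)%N.
      rewrite -sum_nat_const -big_split; apply: eq_bigr => i ig /=.
      by have /implyP/(_ ig) := as_ i; move=> h; rewrite subnK.
    move: E jk; rewrite E2; move: (\sum_(i in g) _)%N (#|g| * s)%N => p q; clear; lia.
  have bcD : (b, c) \in D by rewrite inE; apply/andP.
  exists (b, c) => //; apply/ffunP => i; apply/val_inj.
  have [ig|ig] := boolP (i \in g); rewrite /=; last by rewrite (Fout _ _ _ bcD ig) bE (negPf ig).
  by rewrite (Fin _ _ _ bcD ig) cE ig subnK //; have /implyP/(_ ig) := as_ i.
have := bcD; rewrite inE => /andP[/multi_indexP[/= b0 bj] /multi_indexP[/= c0 cm]].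
have sg : (\sum_(i in g) F (b, c) i = m + #|g| * s)%N.
  rewrite (eq_bigr (fun i => c i + s)%N); last by move=> l lg; exact: Fin.
  rewrite big_split sum_nat_const /=; congr addn.
  by rewrite -[RHS]cm [RHS](bigID [in g]) /= [X in _ = (_ + X)%N]big1 ?addn0 // => l; exact: c0.
have sn : (\sum_(i | i \notin g) F (b, c) i = j)%N.
  rewrite (eq_bigr (fun i => b i : nat)); last by move=> l lg; exact: Fout.
  rewrite -[RHS]bj [RHS](bigID [in g]) /= [X in _ = (X + _)%N]big1 ?add0n // => l lg.
  by rewrite b0 // !inE lg.
split.
- apply/multi_indexP; split=> [i iT|].
    have ig : i \notin g by apply: contra iT; exact: (fintype.subsetP gT).
    by rewrite Fout // b0 // !inE negb_and iT orbT.
  by rewrite (bigID [in g]) /= sg sn -jk; lia.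
- by apply/eqP.
- by apply/forallP => i; apply/implyP => ig; rewrite Fin // leq_addl.
Qed.

Lemma sum_unique (I : finType) (P B : pred I) :
  (forall i j, P i -> P j -> B i -> B j -> i = j) ->
  (\sum_(i | P i) B i)%N = [exists i, P i && B i].
Proof.
move=> u; case: existsP => [[i /andP[Pi Bi]]|nex].
  rewrite (bigD1 i) //= Bi big1 // => j /andP[Pj ji].
  by case Bj : (B j) => //; rewrite (u j i Pj Pi Bj Bi) eqxx in ji.
rewrite big1 // => i Pi; case Bi : (B i) => //.
by case: nex; exists i; rewrite Pi.
Qed.

(** Slicing by the value of [d]: indices near a subsimplex are counted layer by layer, as the
    derivatives are counted order by order. *)
Lemma card_nat_lt (I : finType) (P : pred I) (d : I -> nat) a :
  (\sum_(i | P i) (d i < a)%N = \sum_(j < a) #|[pred i | P i && (d i == j)]|)%N.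
Proof.
under [RHS]eq_bigr do rewrite -sum1_card.
under [RHS]eq_bigr => j _ do rewrite (eq_bigl (fun i => P i && (d i == j))) // big_mkcondr.
rewrite exchange_big /=; apply: eq_bigr => i _.
case: ltnP => [da|ad].
  rewrite (bigD1 (Ordinal da)) //= eqxx big1 // => j.
  by rewrite -val_eqE /= eq_sym => /negPf ->.
rewrite big1 // => j _; case: eqP => // e; move: ad.
by rewrite e leqNgt ltn_ord.
Qed.

Variables (T : {set 'I_n}) (rv re rf : int) (k : nat).
Hypotheses (hrf : rf = -1) (hre : -1 <= re) (hrv : Num.max (2 * re) (-1) <= rv)
  (hk : 2 * Num.max rv 0 + 1 <= k%:Z).
Hypothesis T4 : #|T| = 4%N.
Notation mi := {ffun 'I_n -> 'I_k.+1}.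
(** The numbers A and B of layers around a vertex and around an edge; rv and re being at least -1,
    the absolute values change nothing. *)
Let A := `|(rv + 1)%R|%N.
Let B := `|(re + 1)%R|%N.

Let AE : A%:Z = rv + 1.
Proof. by rewrite /A gez0_abs //; have [+ _ _ _ _] := degree_bounds hrf hre hrv hk; lia. Qed.

Let BE : B%:Z = re + 1.
Proof. by rewrite /B gez0_abs //; move: hre; lia. Qed.

Let near (a : mi) := [exists g, Delta 0 T g && (dist a g < A)%N].

(** Two vertices have distances adding up to at least k > 2 rv, so a is near at most one. For two
    edges sharing a vertex, the sum bounds the distance to that vertex, and 2 re <= rv makes a near
    the vertex. For two disjoint edges the sum is at least k > rv >= 2 re. *)
Lemma multi_index_partition (a : mi) : multi_index T a ->
  (1 = bubble_index [:: rv; re; rf] T a + \sum_(g | Delta 0 T g) (dist a g < A)%N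
     + \sum_(e | Delta 1 T e) (~~ near a && (dist a e < B)%N))%N.
Proof.
move=> aT; have [rv1 re2 rev rvk [rk k0]] := degree_bounds hrf hre hrv hk.
have a0 : dist a finset.set0 = k.
  by have := sum_in_multi_index finset.set0 aT; rewrite big_set0 add0n.
rewrite sum_unique -/(near a); last first.
  move=> g g' /andP[gT /cards1P[i ->]] /andP[gT' /cards1P[i' ->]] h h'.
  congr ([set _]%SET); apply: contrapT => ii'.
  have := dist_capcup [set i]%SET [set i']%SET a.
  rewrite (_ : [set i]%SET :&: [set i']%SET = finset.set0).
    rewrite a0 => e; move: h h' e AE rk rvk; clear; lia.
  by apply/setP => l; rewrite !inE; case: eqP => // ->; apply/eqP.
have [na|nna] := boolP (near a).
  rewrite big1 ?addn0 // (_ : bubble_index _ _ _ = false) //.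
  apply/negP => /(@bubble_cellP _ T rv re rf k hrf a)[_ hv _].
  have /existsP[g /andP[/andP[gT /cards1P[i gi]] h]] := na.
  rewrite gi in gT h; have := hv i; rewrite -finset.sub1set => /(_ gT).
  move: h AE; clear; lia.
rewrite addn0 (eq_bigr (fun e => ((dist a e < B)%N : nat))) // sum_unique; last first.
  move=> e e' /andP[eT /eqP e2] /andP[eT' /eqP e2'] h h'.
  apply: contrapT => ee'.
  have := dist_capcup e e' a.
  have : (#|e :&: e'| < 2)%N.
    rewrite -[X in (_ < X)%N]e2 proper_card // finset.properEneq finset.subsetIl andbT.
    apply/eqP => E; apply: ee'; apply/eqP; rewrite eqEcard e2 e2' leqnn andbT.
    by rewrite -E finset.subsetIr.
  case c : #|e :&: e'| => [|[|//]] _.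
    have /eqP := c; rewrite cards_eq0 => /eqP ->; rewrite a0 => E.
    move: h h' E BE rk rvk re2; clear; lia.
  have /eqP/cards1P[i ei] := c; rewrite ei => E.
  have : near a.
    apply/existsP; exists [set i]%SET; rewrite /Delta cards1 andbT.
    rewrite -ei (fintype.subset_trans (finset.subsetIl _ _) eT) /= ei.
    move: h h' E BE AE re2; clear; lia.
  by rewrite (negPf nna).
case: existsP => [[e /andP[/andP[eT /eqP e2] h]]|ne].
  rewrite (_ : bubble_index _ _ _ = false) //.
  apply/negP => /(@bubble_cellP _ T rv re rf k hrf a)[_ _ he].
  have := he e eT e2; move: h BE; clear; lia.
rewrite (_ : bubble_index _ _ _ = true) //.
apply/(@bubble_cellP _ T rv re rf k hrf a); split=> // [i iT|e eT e2]; rewrite ltNge; apply/negP => h.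
  move/negP: nna; apply; apply/existsP; exists [set i]%SET.
  rewrite /Delta finset.sub1set iT cards1 /=; move: h AE; clear; lia.
by case: ne; exists e; rewrite /Delta eT e2 /=; move: h BE; clear; lia.
Qed.

Lemma card_vertex_layer g (j : 'I_A) : Delta 0 T g ->
  #|[pred a : mi | multi_index T a && (dist a g == j)]| = num_partials j.
Proof.
move=> /andP[gT /eqP g1]; have [rv1 _ _ rvk [rk k0]] := degree_bounds hrf hre hrv hk.
have jk : (j <= k)%N by move: (ltn_ord j) AE rvk; clear; lia.
(* With s = 0 the entry at the vertex is unconstrained: it is k - j, and the other three entries add
   up to j. *)
have := @card_split g T k j 0 (k - j) gT; rewrite muln0 addn0 subnKC // => /(_ erefl) E.
rewrite num_partialsE.
transitivity (#|multi_index (T :\: g) (k := j)| * #|multi_index g (k := (k - j)%N)|)%N.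
  rewrite -E; apply: eq_card => a; rewrite !inE.
  have -> : [forall i, (i \in g) ==> (0 <= a i)%N] by apply/forallP => i; rewrite leq0n implybT.
  by rewrite andbT.
rewrite (@card_multi_index g _ 0) // bin0 muln1 (@card_multi_index _ _ 2) //.
by rewrite cardsD (finset.setIidPr gT) T4 g1.
Qed.

(** At distance j from e, being far from both endpoints means that both entries on e are at least A
    - j. This leaves degree k - j - 2 (A - j) = k + j - 2 A on e, against j + 1 choices off e. *)
Lemma card_edge_layer e (j : 'I_B) : Delta 1 T e ->
  #|[pred a : mi | multi_index T a && (~~ near a && (dist a e == j))]| =
  (j.+1 * (k + j + 1 - 2 * A))%N.
Proof.
move=> /andP[eT /eqP e2]; have [rv1 re2 rev rvk [rk k0]] := degree_bounds hrf hre hrv hk.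
have jB := ltn_ord j.
have jA : (j < A)%N by move: jB AE BE rev; clear; lia.
have farE (a : mi) : multi_index T a -> dist a e = j ->
    near a = ~~ [forall i, (i \in e) ==> (A - j <= a i)%N].
  move=> aT aj; have [i0 [i1 [eE i01]]] : exists i0 i1, e = [set i0; i1]%SET /\ i0 != i1.
    by have /eqP/cards2P[i0 [i1 [? ?]]] := e2; exists i0, i1.
  have d1 i i' : [set i; i']%SET = e -> i != i' -> dist a [set i]%SET = (a i' + j)%N.
    move=> ee ii'; rewrite -aj /dist (bigD1 i') /=; last by rewrite inE eq_sym.
    by congr addn; apply: eq_bigl => l; rewrite -ee !inE negb_or.
  have d0 := d1 i0 i1 (esym eE) i01.
  have d1' : dist a [set i1]%SET = (a i0 + j)%N.
    by apply: d1; rewrite ?eE 1?finset.setUC // eq_sym.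
  rewrite negb_forall; apply/existsP/existsP => [[g /andP[/andP[gT /cards1P[i gi]] h]]|[i]].
    rewrite gi in h.
    have [ie|nie] := boolP (i \in e).
      move: ie; rewrite {1}eE !inE => /orP[] /eqP ii; rewrite ii ?d0 ?d1' in h.
        by exists i1; rewrite eE !inE eqxx orbT /= -ltnNge; move: h; clear; lia.
      by exists i0; rewrite eE !inE eqxx /= -ltnNge; move: h; clear; lia.
    (* A vertex off e is at distance at least k - j, too far to be near a. *)
    have : (k <= dist a [set i]%SET + j)%N.
      have := dist_capcup [set i]%SET e a.
      rewrite (_ : [set i]%SET :&: e = finset.set0).
        have := sum_in_multi_index finset.set0 aT; rewrite big_set0 add0n => ->.
        by rewrite aj => ->; rewrite leq_addr.
      by apply/setP => l; rewrite !inE; case: eqP => // ->; rewrite (negPf nie).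
    move: h jA jB AE BE rk rvk re2; clear => h1 h2 h3 h4 h5 h6 h7 h8 h9; exfalso; lia.
  rewrite negb_imply -ltnNge => /andP[ie h].
  move: ie; rewrite {1}eE !inE => /orP[] /eqP ii; rewrite ii in h.
    exists [set i1]%SET; rewrite /Delta cards1 finset.sub1set d1' (fintype.subsetP eT) /=.
      by move: h; clear; lia.
    by rewrite eE !inE eqxx orbT.
  exists [set i0]%SET; rewrite /Delta cards1 finset.sub1set d0 (fintype.subsetP eT) /=.
    by move: h; clear; lia.
  by rewrite eE !inE eqxx.
pose s := (A - j)%N.
have PE : [pred a : mi | multi_index T a && (~~ near a && (dist a e == j))] =i
    [pred a : mi | [&& multi_index T a, dist a e == j & [forall i, (i \in e) ==> (s <= a i)%N]]].
  move=> a; rewrite !inE; case aT : (multi_index T a) => //=.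
  rewrite andbC; case: eqP => //= aj; by rewrite farE // negbK.
rewrite (eq_card PE); have [kA|kA] := leqP (2 * A) (k + j).
  rewrite (@card_split e T k j s (k + j - 2 * A)) //; last first.
    by rewrite e2 /s; move: kA jA; clear; lia.
  rewrite (@card_multi_index _ _ 1) ?(@card_multi_index e _ 1) ?e2 //; last first.
    by rewrite cardsD (finset.setIidPr eT) T4 e2.
  by rewrite !bin1 add1n; congr (_ * _)%N; move: kA; clear; lia.
(* The truncated difference is 0 here, and the entries on e are too small in total for both to reach
   A - j. *)
rewrite (_ : (k + j + 1 - 2 * A = 0)%N) ?muln0; last by move: kA; clear; lia.
apply: eq_card0 => a; rewrite !inE; apply/negP => /and3P[aT /eqP aj /forallP h].
have := sum_in_multi_index e aT; rewrite aj => E.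
have : (\sum_(i in e) s <= \sum_(i in e) a i)%N.
  by apply: leq_sum => i ie; have /implyP/(_ ie) := h i.
rewrite sum_nat_const e2 /s; move: E kA jA; move: (\sum_(i in e) _)%N => q; clear; lia.
Qed.

Lemma card_multi_index_partition :
  (#|multi_index T (k := k)| = #|bubble_index [:: rv; re; rf] T (k := k)| +
    \sum_(g | Delta 0 T g) \sum_(j < A) num_partials j +
    \sum_(e | Delta 1 T e) \sum_(j < B) j.+1 * (k + j + 1 - 2 * A))%N.
Proof.
rewrite -sum1_card (eq_bigr _ multi_index_partition).
rewrite [LHS]big_split [X in addn X _ = _]big_split; congr (_ + _ + _)%N.
- rewrite -sum1_card [RHS]big_mkcond [LHS]big_mkcond; apply: eq_bigr => a _.
  change ((if multi_index T a then bubble_index [:: rv; re; rf] T a : nat else 0%N) =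
    (if bubble_index [:: rv; re; rf] T a then 1%N else 0%N)).
  case: ifPn => [_|nT]; first by case: bubble_index.
  by case: ifPn => // /(@bubble_cellP _ T rv re rf k hrf a)[aT]; rewrite aT in nT.
- rewrite [LHS]exchange_big; apply: eq_bigr => g gT.
  rewrite (card_nat_lt (multi_index T (k := k)) (fun a => dist a g) A); apply: eq_bigr => j _.
  exact: card_vertex_layer.
- rewrite [LHS]exchange_big; apply: eq_bigr => e eT.
  transitivity (\sum_(a : mi | multi_index T a && ~~ near a) (dist a e < B)%N)%N.
    by rewrite [RHS]big_mkcondr; apply: eq_bigr => a _; case: near.
  rewrite (card_nat_lt (fun a => multi_index T a && ~~ near a) (fun a => dist a e) B); apply: eq_bigr => j _.
  by rewrite -(card_edge_layer j eT); apply: eq_card => a; rewrite !inE andbA.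
Qed.

End Counting.

(** * Number of degrees of freedom and the theorem *)

Section DofCount.
Context {R : realType} {n : nat}.
Variables (x : 'M[R]_(n, 3)) (T : {set 'I_n}).
Notation R3 := 'rV[R]_3.
Variables (n1 n2 nf : {set 'I_n} -> R3) (rv re rf : int) (k : nat).
Hypotheses (hrf : rf = -1) (hre : -1 <= re) (hrv : Num.max (2 * re) (-1) <= rv)
  (hk : 2 * Num.max rv 0 + 1 <= k%:Z).
Hypotheses (tT : tetrahedron x T) (nT : normals_of x n1 n2 nf T).

(** Polynomials of degree m = k + j - 2 A on an edge have dimension m + 1; for m < 0 the truncated
    subtraction gives 0, the dimension of {0}. *)
Lemma dimension_edge_test (j : nat) (e : {set 'I_n}) : Delta 1 T e ->
  dimension (edge_test x rv k j e) = ((k + j + 1 - 2 * `|(rv + 1)%R|) * 3)%N.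
Proof.
move=> /andP[eT /eqP e2]; have [rv1 _ _ _ _] := degree_bounds hrf hre hrv hk.
have e0 : e != finset.set0 by rewrite -card_gt0 e2.
rewrite /edge_test; set A := `|(rv + 1)%R|%N.
have -> : rv + 1 = A%:Z by rewrite /A gez0_abs //; move: rv1; clear; lia.
have [kA|kA] := leqP (2 * A) (k + j).
  have -> : k%:Z - 2 * A%:Z + j%:Z = (k + j - 2 * A)%N%:Z by move: kA; clear; lia.
  rewrite (dimension_restr_poly_le tT) // (@card_multi_index _ e _ 1) // bin1; congr (_ * _)%N.
  by move: kA; clear; lia.
have -> : k%:Z - 2 * A%:Z + j%:Z = Negz (2 * A - (k + j)).-1.
  by rewrite NegzE; move: kA; clear; lia.
rewrite dimension_restr_poly_le_neg; by move: kA; clear; lia.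
Qed.

Lemma num_dofs_dimension : num_dofs x nf rv re rf k T = dimension (@Pvec R k).
Proof.
rewrite /Pvec (dimension_poly_le tT k) (card_multi_index_partition hrf hre hrv hk tT.1).
rewrite /num_dofs !mulnDl.
have -> : (\sum_(f | Delta 2 T f) dimension (V := R3 -> R^o) (face_test x rv re k f) =
    \sum_(f | Delta 2 T f) #|bubble_index [:: rv; re] f (k := k)|)%N.
  by apply: eq_bigr => f; exact: dimension_face_test.
(* The bubble indices, taken for three components, account for (H2) and (H3) together. *)
rewrite -(dimension_cell_test tT hrf hre hrv hk nT).
rewrite -addnA [X in addn _ X = _]addnC -[RHS]addnA [RHS]addnC.
congr (_ + _ + _)%N.
- rewrite big_distrl; apply: eq_bigr => g _; by rewrite big_distrl.
- rewrite big_distrl; apply: eq_bigr => e eT; rewrite big_distrl; apply: eq_bigr => j _.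
  under eq_bigr do rewrite (dimension_edge_test j eT).
  by rewrite sum_nat_const card_ord mulnA.
Qed.

Lemma unisolvence (v : R3 -> R3) : Pvec k v ->
  (forall (g : {set 'I_n}) N, g \subset T -> dof x n1 n2 nf rv re rf k g N -> N v = 0) -> v = 0.
Proof.
move=> vP dof0.
have /choice[C vC] : forall c, exists C : {ffun 'I_n -> 'I_k.+1} -> R,
    (fun p => v p 0 c) = bernstein_comb x T C.
  move=> c; have /(poly_le_bernstein tT)/lspan_pointwise[C h] := vP c.
  by exists C; exact/funext.
exact: (cell_dofs hrf hre hrv hk tT nT dof0 vC).
Qed.

End DofCount.

Theorem theorem3p10 (R : realType) (rv re rf : int) (k : nat)
  (hrf : rf = -1) (hre : -1 <= re) (hrv : Num.max (2 * re) (-1) <= rv)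
  (hk : 2 * Num.max rv 0 + 1 <= k%:Z)
  (n : nat) (x : 'M[R]_(n, 3)) (n1 n2 nf : {set 'I_n} -> 'rV[R]_3) :
  (forall T : {set 'I_n}, tetrahedron x T -> normals_of x n1 n2 nf T ->
     num_dofs x nf rv re rf k T = dimension (@Pvec R k) /\
     (forall v : 'rV[R]_3 -> 'rV[R]_3, Pvec k v ->
        (forall (g : {set 'I_n}) N, g \subset T -> dof x n1 n2 nf rv re rf k g N -> N v = 0) ->
        v = 0)) /\
  (forall (Omega : set 'rV[R]_3) (Th : {set {set 'I_n}}),
     is_domain Omega -> conforming_mesh x Omega Th ->
     (forall T, T \in Th -> normals_of x n1 n2 nf T) ->
     let V := Vdiv x n1 n2 nf rv re rf k Omega Th in
     [/\ V `<=` Hdiv Omega, V 0 &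
         forall (a : R) v w, V v -> V w -> V (a *: v + w)]).
Proof.
split=> [T tT nT|Omega Th [oO _ _] [tet _ _] nT V].
  split; first exact: (num_dofs_dimension hrf hre hrv hk tT nT).
  exact: (unisolvence hrf hre hrv hk tT nT).
split=> [v []//||a v w [vH [p [pT pdof]]] [wH [q [qT qdof]]]].
  split; first exact: Hdiv0.
  exists (fun=> 0); split=> // T TT; split; last by apply: aeW.
  move=> c; rewrite (_ : (fun z => _) = (0 : 'rV[R]_3 -> R^o)); first exact: lspan0.
  by apply/funext => z; rewrite mxE.
split; first exact: Hdiv_comb.
(* The polynomial pieces combine like the fields: almost everywhere identities survive intersection,
   and the degrees of freedom are linear on the pieces. *)
exists (fun T => a *: p T + q T); split=> [T TT|T T' g TT TT' gT gT' N dN].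
  have [pP pae] := pT T TT; have [qP qae] := qT T TT; split.
    move=> c; rewrite field_comp_comb.
    exact: (lspanD (lspanZ a (pP c)) (qP c)).
  have F : Filter (almost_everywhere (@leb3 R)) by exact: ae_filter_ringOfSetsType.
  apply: filterS2 pae qae => u pu qu uT.
  by rewrite -[LHS]/(a *: v (toR3 u) + w (toR3 u)) pu // qu.
have pP U (UT : U \in Th) := Pvec_polyfield (pT U UT).1.
have qP U (UT : U \in Th) := Pvec_polyfield (qT U UT).1.
rewrite (dof_linear (tet T TT) a gT dN (pP T TT) (qP T TT)).
rewrite (dof_linear (tet T' TT') a gT' dN (pP T' TT') (qP T' TT')).
by rewrite (pdof T T' g) // (qdof T T' g).
Qed.
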